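(* Let $(M,g)$ and $(M,g')$ be space-times (on the same manifold $M$) with Levi-Civita connections $\nabla$ and $\nabla'$ respectively, with $(M,g)$ non-flat and of holonomy type $R_6$, $R_8$ or $R_{12}$. Suppose that $\nabla$ and $\nabla'$ are projectively related. Then $\nabla=\nabla'$ on $M$.
   Context: A space-time $(M,g)$ is a 4-dimensional, Hausdorff, connected, smooth manifold $M$ with a smooth metric $g$ of Lorentz signature $(-,+,+,+)$. It is non-flat if its curvature tensor $\mathrm{Riem}$ does not vanish identically on any non-empty open subset of $M$. Projectively related: $\nabla$ and $\nabla'$ (or $g$ and $g'$) are projectively related if their sets of unparametrised geodesics (geodesic paths) coincide; equivalently there is a global smooth 1-form $\psi$ on $M$ with $\Gamma'^a_{bc}-\Gamma^a_{bc}=\delta^a_b\psi_c+\delta^a_c\psi_b$ in every coordinate domain. Bivectors: for $m\in M$ and $p,q\in T_mM$, $p\wedge q$ denotes the bivector $F^{ab}=p^aq^b-q^ap^b$, identified (using $g(m)$) with the skew-self-adjoint endomorphism $F^a{}_b=F^{ac}g_{cb}$ of $T_mM$. A null tetrad at $m$ is a basis $l,n,x,y$ of $T_mM$ whose only non-vanishing inner products are $g(l,n)=g(x,x)=g(y,y)=1$. Holonomy type: let $\phi$ be the Lie algebra of the holonomy group of $\nabla$ at a point $m\in M$, regarded as a Lie algebra of skew-self-adjoint endomorphisms (bivectors) of $T_mM$. $(M,g)$ is of holonomy type $R_6$, $R_8$, $R_{12}$ if, for some null tetrad $l,n,x,y$ at $m$, $\phi$ is, respectively: the 2-dimensional algebra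 spanned by $l\wedge n,\ l\wedge x$ (type $R_6$); the 2-dimensional algebra spanned by $l\wedge x,\ l\wedge y$ (type $R_8$); the 3-dimensional algebra spanned by $l\wedge x,\ l\wedge y,\ l\wedge n+\omega\,(x\wedge y)$ for some real $\omega\neq 0$ (type $R_{12}$). (The type does not depend on the choice of $m$.) *)

(* Defs.v *)
From HB Require Import structures.
From mathcomp Require Import all_boot all_order all_algebra.
From mathcomp Require Import all_classical all_reals all_analysis.
Set Implicit Arguments.
Unset Strict Implicit.
Unset Printing Implicit Defensive.
Import Order.TTheory GRing.Theory Num.Theory.
Import numFieldNormedType.Exports.
Local Open Scope classical_set_scope.
Local Open Scope ring_scope.

(* Points of R^4 and components of tangent vectors are columns, so that a
   (1,1)-tensor F^a_b is a matrix with row index a acting by F *m v. *)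

Section Calculus.
Context {R : realType}.

Definition partial (V : normedModType R) (b : 'I_4) (f : 'cV[R]_4 -> V) :
  'cV[R]_4 -> V := fun x => 'D_(delta_mx b 0) f x.

Definition partials (V : normedModType R) (s : seq 'I_4) (f : 'cV[R]_4 -> V) :
  'cV[R]_4 -> V := foldr (@partial V) f s.

(* C^infinity on an open set U: the iterated partial derivatives of all orders
   exist and are continuous on U. *)
Definition smooth_on (V : normedModType R) (U : set 'cV[R]_4)
    (f : 'cV[R]_4 -> V) : Prop :=
  forall (s : seq 'I_4) (x : 'cV[R]_4), U x ->
    {for x, continuous (partials s f)} /\
    forall b : 'I_4, derivable (partials s f) x (delta_mx b 0).

Definition smooth_curve_on (V : normedModType R) (D : set R) (f : R -> V) :
  Prop := forall (k : nat) (t : R), D t -> derivable (derive1n k f) t 1.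

End Calculus.

Record manifold4 (R : realType) := Manifold4 {
  mcarrier :> topologicalType ;
  mindex : Type ;
  mdom : mindex -> set mcarrier ;
  mto : mindex -> mcarrier -> 'cV[R]_4 ;
  mfrom : mindex -> 'cV[R]_4 -> mcarrier ;
  mhausdorff : hausdorff_space mcarrier ;
  mconnected : connected [set: mcarrier] ;
  mcover : forall p : mcarrier, exists i : mindex, mdom i p ;
  mdom_open : forall i : mindex, open (mdom i) ;
  mrange_open : forall i : mindex, open (mto i @` mdom i) ;
  mtoK : forall (i : mindex) (p : mcarrier), mdom i p -> mfrom i (mto i p) = p ;
  mto_continuous : forall i : mindex, {within mdom i, continuous (mto i)} ;
  mfrom_continuous : forall i : mindex,
    {within mto i @` mdom i, continuous (mfrom i)} ;
  mtrans_smooth : forall i j : mindex,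
    smooth_on (mto i @` (mdom i `&` mdom j)) (mto j \o mfrom i) }.

Arguments mindex {R} m.
Arguments mdom {R} m i p.
Arguments mto {R} m i p.
Arguments mfrom {R} m i x.

Section Geometry.
Context {R : realType} (M : manifold4 R).

Definition mrange (i : mindex M) : set 'cV[R]_4 := mto M i @` mdom M i.

(* (dx_j^a / dx_i^b) at the point with coordinates x in chart i *)
Definition jac (i j : mindex M) (x : 'cV[R]_4) : 'M[R]_4 :=
  \matrix_(a, b) partial b (fun y => mto M j (mfrom M i y) a 0) x.

Definition minkowski : 'M[R]_4 :=
  diag_mx (\row_(k < 4) (if k == ord0 then - 1 else 1)).

Definition lorentz_signature (h : 'M[R]_4) : Prop :=
  exists2 P : 'M[R]_4, P \in unitmx & P^T *m h *m P = minkowski.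

(* A metric is given by its components g_ab in each chart, as functions of the
   coordinates. *)
Record lorentz_metric := LorentzMetric {
  gcomp :> mindex M -> 'cV[R]_4 -> 'M[R]_4 ;
  gcomp_smooth : forall i : mindex M, smooth_on (mrange i) (gcomp i) ;
  gcomp_sym : forall (i : mindex M) (x : 'cV[R]_4),
    mrange i x -> (gcomp i x)^T = gcomp i x ;
  gcomp_lorentz : forall (i : mindex M) (x : 'cV[R]_4),
    mrange i x -> lorentz_signature (gcomp i x) ;
  gcomp_tensor : forall (i j : mindex M) (p : M), mdom M i p -> mdom M j p ->
    gcomp i (mto M i p) =
    (jac i j (mto M i p))^T *m gcomp j (mto M j p) *m jac i j (mto M i p) }.

(* Gamma^a_bc *)
Definition christoffel (g : lorentz_metric) (i : mindex M) (x : 'cV[R]_4)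
    (a b c : 'I_4) : R :=
  2^-1 * \sum_(d < 4) invmx (g i x) a d *
    (partial b (fun y => g i y d c) x + partial c (fun y => g i y d b) x
     - partial d (fun y => g i y b c) x).

(* R^a_bcd *)
Definition riemann (g : lorentz_metric) (i : mindex M) (x : 'cV[R]_4)
    (a b c d : 'I_4) : R :=
  partial c (fun y => christoffel g i y a d b) x
  - partial d (fun y => christoffel g i y a c b) x
  + \sum_(e < 4) (christoffel g i x a c e * christoffel g i x e d b
                  - christoffel g i x a d e * christoffel g i x e c b).

Definition non_flat (g : lorentz_metric) : Prop :=
  forall U : set M, open U -> U !=set0 ->
    exists (p : M) (i : mindex M) (a b c d : 'I_4),
      [/\ U p, mdom M i p & riemann g i (mto M i p) a b c d != 0].

(* Affinely parametrised, non-constant geodesic defined on the open interval D;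
   c is irrelevant outside D. *)
Definition geodesic (g : lorentz_metric) (D : set R) (c : R -> M) : Prop :=
  forall t : R, D t -> {for t, continuous c} /\
    forall i : mindex M, mdom M i (c t) ->
      let x : R -> 'cV[R]_4 := fun s => mto M i (c s) in
      [/\ derivable x t 1, derive1 x t != 0 &
          is_derive t 1 (derive1 x)
            (- \col_a \sum_(b < 4) \sum_(d < 4)
                 christoffel g i (x t) a b d * derive1 x t b 0
                                             * derive1 x t d 0)].

Definition open_interval (D : set R) : Prop := open D /\ is_interval D.

(* s is a regular smooth change of parameter from the interval D' onto D (it is
   then automatically injective on D'). *)
Definition reparametrisation (D' D : set R) (s : R -> R) : Prop :=
  [/\ smooth_curve_on D' s, forall t : R, D' t -> derive1 s t != 0 &
      s @` D' = D].

(* The parametrised curve c on D traces out a geodesic path.  The interval D' is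
   not assumed bounded, even if D is. *)
Definition unparametrised_geodesic (g : lorentz_metric) (D : set R)
    (c : R -> M) : Prop :=
  exists (D' : set R) (s : R -> R),
    [/\ open_interval D', reparametrisation D' D s & geodesic g D' (c \o s)].

Definition projectively_related (g g' : lorentz_metric) : Prop :=
  forall (D : set R) (c : R -> M), open_interval D ->
    (unparametrised_geodesic g D c <-> unparametrised_geodesic g' D c).

(* The columns of E are the parallel transports, along the coordinate curve x in
   chart i, of the coordinate basis at x(0):
   dE^a_k/dt = - Gamma^a_bd (dx^b/dt) E^d_k. *)
Definition parallel_frame (g : lorentz_metric) (i : mindex M)
    (x : R -> 'cV[R]_4) (E : R -> 'M[R]_4) : Prop :=
  E 0 = 1%:M /\
  forall t : R, 0 <= t <= 1 ->
    is_derive t 1 E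
      (- ((\matrix_(a, d) \sum_(b < 4)
             christoffel g i (x t) a b d * derive1 x t b 0) *m E t)).

(* transport g i p j q T: some piecewise smooth curve from p to q has parallel
   transport T_p M -> T_q M with matrix T, in the bases given by chart i at p
   and chart j at q.  By compactness a piecewise smooth curve is a finite
   concatenation of smooth arcs, each contained in one coordinate domain; a
   smooth arc on [0,1] extends to a smooth function on the whole line. *)
Inductive transport (g : lorentz_metric) :
    mindex M -> M -> mindex M -> M -> 'M[R]_4 -> Prop :=
| transport_arc (i : mindex M) (x : R -> 'cV[R]_4) (E : R -> 'M[R]_4) :
    smooth_curve_on setT x ->
    (forall t : R, 0 <= t <= 1 -> mrange i (x t)) ->
    parallel_frame g i x E ->
    transport g i (mfrom M i (x 0)) i (mfrom M i (x 1)) (E 1)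
| transport_chart (i j : mindex M) (p : M) :
    mdom M i p -> mdom M j p ->
    transport g i p j p (jac i j (mto M i p))
| transport_comp (i j k : mindex M) (p q r : M) (S T : 'M[R]_4) :
    transport g i p j q S -> transport g j q k r T ->
    transport g i p k r (T *m S).

(* The holonomy group at p, as matrices in the coordinate basis of chart i. *)
Definition holonomy_group (g : lorentz_metric) (i : mindex M) (p : M) :
  set 'M[R]_4 := [set T | transport g i p i p T].

(* The Lie algebra of a group G of invertible matrices: the velocities at the
   identity of the C^1 curves in G.  For G a (not necessarily closed) Lie
   subgroup of GL_4 this is its tangent space at the identity; being C^1, and
   not merely differentiable at 0, matters when G is not closed. *)
Definition lie_algebra (G : set 'M[R]_4) : set 'M[R]_4 :=
  [set A | exists f : R -> 'M[R]_4,
     [/\ f 0 = 1%:M, forall t : R, G (f t), forall t : R, derivable f t 1,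
         continuous (derive1 f) & derive1 f 0 = A]].

Definition inner (h : 'M[R]_4) (v w : 'cV[R]_4) : R := (v^T *m h *m w) 0 0.

Definition null_tetrad (h : 'M[R]_4) (l n x y : 'cV[R]_4) : Prop :=
  [/\ basis_of fullv [:: l; n; x; y],
      [/\ inner h l n = 1, inner h x x = 1 & inner h y y = 1],
      [/\ inner h l l = 0, inner h n n = 0 & inner h x y = 0],
      inner h l x = 0 /\ inner h l y = 0 &
      inner h n x = 0 /\ inner h n y = 0].

(* p wedge q as the endomorphism F^a_b = (p^a q^c - q^a p^c) h_cb *)
Definition wedge (h : 'M[R]_4) (p q : 'cV[R]_4) : 'M[R]_4 :=
  (p *m q^T - q *m p^T) *m h.

(* Common part of the definitions of the types: at some point, and for some null
   tetrad there, the holonomy algebra is spanned by the family B. *)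
Definition holonomy_spanned (g : lorentz_metric)
    (B : ('cV[R]_4 -> 'cV[R]_4 -> 'M[R]_4) ->
         'cV[R]_4 -> 'cV[R]_4 -> 'cV[R]_4 -> 'cV[R]_4 -> seq 'M[R]_4) : Prop :=
  exists (p : M) (i : mindex M) (l n x y : 'cV[R]_4),
    let h := g i (mto M i p) in
    [/\ mdom M i p, null_tetrad h l n x y &
        forall A : 'M[R]_4, lie_algebra (holonomy_group g i p) A <->
          A \in <<B (wedge h) l n x y>>%VS].

Definition holonomy_R6 (g : lorentz_metric) : Prop :=
  holonomy_spanned g (fun w l n x y => [:: w l n; w l x]).

Definition holonomy_R8 (g : lorentz_metric) : Prop :=
  holonomy_spanned g (fun w l n x y => [:: w l x; w l y]).

Definition holonomy_R12 (g : lorentz_metric) : Prop :=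
  exists2 omega : R, omega != 0 &
    holonomy_spanned g
      (fun w l n x y => [:: w l x; w l y; w l n + omega *: w x y]).

Definition same_connection (g g' : lorentz_metric) : Prop :=
  forall (i : mindex M) (p : M), mdom M i p -> forall a b c : 'I_4,
    christoffel g i (mto M i p) a b c = christoffel g' i (mto M i p) a b c.

End Geometry.

(* Main.v *)
Require Import Defs.
From HB Require Import structures.
From mathcomp Require Import all_boot all_order all_algebra.
From mathcomp Require Import all_classical all_reals all_analysis.
From mathcomp Require Import perm ring lra.
Set Implicit Arguments.
Unset Strict Implicit.
Unset Printing Implicit Defensive.
Import Order.TTheory GRing.Theory Num.Theory.
Import numFieldNormedType.Exports.
Local Open Scope classical_set_scope.
Local Open Scope ring_scope.

(* Projective relatedness gives [Gamma'^a_bc - Gamma^a_bc = delta^a_b psi_c +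
   delta^a_c psi_b] with [2 psi = d ln rho], [rho = |det g' / det g|^(1/5)].  In
   terms of [sigma = rho g'^-1] and [Lam = - sigma psi] this is the Sinjukov equation
   [nabla_c sigma^ab = delta_c^a Lam^b + delta_c^b Lam^a], and [Gamma' = Gamma]
   amounts to [Lam = 0].

   The curvature at any point, transported to the base point, lies in the holonomy
   algebra, because it is the infinitesimal holonomy of small parallelograms.  By
   the pair symmetry of the curvature tensor, every bivector [W] orthogonal to the
   holonomy algebra is killed by the curvature, and the Ricci identity for [sigma]
   then makes [(nabla Lam) W] skew.  For the three holonomy types this forces
   [nabla Lam = kap 1]; the Ricci identity for [Lam] gives [d kap = 0] and
   [Riem Lam = 0].  Hence [Lam] is orthogonal to the null direction [l] wherever the
   curvature is nonzero; differentiating along [n] gives [kap = 0] there, and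
   everywhere by density.  So [Lam] is parallel and killed by the holonomy algebra:
   [Lam = 0] for type R12, [Lam = a y] for R6 and [Lam = a l] for R8.  In the last two
   cases the curvature commutes with [sigma], which has [l] as an eigenvector, and
   differentiating the eigenvalue relations along [n] gives [a = 0]. *)

(** * Calculus of matrix-valued functions *)

(** Both hypotheses speak of actual curves and become tensor identities only through differential
    equations. Projective relatedness concerns unparametrised geodesics, so the difference of the
    connections can be tested on a tangent vector only once a geodesic with that initial velocity
    exists; hence the Picard theorem. The holonomy algebra consists of velocities of C^1 curves in
    the group, so curvature enters it through explicit loops whose transport depends on a parameter
    with continuous derivative; hence the study of linear equations in a parameter. All three
    algebras lie in the span of [l ∧ n], [l ∧ x], [l ∧ y], [x ∧ y], the stabiliser of the null
    direction [l]. What they share is that an element without [l ∧ n] part has no rotation part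
    [x ∧ y]; this makes the kernel of a nonzero curvature endomorphism orthogonal to [l]. They
    differ in fixed vectors: R12 has none except 0, so a parallel [Lam] vanishes at once, while R6
    fixes [y] and R8 fixes [l]. There the parallel field survives linear algebra, and only the
    eigenvalues of [sigma] along a curve exclude it. *)

Section MatrixCalculus.
Context {R : realType}.

Lemma mx_entry_le m n (A : 'M[R]_(m, n)) i j : `|A i j| <= `|A|.
Proof.
by rewrite [leRHS]/Num.Def.normr/= mx_normrE; exact: (le_bigmax _ _ (i, j)).
Qed.

Lemma mx_norm_le m n (A : 'M[R]_(m, n)) (C : R) : 0 <= C ->
  (forall i j, `|A i j| <= C) -> `|A| <= C.
Proof.
move=> C0 AC; rewrite [leLHS]/Num.Def.normr/= mx_normrE.
by apply: bigmax_le => // -[i j] _; exact: AC.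
Qed.

Lemma mulmx_norm_le m n p (A : 'M[R]_(m, n)) (B : 'M[R]_(n, p)) :
  `|A *m B| <= n%:R * `|A| * `|B|.
Proof.
apply: mx_norm_le => [|i j]; first by rewrite !mulr_ge0.
rewrite mxE (le_trans (ler_norm_sum _ _ _))//.
have -> : n%:R * `|A| * `|B| = \sum_(k < n) `|A| * `|B|.
  by rewrite sumr_const card_ord -mulrA mulr_natl.
by apply: ler_sum => k _; rewrite normrM ler_pM // mx_entry_le.
Qed.

Lemma is_derive_mxP (V : normedModType R) m n (f : V -> 'M[R]_(m, n)) x v D :
  is_derive x v f D <->
  forall i j, is_derive x v (fun y => f y i j) (D i j).
Proof.
split=> [[df <-] i j|df].
  split; first by move/derivable_mxP: df; exact.
  by rewrite derive_mx// mxE.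
have d : derivable f x v by apply/derivable_mxP => i j; case: (df i j).
split => //; rewrite derive_mx//; apply/matrixP => i j; rewrite mxE.
by case: (df i j).
Qed.

Lemma is_derive_big (V W : normedModType R) (I : Type) (r : seq I)
    (f : I -> V -> W) x v (df : I -> W) :
  (forall i, is_derive x v (f i) (df i)) ->
  is_derive x v (fun y => \sum_(i <- r) f i y) (\sum_(i <- r) df i).
Proof.
move=> fi; elim: r => [|i r IH].
  rewrite big_nil (_ : (fun _ => _) = cst 0); first exact: is_derive_cst.
  by apply/funext => y; rewrite big_nil.
rewrite big_cons.
rewrite (_ : (fun _ => _) = f i + (fun y => \sum_(j <- r) f j y)).
  exact: is_deriveD.
by apply/funext => y; rewrite big_cons.
Qed.

Lemma is_derive_mul (V : normedModType R) (f h : V -> R) x v df dh :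
  is_derive x v f df -> is_derive x v h dh ->
  is_derive x v (fun y => f y * h y) (df * h x + f x * dh).
Proof.
move=> Hf Hh; have := @is_deriveM _ _ f h x v df dh Hf Hh.
by congr is_derive; rewrite addrC /GRing.scale/= [h x * _]mulrC.
Qed.

Lemma is_derive_mulmx (V : normedModType R) m n p (A : V -> 'M[R]_(m, n))
    (B : V -> 'M[R]_(n, p)) x v A' B' :
  is_derive x v A A' -> is_derive x v B B' ->
  is_derive x v (fun y => A y *m B y) (A' *m B x + A x *m B').
Proof.
move=> /is_derive_mxP HA /is_derive_mxP HB; apply/is_derive_mxP => i j.
have -> : (fun y => (A y *m B y) i j) = (fun y => \sum_k A y i k * B y k j).
  by apply/funext => y; rewrite mxE.
have -> : (A' *m B x + A x *m B') i j =
    \sum_k (A' i k * B x k j + A x i k * B' k j).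
  by rewrite !mxE big_split.
by apply: is_derive_big => k; exact: is_derive_mul.
Qed.

Lemma is_derive_trmx (V : normedModType R) m n (A : V -> 'M[R]_(m, n)) x v A' :
  is_derive x v A A' -> is_derive x v (fun y => (A y)^T) A'^T.
Proof.
move=> /is_derive_mxP HA; apply/is_derive_mxP => i j; rewrite mxE.
by rewrite (_ : (fun _ => _) = (fun y => A y j i))//; apply/funext => y; rewrite mxE.
Qed.

Lemma is_derive_continuous (W : normedModType R) (f : R -> W) (t : R) d :
  is_derive t 1 f d -> {for t, continuous f}.
Proof.
by move=> [/derivable1_diffP df _]; exact: differentiable_continuous.
Qed.

Lemma is_derive_derive1 (W : normedModType R) (f : R -> W) (t : R) d :
  is_derive t 1 f d -> derive1 f t = d.
Proof. by move=> [_ <-]; rewrite derive1E. Qed.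

Lemma is_derive_near_eq (V W : normedModType R) (f h : V -> W) x v d :
  (\near x, f x = h x) -> is_derive x v f d -> is_derive x v h d.
Proof. exact: near_eq_is_derive. Qed.

Lemma is_derive_uniq (V W : normedModType R) (f : V -> W) x v d d' :
  is_derive x v f d -> is_derive x v f d' -> d = d'.
Proof. by move=> [_ <-] [_ <-]. Qed.

Lemma is_derive_comp1 (W : normedModType R) (f : R -> W) (s : R -> R) (t : R) d s' :
  is_derive (s t) 1 f d -> is_derive t 1 s s' ->
  is_derive t 1 (fun u => f (s u)) (s' *: d).
Proof.
move=> [df <-] [ds <-].
have Df : differentiable f (s t) by apply/derivable1_diffP.
have Ds : differentiable s t by apply/derivable1_diffP.
have Dc : differentiable (f \o s) t by exact: differentiable_comp.
split; first by apply/derivable1_diffP.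
rewrite -[LHS]/('D_1 (f \o s) t) -derive1E derive1E' // diff_comp //= deriv1E //.
by rewrite -!derive1E -derive1E'.
Qed.

(** The matrix norm is the largest absolute value of an entry, so the scalar mean value theorem may
    be applied to each entry, with its own intermediate point, without worsening the constant. *)
Lemma mvt_mx m n (f df : R -> 'M[R]_(m, n)) (a b C : R) : a <= b -> 0 <= C ->
  (forall t, a <= t <= b -> is_derive t 1 f (df t)) ->
  (forall t, a <= t <= b -> `|df t| <= C) ->
  `|f b - f a| <= C * (b - a).
Proof.
move=> ab C0 fdf dfC; apply: mx_norm_le => [|i j].
  by rewrite mulr_ge0 // subr_ge0.
have fij t : a <= t <= b -> is_derive t 1 (fun u => f u i j) (df t i j).
  by move=> /fdf /is_derive_mxP; exact.
rewrite !mxE.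
have [| |c cab ->] := @MVT_segment _ (fun u => f u i j) (fun u => df u i j) a b ab.
- by move=> x /[!in_itv]/= /andP[ax xb]; apply: fij; rewrite !ltW.
- apply: derivable_within_continuous => x /[!in_itv]/= xab.
  by case: (fij x xab).
rewrite normrM (ger0_norm (_ : 0 <= b - a)) ?subr_ge0 // ler_wpM2r ?subr_ge0 //.
exact: le_trans (mx_entry_le _ _ _) (dfC _ cab).
Qed.

Lemma derive0_cst_mx m n (f : R -> 'M[R]_(m, n)) (a b : R) :
  (forall t, a <= t <= b -> is_derive t 1 f 0) ->
  forall t, a <= t <= b -> f t = f a.
Proof.
move=> f0 t /andP[at_ tb]; apply/eqP; rewrite -subr_eq0 -normr_le0.
rewrite -[leRHS](mul0r (t - a)); apply: (@mvt_mx _ _ _ (cst 0)) => //= u; last first.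
  by rewrite normr0.
by case/andP=> au ut; apply: f0; rewrite au (le_trans ut tb).
Qed.

(** A derivative that exists can be computed from one side. Identities known only on [[0, 1]] can
    therefore be differentiated at the end point 0. *)
Lemma is_derive_right_cst (V : normedModType R) (f : R -> V) (t s : R) d c :
  t < s -> (forall u, t <= u <= s -> f u = c) -> is_derive t 1 f d -> d = 0.
Proof.
move=> ts fc [df <-].
rewrite /derive cvg_at_rightE //; apply/cvg_lim => //.
apply: (@cvg_trans _ (cst 0 @ 0^'+)); last exact: cvg_cst.
apply: near_eq_cvg; near=> h; rewrite /= fc ?fc ?subrr ?scaler0 //.
  by rewrite lexx ltW.
rewrite /GRing.scale /= mulr1 lerDr -lerBrDr; apply/andP; split.
  by near: h; exact: nbhs_right_ge.
by near: h; apply: nbhs_right_le; rewrite subr_gt0.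
Unshelve. all: by end_near. Qed.

Lemma continuous_entry (T : topologicalType) m n (f : T -> 'M[R]_(m, n)) x i j :
  {for x, continuous f} -> {for x, continuous (fun y => f y i j)}.
Proof.
move=> fc; apply: (@continuous_comp _ _ _ f (fun A : 'M[R]_(m, n) => A i j)) => //.
exact: coord_continuous.
Qed.

Lemma continuous_mx (T : topologicalType) m n (f : T -> 'M[R]_(m, n)) x :
  (forall i j, {for x, continuous (fun y => f y i j)}) -> {for x, continuous f}.
Proof.
move=> fc; apply/cvgrPdist_le => e e0.
have : \forall y \near x, forall ij : 'I_m * 'I_n, `|f x ij.1 ij.2 - f y ij.1 ij.2| <= e.
  apply: filter_forall => -[i j] /=.
  by have /cvgrPdist_le/(_ _ e0) := fc i j.
apply: filterS => y H; apply: mx_norm_le => [|i j]; first exact: ltW.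
by rewrite !mxE; exact: (H (i, j)).
Qed.

Lemma primitive_exists (f : R -> R) (a b : R) : continuous f ->
  exists F : R -> R, forall t, a < t < b -> is_derive t 1 F (f t).
Proof.
move=> fc; exists (fun x => \int[lebesgue_measure]_(t in `[a, x]) f t) => t /andP[ta tb].
have [] := @continuous_FTC1_closed _ f a t b tb _ ta (fc t).
  apply: continuous_compact_integrable; first exact: segment_compact.
  exact: continuous_subspaceT.
by move=> dF <-; apply: DeriveDef; [exact: dF|rewrite derive1E].
Qed.

Lemma primitive_mx_exists m n (f : R -> 'M[R]_(m, n)) (a b t0 : R) y0 :
  continuous f -> exists2 F : R -> 'M[R]_(m, n),
    F t0 = y0 & forall t, a < t < b -> is_derive t 1 F (f t).
Proof.
move=> fc.
have fij i j : continuous (fun t => f t i j).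
  by move=> t; apply: (@continuous_entry _ _ _ f t i j); exact: fc.
have /choice[F HF] : forall ij : 'I_m * 'I_n, exists F : R -> R,
    forall t, a < t < b -> is_derive t 1 F (f t ij.1 ij.2).
  by move=> [i j]; exact: primitive_exists.
exists (fun t => \matrix_(i, j) (F (i, j) t - F (i, j) t0) + y0).
  by apply/matrixP => i j; rewrite !mxE subrr add0r.
move=> t tab; apply/is_derive_mxP => i j; rewrite -[f t i j]addr0.
rewrite (_ : (fun _ => _) = F (i, j) + cst (- F (i, j) t0 + y0 i j)).
  by apply: is_deriveD; exact: HF.
by apply/funext => u; rewrite !mxE addrA.
Qed.

Lemma mvt_mx_sym m n (f df : R -> 'M[R]_(m, n)) (T C : R) : 0 <= C ->
  (forall t : R, `|t| <= T -> is_derive t 1 f (df t)) ->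
  (forall t, `|t| <= T -> `|df t| <= C) ->
  forall t, `|t| <= T -> `|f t - f 0| <= C * T.
Proof.
move=> C0 fdf dfC t tT.
have [t0|t0] := leP 0 t.
  have sT s : 0 <= s <= t -> `|s| <= T.
    by case/andP=> s0 st; rewrite ger0_norm // (le_trans st) // -[t]ger0_norm.
  apply: (@le_trans _ _ (C * (t - 0))); last first.
    by rewrite subr0 ler_wpM2l // (le_trans _ tT) // ler_norm.
  by apply: (@mvt_mx _ _ f df) => // s /sT; [exact: fdf|exact: dfC].
have sT s : t <= s <= 0 -> `|s| <= T.
  case/andP=> ts s0; rewrite ler0_norm //; apply: le_trans tT.
  by rewrite ltr0_norm // lerN2.
rewrite distrC; apply: (@le_trans _ _ (C * (0 - t))); last first.
  by rewrite sub0r ler_wpM2l // -(ltr0_norm t0).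
by apply: (@mvt_mx _ _ f df) => //; [exact: ltW|move=> s /sT; exact: fdf|
  move=> s /sT; exact: dfC].
Qed.

Lemma geometric_small (r e : R) : 0 <= r -> 0 < e ->
  exists k, 2 * r / 2 ^+ k < e.
Proof.
move=> r0 e0.
have h1 : `|2^-1 : R| < 1 by rewrite ger0_norm // invf_lt1 // ltr1n.
have e1 : 0 < e / (2 * r + 1) by rewrite divr_gt0 // ltr_wpDl // mulr_ge0.
have /cvgrPdist_lt/(_ _ e1) [N _ /(_ N)] := cvg_expr h1.
rewrite /= leqnn sub0r normrN ger0_norm ?exprn_ge0 ?invr_ge0 // => /(_ isT) HN.
exists N; rewrite -exprVn.
rewrite (@le_lt_trans _ _ ((2 * r + 1) * 2^-1 ^+ N)) //.
  by rewrite ler_wpM2r ?exprn_ge0 ?invr_ge0 // lerDl.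
by rewrite mulrC -ltr_pdivlMr // ltr_wpDl // mulr_ge0.
Qed.

Lemma geometric_cauchy_lim m n (u : nat -> 'M[R]_(m, n)) (r : R) :
  0 <= r -> (forall k, `|u k.+1 - u k| <= r / 2 ^+ k) ->
  exists l, forall k, `|l - u k| <= 2 * r / 2 ^+ k.
Proof.
move=> r0 ur.
have p2 k : 0 < 2 ^+ k :> R by rewrite exprn_gt0.
(* The subtracted term, the rest of the geometric series, is what makes the bound pass through the
   induction on [j]. *)
have tail k j : `|u (k + j)%N - u k| <= 2 * r / 2 ^+ k - 2 * r / 2 ^+ (k + j).
  elim: j => [|j IH]; first by rewrite addn0 !subrr normr0.
  rewrite -(subrKA (u (k + j)%N)) (le_trans (ler_normD _ _)) //.
  rewrite addnS (le_trans (lerD (ur _) IH)) // exprS.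
  have -> : 2 * r / (2 * 2 ^+ (k + j)) = r / 2 ^+ (k + j) :> R.
    by field; rewrite gt_eqF.
  lra.
have tail2 k j : `|u (k + j)%N - u k| <= 2 * r / 2 ^+ k.
  by apply: le_trans (tail k j) _; rewrite gerBl mulr_ge0 ?mulr_ge0 // invr_ge0 ltW.
have uc : cvgn u.
  apply: cauchy_cvg; apply: cauchy_exP => e e0.
  have [k ke] := geometric_small r0 e0; exists (u k); exists k => // j /= kj.
  rewrite -ball_normE /ball_ /= distrC -(subnKC kj); exact: le_lt_trans (tail2 _ _) ke.
exists (limn u) => k; apply/ler_addgt0Pr => e e0.
have /cvgrPdist_lt/(_ _ e0) [N _ HN] := uc.
rewrite -(subrKA (u (k + N)%N)) (le_trans (ler_normD _ _)) // addrC lerD //.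
by apply/ltW/HN; rewrite /= leq_addl.
Qed.

Definition clamp (T t : R) : R := Num.max (- T) (Num.min T t).

Lemma clampE (T t : R) : `|t| <= T -> clamp T t = t.
Proof. by rewrite ler_norml /clamp => /andP[h1 /min_r ->]; rewrite max_r. Qed.

Lemma clamp_le (T t : R) : 0 <= T -> `|clamp T t| <= T.
Proof.
by move=> T0; rewrite ler_norml /clamp le_max lexx /= ge_max ge_min lexx ge0_cp.
Qed.

Lemma clamp_continuous (T : R) : continuous (clamp T).
Proof.
move=> t; apply: (@continuous_max _ _ (cst (- T)) (fun t => Num.min T t)).
  exact: cst_continuous.
by apply: (@continuous_min _ _ (cst T) id); [exact: cst_continuous|exact: cvg_id].
Qed.

(* The Picard iterates are precomposed with [clamp T], so that they are defined
   and continuous on the whole line. *)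
Lemma picard m n (F : R -> 'M[R]_(m, n) -> 'M[R]_(m, n)) (y0 : 'M[R]_(m, n))
    (T r L C : R) :
  0 <= T -> 0 <= r -> 0 <= C -> 0 <= L -> C * T <= r -> L * T <= 2^-1 ->
  (forall (t : R) (y : 'M[R]_(m, n)), `|t| <= T -> `|y - y0| <= r -> {for t, continuous (F^~ y)}) ->
  (forall (t : R) (y : 'M[R]_(m, n)), `|t| <= T -> `|y - y0| <= r -> `|F t y| <= C) ->
  (forall (t : R) (y z : 'M[R]_(m, n)), `|t| <= T -> `|y - y0| <= r -> `|z - y0| <= r ->
     `|F t y - F t z| <= L * `|y - z|) ->
  exists y : R -> 'M[R]_(m, n), [/\ y 0 = y0,
    forall t, `|t| <= T -> `|y t - y0| <= r &
    forall t : R, `|t| <= T -> is_derive t 1 y (F t (y t))].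
Proof.
move=> T0 r0 C0 L0 CT LT Fc FC FL.
pose good (z : R -> 'M[R]_(m, n)) := continuous z /\ forall t, `|z t - y0| <= r.
have cT t : `|clamp T t| <= T by exact: clamp_le.
have /choice[Phi HPhi] : forall z, exists w : R -> 'M[R]_(m, n), good z ->
    w 0 = y0 /\ forall t : R, `|t| <= T -> is_derive t 1 w (F t (z t)).
  move=> z; have [[zc zr]|nz] := pselect (good z); last by exists (cst 0).
  have fc : continuous (fun t => F (clamp T t) (z t)).
    move=> t; apply/cvgrPdist_le => e e0; near=> s.
    rewrite -(subrKA (F (clamp T s) (z t))) (le_trans (ler_normD _ _)) //.
    rewrite (splitr e) lerD //.
      near: s.
      have cc : {for t, continuous (fun s => F (clamp T s) (z t))}.
        apply: (@continuous_comp _ _ _ (clamp T) (F^~ (z t))).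
          exact: clamp_continuous.
        exact: Fc.
      have e2 : 0 < e / 2 by rewrite divr_gt0.
      by have /cvgrPdist_le/(_ _ e2) := cc.
    rewrite (le_trans (FL _ _ _ _ _ _)) // mulrC.
    have : `|z t - z s| <= e / 2 / (L + 1).
      near: s; have e2 : 0 < e / 2 / (L + 1).
        by rewrite divr_gt0 ?divr_gt0 // ltr_wpDl.
      by have /cvgrPdist_le/(_ _ e2) := zc t.
    rewrite ler_pdivlMr ?ltr_wpDl // => /(le_trans _); apply.
    by rewrite ler_wpM2l // lerDl.
  (* The margin 1 makes the end points [- T] and [T] interior, so that the primitive has a two-sided
     derivative there. *)
  have [w w0 wd] := primitive_mx_exists (- T - 1) (T + 1) 0 y0 fc.
  exists w => _; split => // t tT.
  have := wd t; rewrite clampE //; apply.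
  by move: tT; rewrite ler_norml => /andP[? ?]; apply/andP; split; lra.
pose Psi z := Phi z \o clamp T.
have goodPsi z : good z -> good (Psi z).
  move=> gz; have [zc zr] := gz; have [w0 wd] := HPhi z gz; split => t.
    apply: continuous_comp; first exact: clamp_continuous.
    exact: is_derive_continuous (wd _ (cT t)).
  rewrite -w0 (le_trans _ CT) //.
  apply: (@mvt_mx_sym _ _ _ (fun t => F t (z t)) _ _ C0 wd _ _ (cT t)) => s sT.
  exact: FC sT (zr s).
(* By [L * T <= 1/2] the operator halves uniform distances. *)
have lipPsi z1 z2 e : good z1 -> good z2 -> (forall t, `|z1 t - z2 t| <= e) ->
    forall t, `|Psi z1 t - Psi z2 t| <= e / 2.
  move=> g1 g2 z12 t; have e0 : 0 <= e by apply: le_trans (z12 0).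
  have [w10 w1d] := HPhi _ g1; have [w20 w2d] := HPhi _ g2.
  have -> : Psi z1 t - Psi z2 t = (Phi z1 - Phi z2) (clamp T t) - (Phi z1 - Phi z2) 0.
    by rewrite /= -![(_ - _ : _ -> _) _]/(_ - _) w10 w20 subrr subr0.
  apply: (@le_trans _ _ (L * e * T)); last first.
    by rewrite mulrAC mulrC ler_wpM2l // .
  apply: (@mvt_mx_sym _ _ _ (fun t => F t (z1 t) - F t (z2 t))) => //.
  - by rewrite mulr_ge0.
  - by move=> s sT; apply: is_deriveB; [exact: w1d|exact: w2d].
  - move=> s sT; apply: le_trans (FL _ _ _ sT (g1.2 s) (g2.2 s)) _.
    by rewrite ler_wpM2l.
pose z k := iter k Psi (cst y0).
have gz k : good (z k).
  elim: k => [|k]; last exact: goodPsi.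
  by split => [|t]; [exact: cst_continuous|rewrite subrr normr0].
have zk k : forall t, `|z k.+1 t - z k t| <= r / 2 ^+ k.
  elim: k => [|k IH] t; first by rewrite expr0 divr1; exact: (gz 1).2.
  have -> : r / 2 ^+ k.+1 = r / 2 ^+ k / 2 :> R by rewrite exprS invfM; ring.
  exact: (lipPsi (z k.+1) (z k) _ (gz _) (gz _) IH t).
have /choice[y yz] : forall t, exists l : 'M[R]_(m, n),
    forall k, `|l - z k t| <= 2 * r / 2 ^+ k.
  by move=> t; apply: (@geometric_cauchy_lim _ _ (fun k => z k t)).
have gy : good y.
  split => t; last first.
    apply/ler_addgt0Pr => e e0; have [k ke] := geometric_small r0 e0.
    rewrite -(subrKA (z k t)) (le_trans (ler_normD _ _)) // addrC lerD //.
      exact: (gz k).2.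
    exact: le_trans (yz _ _) (ltW ke).
  apply/cvgrPdist_le => e e0.
  have e3 : 0 < e / 3 by rewrite divr_gt0.
  have [k ke] := geometric_small r0 e3.
  have /cvgrPdist_le/(_ _ e3) := (gz k).1 t.
  apply: filterS => s zts.
  have -> : y t - y s = (y t - z k t) + (z k t - z k s) - (y s - z k s).
    by rewrite addrA subrK opprB addrA subrK.
  rewrite (le_trans (ler_normB _ _)) // (le_trans (lerD (ler_normD _ _) (lexx _))) //.
  have := yz t k; have := yz s k; lra.
have Py t : Psi y t = y t.
  apply/eqP; rewrite -subr_eq0 -normr_le0; apply/ler_addgt0Pr => e e0.
  rewrite add0r; have e2 : 0 < e / 2 by rewrite divr_gt0.
  have [k ke] := geometric_small r0 e2.
  rewrite -(subrKA (z k.+1 t)) (le_trans (ler_normD _ _)) //.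
  have h1 := lipPsi y (z k) _ gy (gz k) (yz^~ k) t.
  have h2 := yz t k.+1; rewrite distrC in h2.
  have h3 : 2 * r / 2 ^+ k.+1 = (2 * r / 2 ^+ k) / 2 :> R.
    by rewrite exprS invfM; ring.
  have h4 : 0 <= 2 * r / 2 ^+ k by rewrite !mulr_ge0 ?invr_ge0 ?exprn_ge0.
  move: h2; rewrite h3 => h2; move: h1 h2; rewrite -/(z k.+1); lra.
have [w0 wd] := HPhi _ gy.
have wy t : `|t| <= T -> Phi y t = y t.
  by move=> tT; rewrite -[RHS]Py /Psi /= clampE.
(* The fixed point [y] is frozen outside [[- T, T]] and may fail to be differentiable at the ends.
   [Phi y] agrees with it inside and is a genuine primitive. *)
exists (Phi y); split => // t tT; first by rewrite wy //; exact: gy.2.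
by rewrite wy //; exact: wd.
Unshelve. all: by end_near. Qed.

Lemma gronwall_short m n (w dw : R -> 'M[R]_(m, n)) (T L e : R) :
  0 <= T -> 0 <= L -> 0 <= e -> L * T <= 2^-1 -> w 0 = 0 ->
  (forall t : R, `|t| <= T -> is_derive t 1 w (dw t)) ->
  (forall t, `|t| <= T -> `|dw t| <= L * `|w t| + e) ->
  forall t, `|t| <= T -> `|w t| <= 2 * (e * T).
Proof.
move=> T0 L0 e0 LT w0 wd dwL.
have wc : {within `[- T, T], continuous (fun t => `|w t|)}.
  apply: continuous_in_subspaceT => t /set_mem /= /[!in_itv]/=.
  rewrite -ler_norml => tT; apply: (@continuous_comp _ _ _ w Num.norm).
    exact: is_derive_continuous (wd t tT).
  exact: norm_continuous.
have [|c /[!in_itv]/= cT wmax] := @EVT_max _ (fun t => `|w t|) (- T) T _ wc; first lra.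
rewrite -ler_norml in cT.
have {}wmax t : `|t| <= T -> `|w t| <= `|w c|.
  by rewrite ler_norml => tT; apply: wmax; rewrite in_itv.
have h : `|w c - w 0| <= (L * `|w c| + e) * T.
  apply: (@mvt_mx_sym _ _ w dw) => //; first by rewrite addr_ge0 // mulr_ge0.
  move=> t tT; apply: le_trans (dwL t tT) _.
  by rewrite lerD2r ler_wpM2l // wmax.
move: h; rewrite w0 subr0 mulrDl mulrAC => h t /wmax wt; apply: le_trans wt _.
have : L * T * `|w c| <= 2^-1 * `|w c| by rewrite ler_wpM2r.
lra.
Qed.

End MatrixCalculus.

(** * Functions of class C^k on open subsets of R^4 *)

Section PartialCalculus.
Context {R : realType}.
Local Notation pt := ('cV[R]_4).
Local Notation e_ b := (@delta_mx R 4 1 b 0).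
Implicit Types (W : set pt) (f h : pt -> R).

Lemma is_derive_line (V W : normedModType R) (f : V -> W) z v (s : R) d :
  is_derive (z + s *: v) v f d -> is_derive s 1 (fun u => f (z + u *: v)) d.
Proof.
have E : (fun h : R => h^-1 *: (f (z + (h *: 1 + s) *: v) - f (z + s *: v))) =
  (fun h : R => h^-1 *: (f (h *: v + (z + s *: v)) - f (z + s *: v))).
  by apply/funext => h; rewrite -[h%:A]/(h * 1) mulr1 scalerDl addrCA.
by move=> [df <-]; split; rewrite /derivable /derive /= E.
Qed.

Lemma partial_mvt (f : pt -> R) (z : pt) (b : 'I_4) (a : R) :
  (forall s : R, `|s| <= `|a| -> derivable f (z + s *: e_ b) (e_ b)) ->
  exists2 s : R, `|s| <= `|a| &
    f (z + a *: e_ b) - f z = partial b f (z + s *: e_ b) * a.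
Proof.
move=> df.
have fl (s : R) : `|s| <= `|a| ->
    is_derive s 1 (fun u => f (z + u *: e_ b)) (partial b f (z + s *: e_ b)).
  by move=> /df dfs; apply: is_derive_line; exact: derivableP.
pose F (u : R) := f (z + u *: e_ b).
pose dF (u : R) := partial b f (z + u *: e_ b).
have cl (u w : R) : (forall s, u <= s <= w -> `|s| <= `|a|) ->
    {within `[u, w], continuous (fun u => f (z + u *: e_ b))}.
  move=> H; apply: derivable_within_continuous => s /[!in_itv]/= /H /fl.
  by case.
have [a0|a0] := leP 0 a.
  have sa s : 0 <= s <= a -> `|s| <= `|a| by case/andP=> ? ?; rewrite !ger0_norm.
  have [|s /[!in_itv]/= /sa sa1] := @MVT_segment _ F dF _ _ a0 _ (cl _ _ sa).
    by move=> s /[!in_itv]/= /andP[? ?]; apply/fl/sa; rewrite !ltW.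
  by rewrite /F scale0r addr0 subr0 => E; exists s.
have sa s : a <= s <= 0 -> `|s| <= `|a|.
  by case/andP=> ? ?; rewrite (ltr0_norm a0) ler0_norm // lerN2.
have [|s /[!in_itv]/= /sa sa1] := @MVT_segment _ F dF _ _ (ltW a0) _ (cl _ _ sa).
  by move=> s /[!in_itv]/= /andP[? ?]; apply/fl/sa; rewrite !ltW.
rewrite /F scale0r addr0 sub0r mulrN => E; exists s => //.
by rewrite -[RHS]opprK -E opprB.
Qed.

Lemma open_mx_ball m n (W : set 'M[R]_(m, n)) x : open W -> W x ->
  exists2 r : R, 0 < r & forall y : 'M[R]_(m, n), `|y - x| < r -> W y.
Proof.
move=> oW Wx; have /nbhs_ballP[r r0 rW] := open_nbhs_nbhs (conj oW Wx).
exists r => // y yx; apply: rW; rewrite -ball_normE /ball_ /= distrC; exact: yx.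
Qed.

Lemma continuous_mxP m n (V : normedModType R) (f : 'M[R]_(m, n) -> V) x :
  {for x, continuous f} <-> forall e : R, 0 < e -> exists2 d : R, 0 < d &
    forall y : 'M[R]_(m, n), `|y - x| < d -> `|f y - f x| < e.
Proof.
split=> [fc e e0|H].
  have /nbhs_ballP[d d0 Hd] : nbhs x (f @^-1` ball (f x) e).
    by apply: fc; exact: nbhsx_ballx.
  exists d => // y yx.
  have /Hd : ball x d y by rewrite -ball_normE /ball_ /= distrC.
  by rewrite /= -ball_normE /ball_ /= distrC.
move=> A /nbhs_ballP[e /= e0 eA]; have [d d0 Hd] := H _ e0.
apply/nbhs_ballP; exists d => // y; rewrite -ball_normE /ball_ /= distrC => /Hd yx.
by apply: eA; rewrite -ball_normE /ball_ /= distrC.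
Qed.

Lemma delta_norm_le (b : 'I_4) (s : R) : `|s *: e_ b| <= `|s|.
Proof.
apply: mx_norm_le => // i j; rewrite !mxE normrM.
by case: (_ && _); rewrite ?normr1 ?normr0 ?mulr1 ?mulr0.
Qed.

(** Finite orders of differentiability allow closure under products, inverses, [expR] and [ln] to be
    proved by induction on the order, since each derivative formula involves the function itself at
    one order less. *)
Definition Ck_body (W : set pt) (f : pt -> R) (C : (pt -> R) -> Prop) : Prop :=
  (forall x, W x -> {for x, continuous f}) /\
  forall b : 'I_4, (forall x, W x -> derivable f x (e_ b)) /\ C (partial b f).

Fixpoint Ck (k : nat) (W : set pt) (f : pt -> R) : Prop :=
  if k is k'.+1 then Ck_body W f (Ck k' W)
  else forall x, W x -> {for x, continuous f}.

Lemma Ck_continuous k W f x : Ck k W f -> W x -> {for x, continuous f}.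
Proof. by case: k => [|k]; [exact|case=> fc _; exact: fc]. Qed.

Lemma CkW k W f : Ck k.+1 W f -> Ck k W f.
Proof.
elim: k f => [|k IH] f; first by case.
by move=> [fc df]; split => // b; have [d1 d2] := df b; split => //; exact: IH.
Qed.

Lemma Ck_partial k W f b : Ck k.+1 W f -> Ck k W (partial b f).
Proof. by case=> _ /(_ b)[]. Qed.

Lemma Ck_derive k W f b x : Ck k.+1 W f -> W x ->
  is_derive x (e_ b) f (partial b f x).
Proof. by move=> [_ /(_ b)[d _]] /d; exact: derivableP. Qed.

Lemma near_open (T : topologicalType) (W : set T) (P : T -> Prop) x :
  open W -> W x -> (forall y, W y -> P y) -> \forall y \near x, P y.
Proof.
by move=> oW Wx WP; apply: filterS (open_nbhs_nbhs (conj oW Wx)) => y; exact: WP.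
Qed.

Lemma continuous_open_ext (T U : topologicalType) (W : set T) (f h : T -> U) x :
  open W -> W x -> (forall y, W y -> f y = h y) ->
  {for x, continuous f} -> {for x, continuous h}.
Proof.
move=> oW Wx fh; rewrite /prop_for /continuous_at (fh x Wx).
by apply: cvg_trans; exact: near_eq_cvg (near_open oW Wx fh).
Qed.

Lemma Ck_ext k W f h : open W -> (forall x, W x -> f x = h x) ->
  Ck k W f -> Ck k W h.
Proof.
move=> oW; elim: k f h => [|k IH] f h fh.
  by move=> fc x Wx; exact: continuous_open_ext oW Wx fh (fc x Wx).
move=> [fc df]; split.
  by move=> x Wx; exact: continuous_open_ext oW Wx fh (fc x Wx).
move=> b; have [d1 d2] := df b; split.
  move=> x Wx; apply: near_eq_derivable (d1 x Wx); exact: near_open oW Wx fh.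
apply: IH d2 => x Wx; apply: near_eq_derive; exact: near_open oW Wx fh.
Qed.

(* A Caratheodory form of differentiability; the coefficients are values of the
   partial derivatives at nearby points. *)
Lemma C1_increment W f x : open W -> Ck 1 W f -> W x ->
  exists2 r : R, 0 < r & exists2 q : pt -> 'I_4 -> R,
    forall k : pt, `|k| < r -> f (x + k) - f x = \sum_b q k b * k b 0 &
    forall b (e : R), 0 < e -> exists2 d : R, 0 < d &
      forall k : pt, `|k| < d -> `|q k b - partial b f x| < e.
Proof.
move=> oW Cf Wx; have [r r0 rW] := open_mx_ball oW Wx.
(* The increment cut down to its first [j] coordinates: the path through these points moves along
   one axis at a time and stays within distance [|k|] of [x]. *)
pose tr j (k : pt) : pt := \col_(b < 4) (if (b < j)%N then k b 0 else 0).
have trS (b : 'I_4) k : tr b.+1 k = tr b k + k b 0 *: e_ b.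
  apply/matrixP => i j; rewrite !mxE (ord1 j) andbT ltnS leq_eqVlt.
  have [->|ib] := eqVneq i b; first by rewrite eqxx ltnn /= mulr1 add0r.
  by rewrite -val_eqE in ib; rewrite (negbTE ib) /= mulr0 addr0.
have trle j (k : pt) (b : 'I_4) (s : R) : `|s| <= `|k b 0| ->  (j <= b)%N ->
    `|tr j k + s *: e_ b| <= `|k|.
  move=> sk jb; apply: mx_norm_le => // i i'; rewrite !mxE (ord1 i') andbT.
  have [->|ib] := eqVneq i b.
    by rewrite ltnNge jb add0r mulr1 (le_trans sk) // mx_entry_le.
  rewrite mulr0 addr0; case: ifP => _; first exact: mx_entry_le.
  by rewrite normr0.
have /choice[q Hq] : forall k : pt, exists q : 'I_4 -> R, `|k| < r ->
    f (x + k) - f x = \sum_b q b * k b 0 /\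
    forall b, exists2 xi : pt, `|xi| <= `|k| & q b = partial b f (x + xi).
  move=> k; have [kr|] := pselect (`|k| < r); last by exists (fun=> 0).
  have /choice[q Hq] : forall b : 'I_4, exists qb : R,
      f (x + tr b.+1 k) - f (x + tr b k) = qb * k b 0 /\
      exists2 xi : pt, `|xi| <= `|k| & qb = partial b f (x + xi).
    move=> b; have [|s sk E] := @partial_mvt f (x + tr b k) b (k b 0).
      move=> s sk; have [|d _] := @Ck_derive 0 W f b (x + tr b k + s *: e_ b) Cf => //.
      by apply: rW; rewrite -(addrA x) (addrC x) addrK (le_lt_trans (trle _ _ _ _ sk _)).
    exists (partial b f (x + tr b k + s *: e_ b)); split.
      by rewrite trS addrA.
    by exists (tr b k + s *: e_ b); rewrite ?addrA // trle.
  exists q => _; split => [|b]; last exact: (Hq b).2.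
  under eq_bigr do rewrite -(Hq _).1.
  have t4 : tr 4 k = k by apply/matrixP => i j; rewrite !mxE (ord1 j) ltn_ord.
  have t0 : tr 0%N k = 0 by apply/matrixP => i j; rewrite !mxE.
  by rewrite -(big_mkord xpredT (fun b => f (x + tr b.+1 k) - f (x + tr b k)))
    telescope_sumr // t4 t0 addr0.
exists r => //; exists q => [k kr|b e e0]; first exact: (Hq k kr).1.
have /continuous_mxP/(_ e e0)[d d0 Hd] : {for x, continuous (partial b f)}.
  by apply: Ck_continuous (Ck_partial b Cf) Wx.
exists (Num.min r d); first by rewrite lt_min r0.
move=> k; rewrite lt_min => /andP[kr kd].
have [_ /(_ b)[xi xik ->]] := Hq k kr.
by apply: Hd; rewrite addrC addrA addNr add0r; exact: le_lt_trans kd.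
Qed.

(** Only the derivative of [y] in the direction [v] is assumed; all the uniformity comes from [f],
    through the increment formula [C1_increment]. *)
Lemma C1_chain (V : normedModType R) W f (y : V -> pt) (t v : V) y' :
  open W -> Ck 1 W f -> W (y t) -> is_derive t v y y' ->
  is_derive t v (fun u => f (y u)) (\sum_b partial b f (y t) * y' b 0).
Proof.
move=> oW Cf Wy [dy dyE].
have [r r0 [q fq qc]] := C1_increment oW Cf Wy.
pose k (h : R) : pt := y (h *: v + t) - y t.
have ck : h^-1 *: k h @[h --> 0^'] --> y' by rewrite -dyE.
have k0 : k h @[h --> 0^'] --> (0 : pt).
  have : h *: (h^-1 *: k h) @[h --> (0 : R)^'] --> (0 : R) *: y'.
    by apply: cvgZ => //; exact: cvg_within.
  rewrite scale0r; apply: cvg_trans; apply: near_eq_cvg; near=> h.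
  rewrite scalerA divff ?scale1r //; near: h; exact: nbhs_dnbhs_neq.
suff cf : h^-1 *: (f (y (h *: v + t)) - f (y t)) @[h --> 0^'] -->
    \sum_b partial b f (y t) * y' b 0.
  by split; [apply/cvg_ex; eexists; exact: cf|exact/cvg_lim].
have cs : \sum_b q (k h) b * (h^-1 *: k h) b 0 @[h --> (0 : R)^'] -->
    \sum_b partial b f (y t) * y' b 0.
  apply: cvg_big => [|b _]; first exact: add_continuous.
  apply: cvgM.
    apply/cvgrPdist_lt => e e0; have [d d0 Hd] := qc b e e0.
    have /cvgrPdist_lt/(_ d d0) := k0; apply: filterS => h.
    by rewrite sub0r normrN => /Hd Hk; rewrite distrC.
  apply/cvgrPdist_lt => e e0; have /cvgrPdist_lt/(_ e e0) := ck.
  apply: filterS => h; apply: le_lt_trans.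
  by have := mx_entry_le (y' - h^-1 *: k h) b 0; rewrite !mxE.
apply: cvg_trans cs; apply: near_eq_cvg; near=> h.
have kr : `|k h| < r.
  near: h; have /cvgrPdist_lt/(_ r r0) := k0; apply: filterS => h.
  by rewrite sub0r normrN.
rewrite (_ : y (h *: v + t) = y t + k h); last by rewrite [RHS]addrC subrK.
rewrite fq // scaler_sumr; apply: eq_bigr => b _.
by rewrite mxE [LHS]mulrCA.
Unshelve. all: by end_near. Qed.

(** The second difference over a square of side [h] is symmetric in the two directions. Two mean
    value steps turn it into either mixed derivative at a point near [x], and continuity closes the
    gap. *)
Lemma schwarz W f a b x : open W -> Ck 2 W f -> W x ->
  partial a (partial b f) x = partial b (partial a f) x.
Proof.
move=> oW Cf Wx; apply/eqP; rewrite -subr_eq0 -normr_le0.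
apply/ler_addgt0Pr => e e0; rewrite add0r.
have e2 : 0 < e / 2 by rewrite divr_gt0.
have [r r0 rW] := open_mx_ball oW Wx.
have cab c d : {for x, continuous (partial c (partial d f))}.
  exact: Ck_continuous (Ck_partial c (Ck_partial d Cf)) Wx.
have /continuous_mxP/(_ _ e2)[d1 d10 Hd1] := cab a b.
have /continuous_mxP/(_ _ e2)[d2 d20 Hd2] := cab b a.
(* A displacement with two legs has norm at most [2 h], so the division by 3 keeps it strictly
   inside all three balls. *)
pose h := Num.min r (Num.min d1 d2) / 3.
have h0 : 0 < h by rewrite divr_gt0 // !lt_min r0 d10.
have small (c d : 'I_4) (s u : R) : `|s| <= `|h| -> `|u| <= `|h| ->
    [/\ `|s *: e_ c + u *: e_ d| < r, `|s *: e_ c + u *: e_ d| < d1 &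
        `|s *: e_ c + u *: e_ d| < d2].
  move=> sh uh; suff : `|s *: e_ c + u *: e_ d| < Num.min r (Num.min d1 d2).
    by rewrite !lt_min => /andP[-> /andP[-> ->]].
  rewrite (@le_lt_trans _ _ (h + h)) //; last by move: h0; rewrite /h; lra.
  rewrite (le_trans (ler_normD _ _)) // lerD // (le_trans (delta_norm_le _ _)) //.
    by rewrite -[leRHS]gtr0_norm.
  by rewrite -[leRHS]gtr0_norm.
clearbody h.
have key (c d : 'I_4) : exists2 xi : pt, `|xi| < d1 /\ `|xi| < d2 &
    f (x + h *: e_ c + h *: e_ d) - f (x + h *: e_ c) - f (x + h *: e_ d) + f x =
    partial d (partial c f) (x + xi) * h * h.
  pose G y := f (y + h *: e_ d) - f y.
  have inW s u : `|s| <= `|h| -> `|u| <= `|h| -> W (x + s *: e_ c + u *: e_ d).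
    move=> sh uh; apply: rW; rewrite -(addrA x) (addrC x) addrK.
    by have [] := small c d s u sh uh.
  have inW0 s : `|s| <= `|h| -> W (x + s *: e_ c).
    by move=> sh; have := inW s 0 sh; rewrite scale0r addr0 normr0; exact.
  have dG s : `|s| <= `|h| -> is_derive (x + s *: e_ c) (e_ c) G
      (partial c f (x + s *: e_ c + h *: e_ d) - partial c f (x + s *: e_ c)).
    move=> sh; apply: is_deriveB; last exact: Ck_derive Cf (inW0 _ sh).
    have := @C1_chain pt W f (fun y => y + h *: e_ d) (x + s *: e_ c) (e_ c) (e_ c) oW.
    rewrite (bigD1 c) //= big1 => [|i ic]; last first.
      by rewrite mxE (negbTE ic) mulr0.
    rewrite !mxE !eqxx addr0 mulr1; apply => //; first exact: CkW Cf.
      exact: inW.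
    rewrite -[X in is_derive _ _ _ X]addr0.
    exact: (@is_deriveD _ _ _ id (cst (h *: e_ d))).
  have [|s sh Gs] := @partial_mvt G x c h.
    by move=> s sh; have [] := dG s sh.
  have [|u uh Fu] := @partial_mvt (partial c f) (x + s *: e_ c) d h.
    move=> u uh.
    by have [] := Ck_derive d (Ck_partial c Cf) (inW s u sh uh).
  exists (s *: e_ c + u *: e_ d); first by have [] := small c d s u sh uh.
  have -> : f (x + h *: e_ c + h *: e_ d) - f (x + h *: e_ c)
      - f (x + h *: e_ d) + f x = G (x + h *: e_ c) - G x.
    by rewrite /G opprB addrA addrAC.
  rewrite Gs addrA -Fu; congr (_ * _).
  by have [_] := dG s sh.
have [xi [_ xi2] E1] := key a b; have [eta [eta1 _] E2] := key b a.
have hn0 : h != 0 by rewrite gt_eqF.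
have Dsym : f (x + h *: e_ a + h *: e_ b) - f (x + h *: e_ a) - f (x + h *: e_ b) + f x
    = f (x + h *: e_ b + h *: e_ a) - f (x + h *: e_ b) - f (x + h *: e_ a) + f x.
  have -> : x + h *: e_ a + h *: e_ b = x + h *: e_ b + h *: e_ a.
    by rewrite addrAC.
  by congr (_ + _); exact: addrAC.
have shift (y : pt) : x + y - x = y by rewrite addrC addrA addNr add0r.
have h1 : `|partial b (partial a f) (x + xi) - partial b (partial a f) x| < e / 2.
  by apply: Hd2; rewrite shift.
have h2 : `|partial a (partial b f) (x + eta) - partial a (partial b f) x| < e / 2.
  by apply: Hd1; rewrite shift.
have {E1 E2 Dsym} E := etrans (esym E1) (etrans Dsym E2).
move: E h1 h2 {key cab Hd1 Hd2 small}.
move: (partial a (partial b f) (x + eta)) (partial b (partial a f) (x + xi)).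
move: (partial a (partial b f) x) (partial b (partial a f) x) => A B A' B'.
move=> /(mulIf hn0)/(mulIf hn0) -> h1 h2.
by rewrite -(subrKA A') (le_trans (ler_normD _ _)) // distrC; lra.
Qed.

End PartialCalculus.

HB.lock Definition dmx (R : realType) m n (b : 'I_4) (A : 'cV[R]_4 -> 'M[R]_(m, n))
    (x : 'cV[R]_4) : 'M[R]_(m, n) :=
  \matrix_(i, j) partial b (fun y => A y i j) x.

Section CkAlgebra.
Context {R : realType}.
Local Notation pt := ('cV[R]_4).
Local Notation e_ b := (@delta_mx R 4 1 b 0).
Variable W : set pt.
Hypothesis oW : open W.
Implicit Types f h : pt -> R.

Lemma is_derive_lineP (V U : normedModType R) (f : V -> U) x v d :
  is_derive (0 : R) 1 (fun u : R => f (x + u *: v)) d <-> is_derive x v f d.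
Proof.
split; last by move=> H; apply: is_derive_line; rewrite scale0r addr0.
have E : (fun h : R => h^-1 *: (f (x + (h *: 1 + 0) *: v) - f (x + 0 *: v))) =
  (fun h : R => h^-1 *: (f (h *: v + x) - f x)).
  by apply/funext => h; rewrite -[h%:A]/(h * 1) mulr1 addr0 scale0r addr0 (addrC x).
by case=> df <-; move: df; rewrite /derivable /derive /= E.
Qed.

Lemma is_derive_compR (V U : normedModType R) (phi : R -> U) (f : V -> R) x v d df :
  is_derive (f x) 1 phi d -> is_derive x v f df ->
  is_derive x v (fun y => phi (f y)) (df *: d).
Proof.
move=> Hphi /is_derive_lineP Hf; apply/is_derive_lineP.
apply: (@is_derive_comp1 _ _ phi (fun u => f (x + u *: v))) => //.
by rewrite scale0r addr0.
Qed.

(** The induction step for closure properties: a formula for the partial derivatives, valid on [W],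
    replaces the derivatives themselves. *)
Lemma Ck_step k f (F : 'I_4 -> pt -> R) :
  (forall x, W x -> {for x, continuous f}) ->
  (forall b x, W x -> is_derive x (e_ b) f (F b x)) ->
  (forall b, Ck k W (F b)) -> Ck k.+1 W f.
Proof.
move=> fc fF CF; split => // b; split => [x Wx|].
  by case: (fF b x Wx).
by apply: Ck_ext (CF b) => // x Wx; case: (fF b x Wx).
Qed.

Lemma Ck_cst k (c : R) : Ck k W (fun=> c).
Proof.
elim: k c => [|k IH] c; first by move=> x _; exact: cst_continuous.
apply: (@Ck_step _ _ (fun _ _ => 0)) => // x _; exact: cst_continuous.
Qed.

Lemma CkD k f h : Ck k W f -> Ck k W h -> Ck k W (fun x => f x + h x).
Proof.
elim: k f h => [|k IH] f h Cf Ch.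
  by move=> x Wx; exact: continuousD (Cf x Wx) (Ch x Wx).
apply: (@Ck_step _ _ (fun b x => partial b f x + partial b h x)) => [x Wx|b x Wx|b].
- exact: continuousD (Ck_continuous Cf Wx) (Ck_continuous Ch Wx).
- exact: is_deriveD (Ck_derive b Cf Wx) (Ck_derive b Ch Wx).
- by apply: IH; exact: Ck_partial.
Qed.

Lemma CkM k f h : Ck k W f -> Ck k W h -> Ck k W (fun x => f x * h x).
Proof.
elim: k f h => [|k IH] f h Cf Ch.
  by move=> x Wx; exact: continuousM (Cf x Wx) (Ch x Wx).
apply: (@Ck_step _ _ (fun b x => partial b f x * h x + f x * partial b h x)) =>
    [x Wx|b x Wx|b].
- exact: continuousM (Ck_continuous Cf Wx) (Ck_continuous Ch Wx).
- exact: is_derive_mul (Ck_derive b Cf Wx) (Ck_derive b Ch Wx).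
- by apply: CkD; apply: IH; (exact: Ck_partial || exact: CkW).
Qed.

Lemma CkN k f : Ck k W f -> Ck k W (fun x => - f x).
Proof.
move=> Cf; apply: (@Ck_ext _ _ _ (fun x => -1 * f x)) => //.
  by move=> x _; rewrite mulN1r.
by apply: CkM => //; exact: Ck_cst.
Qed.

Lemma CkB k f h : Ck k W f -> Ck k W h -> Ck k W (fun x => f x - h x).
Proof. by move=> Cf Ch; apply: CkD => //; exact: CkN. Qed.

Lemma Ck_sum k (I : Type) (r : seq I) (F : I -> pt -> R) :
  (forall i, Ck k W (F i)) -> Ck k W (fun x => \sum_(i <- r) F i x).
Proof.
move=> CF; elim: r => [|i r IH].
  by apply: Ck_ext (Ck_cst k 0) => // x _; rewrite big_nil.
by apply: Ck_ext (CkD (CF i) IH) => // x _; rewrite big_cons.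
Qed.

Lemma Ck_prod k (I : Type) (r : seq I) (F : I -> pt -> R) :
  (forall i, Ck k W (F i)) -> Ck k W (fun x => \prod_(i <- r) F i x).
Proof.
move=> CF; elim: r => [|i r IH].
  by apply: Ck_ext (Ck_cst k 1) => // x _; rewrite big_nil.
by apply: Ck_ext (CkM (CF i) IH) => // x _; rewrite big_cons.
Qed.

Lemma CkV k f : (forall x, W x -> f x != 0) -> Ck k W f -> Ck k W (fun x => (f x)^-1).
Proof.
move=> f0; elim: k => [|k IH] Cf.
  by move=> x Wx; apply: continuousV; [exact: f0|exact: Cf].
apply: (@Ck_step _ _ (fun b x => - ((f x)^-1 * (f x)^-1 * partial b f x))) =>
    [x Wx|b x Wx|b].
- by apply: continuousV; [exact: f0|exact: Ck_continuous Cf Wx].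
- have [d <-] := Ck_derive b Cf Wx; split; first exact: derivableV (f0 x Wx) d.
  by rewrite deriveV ?f0 // expr2 invfM scaleNr.
- by apply: CkN; apply: CkM; [apply: CkM; apply: IH; exact: CkW|exact: Ck_partial].
Qed.

Lemma Ck_exp k f : Ck k W f -> Ck k W (fun x => expR (f x)).
Proof.
elim: k => [|k IH] Cf.
  move=> x Wx; apply: (@continuous_comp _ _ _ f expR); first exact: Cf.
  exact: continuous_expR.
apply: (@Ck_step _ _ (fun b x => partial b f x * expR (f x))) => [x Wx|b x Wx|b].
- apply: (@continuous_comp _ _ _ f expR); first exact: Ck_continuous Cf Wx.
  exact: continuous_expR.
- exact: is_derive_compR (Ck_derive b Cf Wx).
- by apply: CkM; [exact: Ck_partial|apply: IH; exact: CkW].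
Qed.

Lemma Ck_ln k f : (forall x, W x -> 0 < f x) -> Ck k W f -> Ck k W (fun x => ln (f x)).
Proof.
move=> f0 Cf; case: k Cf => [|k] Cf.
  move=> x Wx; apply: (@continuous_comp _ _ _ f (@ln R)); first exact: Cf.
  by apply: continuous_ln; exact: f0.
apply: (@Ck_step _ _ (fun b x => partial b f x * (f x)^-1)) => [x Wx|b x Wx|b].
- apply: (@continuous_comp _ _ _ f (@ln R)); first exact: Ck_continuous Cf Wx.
  by apply: continuous_ln; exact: f0.
- apply: is_derive_compR (Ck_derive b Cf Wx); exact: is_derive1_ln (f0 x Wx).
- apply: CkM; first exact: Ck_partial.
  by apply: CkV (CkW Cf) => x Wx; rewrite gt_eqF // f0.
Qed.

Definition Ckmx m n k (A : pt -> 'M[R]_(m, n)) : Prop :=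
  forall i j, Ck k W (fun x => A x i j).

Lemma dmxE m n c (A : pt -> 'M[R]_(m, n)) x a b :
  dmx c A x a b = partial c (fun y => A y a b) x.
Proof. by rewrite dmx.unlock mxE. Qed.

Lemma Ckmx_derive m n k (A : pt -> 'M[R]_(m, n)) b x : Ckmx k.+1 A -> W x ->
  is_derive x (e_ b) A (dmx b A x).
Proof.
move=> CA Wx; apply/is_derive_mxP => i j; rewrite dmxE; exact: Ck_derive (CA i j) Wx.
Qed.

Lemma Ckmx_ext m n k (A B : pt -> 'M[R]_(m, n)) : (forall x, W x -> A x = B x) ->
  Ckmx k A -> Ckmx k B.
Proof. by move=> AB CA i j; apply: Ck_ext (CA i j) => // x Wx; rewrite AB. Qed.

Lemma Ckmx_dmx m n k b (A : pt -> 'M[R]_(m, n)) : Ckmx k.+1 A -> Ckmx k (dmx b A).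
Proof.
by move=> CA i j; apply: Ck_ext (Ck_partial b (CA i j)) => // x _; rewrite dmxE.
Qed.

Lemma Ckmx_continuous m n k (A : pt -> 'M[R]_(m, n)) x :
  Ckmx k A -> W x -> {for x, continuous A}.
Proof. by move=> CA Wx; apply: continuous_mx => i j; exact: Ck_continuous (CA i j) Wx. Qed.

Lemma CkmxM m n p k (A : pt -> 'M[R]_(m, n)) (B : pt -> 'M[R]_(n, p)) :
  Ckmx k A -> Ckmx k B -> Ckmx k (fun x => A x *m B x).
Proof.
move=> CA CB i j; apply: (@Ck_ext _ _ _ (fun x => \sum_l A x i l * B x l j)) => //.
  by move=> x _; rewrite mxE.
by apply: Ck_sum => l; exact: CkM.
Qed.

Lemma Ck_det n k (A : pt -> 'M[R]_n) : Ckmx k A -> Ck k W (fun x => \det (A x)).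
Proof.
move=> CA; apply: Ck_sum => s; apply: CkM; first exact: Ck_cst.
by apply: Ck_prod => i; exact: CA.
Qed.

Lemma Ckmx_inv n k (A : pt -> 'M[R]_n) : (forall x, W x -> A x \in unitmx) ->
  Ckmx k A -> Ckmx k (fun x => invmx (A x)).
Proof.
move=> uA CA i j.
apply: (@Ck_ext _ _ _ (fun x => (\det (A x))^-1 * \adj (A x) i j)) => //.
  by move=> x Wx; rewrite /invmx uA // [in RHS]mxE.
apply: CkM.
  by apply: CkV (Ck_det CA) => x Wx; have := uA x Wx; rewrite unitmxE unitfE.
apply: (@Ck_ext _ _ _ (fun x => (-1) ^+ (j + i) *
    \det (\matrix_(a, b) A x (lift j a) (lift i b)))) => // [x Wx|].
  rewrite [in RHS]mxE /cofactor; congr (_ * \det _).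
  by apply/matrixP => a b; rewrite !mxE.
apply: CkM; first exact: Ck_cst.
apply: Ck_det => a b.
by apply: Ck_ext (CA (lift j a) (lift i b)) => // x _; rewrite mxE.
Qed.

Lemma smooth_on_Ckmx m n (A : pt -> 'M[R]_(m, n)) k : smooth_on W A -> Ckmx k A.
Proof.
move=> sA i j; rewrite -[A]/(partials [::] A); move: [::].
elim: k => [|k IH] s.
  by move=> x Wx; apply: continuous_entry; exact: (sA s x Wx).1.
apply: (@Ck_step _ _ (fun b x => partials (b :: s) A x i j)) => [x Wx|b x Wx|b].
- by apply: continuous_entry; exact: (sA s x Wx).1.
- have [_ /(_ b) d] := sA s x Wx.
  by have /is_derive_mxP := derivableP d; exact.
- exact: IH.
Qed.

End CkAlgebra.

Lemma is_derive_prod (R : realType) (V : normedModType R) (I : eqType) (r : seq I)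
    (f : I -> V -> R) x v (df : I -> R) : uniq r ->
  (forall i, is_derive x v (f i) (df i)) ->
  is_derive x v (fun y => \prod_(i <- r) f i y)
    (\sum_(i <- r) df i * \prod_(j <- r | j != i) f j x).
Proof.
move=> + fi; elim: r => [|i r IH] /=.
  move=> _; rewrite big_nil (_ : (fun _ => _) = cst 1); first exact: is_derive_cst.
  by apply/funext => y; rewrite big_nil.
move=> /andP[ir /IH{}IH].
rewrite (_ : (fun _ => _) = (fun y => f i y * \prod_(j <- r) f j y)); last first.
  by apply/funext => y; rewrite big_cons.
apply: is_derive_eq (is_derive_mul (fi i) IH) _.
rewrite big_cons big_cons eqxx /=; congr (_ * _ + _).
  rewrite [LHS]big_seq [RHS]big_seq_cond; apply: eq_bigl => j.
  by case: eqVneq => [->|]; rewrite ?(negbTE ir) ?andbT.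
rewrite mulr_sumr [LHS]big_seq [RHS]big_seq; apply: eq_bigr => j jr.
rewrite big_cons; have -> /= : i != j by apply: contraNneq ir => ->.
by rewrite mulrCA.
Qed.

(** Jacobi's formula. The product rule on the Leibniz expansion differentiates one row at a time,
    and expansion along that row produces the cofactors. *)
Lemma is_derive_det (R : realType) (V : normedModType R) n (A : V -> 'M[R]_n) x v A' :
  is_derive x v A A' ->
  is_derive x v (fun y => \det (A y)) (\tr (\adj (A x) *m A')).
Proof.
move=> /is_derive_mxP dA.
have H (s : 'S_n) : is_derive x v (fun y => (-1) ^+ s * \prod_i A y i (s i))
   ((-1) ^+ s * \sum_i A' i (s i) * \prod_(j | j != i) A x j (s j)).
  have := is_derive_mul (is_derive_cst ((-1) ^+ s : R) x v)
    (is_derive_prod (index_enum_uniq _) (fun i => dA i (s i))).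
  by rewrite mul0r add0r.
apply: is_derive_eq (is_derive_big _ H) _.
rewrite mxtrace_mulC.
have -> : \tr (A' *m \adj (A x)) = \sum_k \det (\matrix_(i, j)
    if i == k then A' i j else A x i j).
  apply: eq_bigr => k _; rewrite mxE (expand_det_row _ k); apply: eq_bigr => j _.
  rewrite !mxE eqxx; congr (_ * _); rewrite /cofactor; congr (_ * \det _).
  apply/matrixP => a b; rewrite !mxE.
  by rewrite eq_sym (negbTE (neq_lift _ _)).
rewrite exchange_big /=; apply: eq_bigr => s _.
rewrite mulr_sumr; apply: eq_bigr => k _.
rewrite [in RHS](bigD1 k) //= !mxE eqxx; congr (_ * (_ * _)).
by apply: eq_bigr => j jk; rewrite mxE (negbTE jk).
Qed.

(** * Levi-Civita connection and curvature in a chart *)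

Section Entries.
Context {R : realType} {m n : nat}.
Implicit Types A B : 'M[R]_(m, n).

Lemma mxDE A B a b : (A + B) a b = A a b + B a b.
Proof. by rewrite mxE. Qed.

Lemma mxNE A a b : (- A) a b = - A a b.
Proof. by rewrite mxE. Qed.

Lemma mxBE A B a b : (A - B) a b = A a b - B a b.
Proof. by rewrite !mxE. Qed.

End Entries.

Lemma mxME (R : realType) m n p (A : 'M[R]_(m, n)) (B : 'M[R]_(n, p)) a b :
  (A *m B) a b = \sum_e A a e * B e b.
Proof. by rewrite mxE. Qed.

HB.lock Definition Gam (R : realType) (M : manifold4 R) (g : lorentz_metric M)
    (i : mindex M) (c : 'I_4) (x : 'cV[R]_4) : 'M[R]_4 :=
  \matrix_(a, b) christoffel g i x a c b.

(** Christoffel symbols of the first kind. Keeping the inverse metric apart makes metric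
    compatibility and uniqueness linear in the derivatives of the metric. *)
HB.lock Definition lowGam (R : realType) (M : manifold4 R) (g : lorentz_metric M)
    (i : mindex M) (c : 'I_4) (x : 'cV[R]_4) : 'M[R]_4 :=
  \matrix_(a, b) (2^-1 * (partial c (fun y => g i y a b) x
    + partial b (fun y => g i y a c) x - partial a (fun y => g i y c b) x)).

HB.lock Definition Riem (R : realType) (M : manifold4 R) (g : lorentz_metric M)
    (i : mindex M) (c d : 'I_4) (x : 'cV[R]_4) : 'M[R]_4 :=
  \matrix_(a, b) riemann g i x a b c d.

Section Chart.
Context {R : realType} (M : manifold4 R) (g : lorentz_metric M) (i : mindex M).
Local Notation pt := ('cV[R]_4).
Local Notation W := (mrange i).
Local Notation Gam_ := (Gam g i).
Local Notation lowGam_ := (lowGam g i).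
Local Notation Riem_ := (Riem g i).

Lemma mrange_open' : open W.
Proof. exact: mrange_open. Qed.
Hint Resolve mrange_open' : core.

Lemma metric_Ck k : Ckmx W k (g i).
Proof. by apply: smooth_on_Ckmx => //; exact: gcomp_smooth. Qed.

Lemma metric_symE x a b : W x -> g i x a b = g i x b a.
Proof. by move=> /(gcomp_sym g) gs; rewrite -[in LHS]gs mxE. Qed.

Lemma partial_metric_sym c x a b : W x ->
  partial c (fun y => g i y a b) x = partial c (fun y => g i y b a) x.
Proof.
move=> Wx; apply: near_eq_derive.
by apply: (near_open mrange_open' Wx) => y Wy; exact: metric_symE.
Qed.

(** Congruence multiplies the determinant by a positive square. The sign makes [\det g' / \det g]
    positive, which its logarithm in [rho] requires. *)
Lemma lorentz_det (h : 'M[R]_4) : lorentz_signature h -> \det h < 0.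
Proof.
move=> [P uP /(congr1 determinant)]; rewrite !det_mulmx det_tr.
have -> : \det (@Defs.minkowski R) = -1.
  by rewrite /Defs.minkowski det_diag !big_ord_recl big_ord0 !mxE /= !mulr1.
rewrite unitmxE unitfE in uP => E.
have p2 : 0 < \det P * \det P by rewrite -expr2 exprn_even_gt0.
rewrite -(pmulr_llt0 _ p2).
have -> : \det h * (\det P * \det P) = -1 by rewrite -E; ring.
by rewrite oppr_lt0.
Qed.

Lemma metric_det x : W x -> \det (g i x) < 0.
Proof. by move=> Wx; exact/lorentz_det/gcomp_lorentz. Qed.

Lemma metric_unit x : W x -> g i x \in unitmx.
Proof. by move=> Wx; rewrite unitmxE unitfE lt_eqF // metric_det. Qed.

Lemma GamEntry c x a b : Gam_ c x a b = christoffel g i x a c b.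
Proof. by rewrite Gam.unlock mxE. Qed.

Lemma lowGamEntry c x a b : lowGam_ c x a b =
  2^-1 * (partial c (fun y => g i y a b) x
    + partial b (fun y => g i y a c) x - partial a (fun y => g i y c b) x).
Proof. by rewrite lowGam.unlock mxE. Qed.

Lemma GamE c x : Gam_ c x = invmx (g i x) *m lowGam_ c x.
Proof.
apply/matrixP => a b; rewrite GamEntry mxME /christoffel mulr_sumr.
by apply: eq_bigr => d _; rewrite lowGamEntry mulrCA.
Qed.

Lemma Gam_Ck k c : Ckmx W k (Gam_ c).
Proof.
have CG : Ckmx W k (fun x => invmx (g i x) *m lowGam_ c x).
  apply: CkmxM => //; first exact: (Ckmx_inv mrange_open' metric_unit (metric_Ck k)).
  move=> a b.
  apply: (@Ck_ext _ k W (fun x => 2^-1 * (partial c (fun y => g i y a b) x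
    + partial b (fun y => g i y a c) x - partial a (fun y => g i y c b) x))) => //.
    by move=> x _; rewrite lowGamEntry.
  apply: CkM => //; first exact: Ck_cst.
  by apply: CkB => //; first apply: CkD => //; exact: Ck_partial (metric_Ck k.+1 _ _).
by apply: Ckmx_ext CG => // x _; rewrite GamE.
Qed.

Lemma Gam_sym x a b c : W x -> Gam_ b x a c = Gam_ c x a b.
Proof.
move=> Wx; rewrite !GamE !mxME; apply: eq_bigr => d _; rewrite !lowGamEntry.
by rewrite (partial_metric_sym d b c Wx) [X in X - _]addrC.
Qed.

Lemma metric_Gam c x : W x -> g i x *m Gam_ c x = lowGam_ c x.
Proof. by move=> Wx; rewrite GamE mulKVmx // metric_unit. Qed.

Lemma metric_compat c x : W x ->
  dmx c (g i) x = g i x *m Gam_ c x + (Gam_ c x)^T *m g i x.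
Proof.
move=> Wx; have -> : (Gam_ c x)^T *m g i x = (lowGam_ c x)^T.
  by rewrite -metric_Gam // trmx_mul (gcomp_sym g Wx).
rewrite metric_Gam //; apply/matrixP => a b.
rewrite dmxE mxDE [X in _ = _ + X]mxE !lowGamEntry.
rewrite (partial_metric_sym c b a Wx) (partial_metric_sym a b c Wx).
rewrite (partial_metric_sym b c a Wx).
move: (partial c _ x) (partial b _ x) (partial a _ x) => p q r; lra.
Qed.

(** Koszul's argument: the three permutations of metric compatibility, combined with symmetry, can
    be solved for the lowered coefficients. *)
Lemma Gam_unique (G : 'I_4 -> 'M[R]_4) x : W x ->
  (forall a b c, G b a c = G c a b) ->
  (forall c, dmx c (g i) x = g i x *m G c + (G c)^T *m g i x) ->
  forall c, G c = Gam_ c x.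
Proof.
move=> Wx Gs Gm c; rewrite GamE; apply: (canRL (mulKmx (metric_unit Wx))).
pose L c := g i x *m G c.
have Ls a b d : L b a d = L d a b.
  by rewrite !mxME; apply: eq_bigr => e _; rewrite Gs.
have Lm d a b : partial d (fun y => g i y a b) x = L d a b + L d b a.
  have -> : partial d (fun y => g i y a b) x = dmx d (g i) x a b by rewrite dmxE.
  rewrite Gm mxDE; congr (_ + _); rewrite /L !mxME.
  by apply: eq_bigr => e _; rewrite mxE mulrC (metric_symE _ _ Wx).
apply/matrixP => a b; rewrite -/(L c) lowGamEntry !Lm.
rewrite (Ls a b c) (Ls b c a) (Ls c b a).
move: (L c a b) (L a b c) (L a c b) => p q r; lra.
Qed.

Lemma RiemEntry c d x a b : Riem_ c d x a b = riemann g i x a b c d.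
Proof. by rewrite Riem.unlock mxE. Qed.

Lemma RiemE c d x : Riem_ c d x = dmx c (Gam_ d) x - dmx d (Gam_ c) x
  + (Gam_ c x *m Gam_ d x - Gam_ d x *m Gam_ c x).
Proof.
apply/matrixP => a b; rewrite mxDE !mxBE !dmxE !mxME RiemEntry /riemann.
have E c' d' : (fun y => Gam_ c' y a d') = (fun y => christoffel g i y a c' d').
  by apply/funext => y; rewrite GamEntry.
rewrite !E; congr (_ + _); rewrite -sumrB.
by apply: eq_bigr => e _; rewrite !GamEntry.
Qed.

Lemma Riem_Ck k c d : Ckmx W k (Riem_ c d).
Proof.
have H : Ckmx W k (fun x => dmx c (Gam_ d) x - dmx d (Gam_ c) x
  + (Gam_ c x *m Gam_ d x - Gam_ d x *m Gam_ c x)).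
  have CM a b : Ckmx W k (fun x => Gam_ a x *m Gam_ b x).
    by apply: CkmxM => //; exact: Gam_Ck.
  have Cd a b : Ckmx W k (dmx a (Gam_ b)).
    by apply: Ckmx_dmx => //; exact: Gam_Ck.
  move=> a b; apply: (@Ck_ext _ k W (fun x => dmx c (Gam_ d) x a b - dmx d (Gam_ c) x a b
    + ((Gam_ c x *m Gam_ d x) a b - (Gam_ d x *m Gam_ c x) a b))) => //.
    by move=> x _; rewrite mxDE !mxBE.
  by apply: CkD => //; apply: CkB => //; (exact: Cd || exact: CM).
by apply: Ckmx_ext H => // x _; rewrite RiemE.
Qed.

Lemma Riem_anti c d x : Riem_ c d x = - Riem_ d c x.
Proof. by rewrite !RiemE; rewrite opprD !opprB. Qed.

Lemma dmx_Gam_sym e x a b c : W x -> dmx e (Gam_ b) x a c = dmx e (Gam_ c) x a b.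
Proof.
move=> Wx; rewrite !dmxE; apply: near_eq_derive.
by apply: (near_open mrange_open' Wx) => y Wy; exact: Gam_sym.
Qed.

Lemma Riem_bianchi x a b c d : W x ->
  Riem_ c d x a b + Riem_ d b x a c + Riem_ b c x a d = 0.
Proof.
move=> Wx.
have E c' d' b' : Riem_ c' d' x a b' = dmx c' (Gam_ d') x a b' - dmx d' (Gam_ c') x a b'
    + (\sum_e Gam_ c' x a e * Gam_ d' x e b' - \sum_e Gam_ d' x a e * Gam_ c' x e b').
  by rewrite RiemE mxDE !mxBE !mxME.
rewrite !E.
have S b' c' e' : \sum_e Gam_ e' x a e * Gam_ b' x e c' =
    \sum_e Gam_ e' x a e * Gam_ c' x e b'.
  by apply: eq_bigr => e _; rewrite (Gam_sym e b' c' Wx).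
rewrite (S d b c) (S c b d) (S d c b).
rewrite (dmx_Gam_sym c a d b Wx) (dmx_Gam_sym d a b c Wx) (dmx_Gam_sym b a d c Wx).
ring.
Qed.

End Chart.

(** * Change of chart *)

Section Transition.
Context {R : realType} (M : manifold4 R).
Local Notation pt := ('cV[R]_4).
Local Notation e_ b := (@delta_mx R 4 1 b 0).
Implicit Types i j : mindex M.

Lemma mulmx_delta m n (A : 'M[R]_(m, n)) a b : (A *m delta_mx b (0 : 'I_1)) a 0 = A a b.
Proof. by rewrite -colE mxE. Qed.

Lemma mrange_to i p : mdom M i p -> mrange i (mto M i p).
Proof. by move=> ip; exists p. Qed.

Lemma mrange_dom i x : mrange i x -> mdom M i (mfrom M i x).
Proof. by move=> [p ip <-]; rewrite mtoK. Qed.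

Lemma mfromK i x : mrange i x -> mto M i (mfrom M i x) = x.
Proof. by move=> [p ip <-]; rewrite mtoK. Qed.

Lemma mto_cvg i p : mdom M i p -> {for p, continuous (mto M i)}.
Proof.
move=> ip; have := @mto_continuous _ M i.
by rewrite continuous_open_subspace; [apply; rewrite inE|exact: mdom_open].
Qed.

Lemma mfrom_cvg i x : mrange i x -> {for x, continuous (mfrom M i)}.
Proof.
move=> ix; have := @mfrom_continuous _ M i.
by rewrite continuous_open_subspace; [apply; rewrite inE|exact: mrange_open].
Qed.

Definition overlap i j : set pt := mto M i @` (mdom M i `&` mdom M j).

Lemma overlapP i j x : overlap i j x <-> mrange i x /\ mdom M j (mfrom M i x).
Proof.
split=> [[p [ip jp] <-]|[ix jx]]; first by rewrite mtoK //; split => //; exists p.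
by exists (mfrom M i x); [split => //; exact: mrange_dom|exact: mfromK].
Qed.

Lemma overlap_open i j : open (overlap i j).
Proof.
rewrite openE => x /overlapP[ix jx]; rewrite /interior.
have n1 : nbhs x (mrange i) by apply: open_nbhs_nbhs; split => //; exact: mrange_open.
have n2 : nbhs x (mfrom M i @^-1` mdom M j).
  by apply: (mfrom_cvg ix); apply: open_nbhs_nbhs; split => //; exact: mdom_open.
by apply: filterS (filterI n1 n2) => y [iy jy]; apply/overlapP.
Qed.

Definition trans i j : pt -> pt := mto M j \o mfrom M i.

Lemma trans_range i j x : overlap i j x -> mrange j (trans i j x).
Proof. by case/overlapP => _ jx; exact: mrange_to. Qed.

Lemma trans_from i j x : overlap i j x -> mfrom M j (trans i j x) = mfrom M i x.
Proof. by case/overlapP => _ jx; rewrite /trans /= mtoK. Qed.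

Lemma trans_overlap i j x : overlap i j x -> overlap j i (trans i j x).
Proof.
move=> ijx; apply/overlapP; split; first exact: trans_range.
by rewrite trans_from //; apply: mrange_dom; case/overlapP: ijx.
Qed.

Lemma transK i j x : overlap i j x -> trans j i (trans i j x) = x.
Proof.
move=> ijx; rewrite {1}/trans /= trans_from //; apply: mfromK.
by case/overlapP: ijx.
Qed.

Lemma trans_Ck i j k : Ckmx (overlap i j) k (trans i j).
Proof. by apply: smooth_on_Ckmx; [exact: overlap_open|exact: mtrans_smooth]. Qed.

Lemma jacE i j x a b : jac i j x a b = partial b (fun y => trans i j y a 0) x.
Proof. by rewrite mxE. Qed.

Lemma jac_Ck i j k : Ckmx (overlap i j) k (jac i j).
Proof.
move=> a b; apply: Ck_ext (Ck_partial b (@trans_Ck i j k.+1 a 0)).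
  exact: overlap_open.
by move=> x _; rewrite jacE.
Qed.

Lemma trans_chain (V : normedModType R) i j (y : V -> pt) (t v : V) y' :
  overlap i j (y t) -> is_derive t v y y' ->
  is_derive t v (fun u => trans i j (y u)) (jac i j (y t) *m y').
Proof.
move=> ijy dy; apply/is_derive_mxP => a b; rewrite (ord1 b) mxME.
have := C1_chain (@overlap_open i j) (@trans_Ck i j 1 a 0) ijy dy.
by under eq_bigr do rewrite -jacE.
Qed.

Lemma jacK i j x : overlap i j x -> jac j i (trans i j x) *m jac i j x = 1%:M.
Proof.
move=> ijx; apply/matrixP => a b.
have dt : is_derive x (e_ b) (trans i j) (jac i j x *m e_ b).
  exact: (@trans_chain pt i j id x (e_ b) (e_ b) ijx (is_derive_id _ _)).
have := trans_chain (trans_overlap ijx) dt.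
have E : \near x, trans j i (trans i j x) = x.
  by apply: (near_open (@overlap_open i j) ijx) => y; exact: transK.
move=> /(is_derive_near_eq E) /is_derive_uniq /(_ (is_derive_id _ _)).
rewrite mulmxA => /(congr1 (fun A : pt => A a 0)).
by rewrite mulmx_delta => ->; rewrite !mxE andbT.
Qed.

Lemma jac_unit i j x : overlap i j x -> jac i j x \in unitmx.
Proof. by move=> /jacK /mulmx1_unit[]. Qed.

Variable g : lorentz_metric M.

Lemma metric_trans i j x : overlap i j x ->
  g i x = (jac i j x)^T *m g j (trans i j x) *m jac i j x.
Proof.
move=> /overlapP[ix jx]; have := gcomp_tensor g (mrange_dom ix) jx.
by rewrite mfromK.
Qed.

(* The right-hand side defines a symmetric metric connection, which is unique. *)
Lemma Gam_trans i j x c : overlap i j x ->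
  jac i j x *m Gam g i c x = dmx c (jac i j) x
    + (\sum_d jac i j x d c *: Gam g j d (trans i j x)) *m jac i j x.
Proof.
move=> ijx; have [ix jx] := (overlapP _ _ _).1 ijx.
have uJ := jac_unit ijx; have jt := trans_range ijx.
set J := jac i j x.
pose S c := \sum_d J d c *: Gam g j d (trans i j x).
pose G c := invmx J *m (dmx c (jac i j) x + S c *m J).
suff <- : G c = Gam g i c x by rewrite /G mulKVmx.
have JG b : J *m G b = dmx b (jac i j) x + S b *m J by rewrite /G mulKVmx.
apply: (@Gam_unique _ M g i (fun c => G c) x ix).
  move=> a b d; rewrite /G !mxME; apply: eq_bigr => f _; congr (_ * _).
  rewrite !mxDE; congr (_ + _).
    rewrite !dmxE.
    have E a' b' : (fun y => jac i j y a' b') = partial b' (fun y => trans i j y a' 0).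
      by apply/funext => y; rewrite jacE.
    rewrite !E; exact: schwarz (@overlap_open i j) (@trans_Ck i j 2 f 0) ijx.
  have E b' d' : (S b' *m J) f d' =
      \sum_k \sum_e J e b' * J k d' * Gam g j e (trans i j x) f k.
    rewrite mxME; apply: eq_bigr => k _; rewrite /S summxE mulr_suml.
    by apply: eq_bigr => e _; rewrite mxE mulrAC.
  rewrite !E exchange_big /=; apply: eq_bigr => k _; apply: eq_bigr => e _.
  by rewrite (Gam_sym g f k e jt) [_ * J e _]mulrC.
move=> b.
have dJ : is_derive x (e_ b) (jac i j) (dmx b (jac i j) x).
  exact: Ckmx_derive (@jac_Ck i j 1) ijx.
have dg : is_derive x (e_ b) (fun y => g j (trans i j y))
    (g j (trans i j x) *m S b + (S b)^T *m g j (trans i j x)).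
  have dt : is_derive x (e_ b) (trans i j) (J *m e_ b).
    exact: (@trans_chain pt i j id x (e_ b) (e_ b) ijx (is_derive_id _ _)).
  apply/is_derive_mxP => p q.
  have := C1_chain (@mrange_open' _ M j) (metric_Ck g j 1 p q) jt dt.
  congr is_derive.
  have -> : g j (trans i j x) *m S b + (S b)^T *m g j (trans i j x) =
      \sum_d J d b *: dmx d (g j) (trans i j x).
    rewrite /S mulmx_sumr linear_sum /= mulmx_suml -big_split /=.
    apply: eq_bigr => d _.
    by rewrite metric_compat // scalerDr -scalemxAr linearZ /= -scalemxAl.
  rewrite summxE; apply: eq_bigr => d _; rewrite [RHS]mxE dmxE mulrC; congr (_ * _).
  exact: mulmx_delta.
have H := is_derive_mulmx (is_derive_mulmx (is_derive_trmx dJ) dg) dJ.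
have E : \near x, (jac i j x)^T *m g j (trans i j x) *m jac i j x = g i x.
  by apply: (near_open (@overlap_open i j) ijx) => y ijy; rewrite -metric_trans.
move: H => /(is_derive_near_eq E) /is_derive_uniq.
move=> /(_ _ (Ckmx_derive b (metric_Ck g i 1) ix)) <-.
have -> : g i x *m G b =
    J^T *m g j (trans i j x) *m (dmx b (jac i j) x + S b *m J).
  by rewrite (metric_trans ijx) -/J -mulmxA JG.
have -> : (G b)^T *m g i x =
    (dmx b (jac i j) x + S b *m J)^T *m (g j (trans i j x) *m J).
  by rewrite (metric_trans ijx) -/J -(JG b) [(J *m G b)^T]trmx_mul !mulmxA.
rewrite -/J; move: (dmx b (jac i j) x) (g j (trans i j x)) (S b) => D h s.
rewrite [(D + s *m J)^T]linearD /= [(s *m J)^T]trmx_mul.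
rewrite !mulmxDl !mulmxDr !mulmxDl !mulmxA !addrA.
by rewrite [LHS](ACl (4*2*1*3))%AC.
Qed.

End Transition.

(** * Bounds and Lipschitz constants near a point *)

Section LocalLipschitz.
Context {R : realType}.
Local Notation pt := ('cV[R]_4).
Local Notation e_ b := (@delta_mx R 4 1 b 0).

Lemma uniform_radius (I : finType) (P : I -> R -> Prop) :
  (forall i (r r' : R), P i r -> 0 < r' -> r' <= r -> P i r') ->
  (forall i, exists2 r : R, 0 < r & P i r) ->
  exists2 r : R, 0 < r & forall i, P i r.
Proof.
move=> mono HP.
have /choice[r /all_and2[r0 Pr]] : forall i, exists r : R, 0 < r /\ P i r.
  by move=> i; have [r r0 Pr] := HP i; exists r.
exists (\big[Num.min/1]_i r i); last first.
  move=> i; apply: mono (Pr i) _ _; last exact: bigmin_le_cond.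
  by apply: lt_bigmin.
by apply: lt_bigmin.
Qed.

Lemma Ck_lipschitz (W : set pt) (f : pt -> R) (x0 : pt) (r K : R) : open W -> Ck 1 W f -> 0 <= K ->
  (forall y : pt, `|y - x0| <= r -> W y) ->
  (forall b (y : pt), `|y - x0| <= r -> `|partial b f y| <= K) ->
  forall y z : pt, `|y - x0| <= r -> `|z - x0| <= r ->
  `|f y - f z| <= 4 * K * `|y - z|.
Proof.
move=> oW Cf K0 rW pK y z yr zr.
pose c (t : R) : pt := z + t *: (y - z).
have cr (t : R) : 0 <= t <= 1 -> `|c t - x0| <= r.
  move=> /andP[t0 t1]; have -> : c t - x0 = (1 - t) *: (z - x0) + t *: (y - x0).
    by apply/matrixP => i j; rewrite !mxE; ring.
  rewrite (le_trans (ler_normD _ _)) // !normrZ ger0_norm ?subr_ge0 // (ger0_norm t0).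
  have h1 : (1 - t) * `|z - x0| <= (1 - t) * r by rewrite ler_wpM2l // subr_ge0.
  have h2 : t * `|y - x0| <= t * r by rewrite ler_wpM2l.
  lra.
have dc (t : R) : is_derive t 1 c (y - z).
  by apply: is_derive_line.
have df (t : R) : 0 <= t <= 1 -> is_derive t 1 (fun u => f (c u))
    (\sum_b partial b f (c t) * (y - z) b 0).
  by move=> t01; exact: C1_chain oW Cf (rW _ (cr t t01)) (dc t).
have [| |t t01] := @MVT_segment _ (fun u => f (c u))
    (fun t => \sum_b partial b f (c t) * (y - z) b 0) 0 1 ler01.
- by move=> t /[!in_itv]/= /andP[? ?]; apply: df; rewrite !ltW.
- by apply: derivable_within_continuous => t /[!in_itv]/= /df [].
rewrite subr0 mulr1 /c scale1r scale0r addr0 (addrC z) subrK => ->.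
rewrite (le_trans (ler_norm_sum _ _ _)) //.
have -> : 4 * K * `|y - z| = \sum_(b < 4) K * `|y - z|.
  by rewrite !big_ord_recl big_ord0; ring.
apply: ler_sum => b _; rewrite normrM ler_pM // ?mx_entry_le //.
by apply: pK; apply: cr; move: t01; rewrite in_itv.
Qed.

Lemma continuous_loc_bounded m n p q (f : 'M[R]_(m, n) -> 'M[R]_(p, q)) x :
  {for x, continuous f} -> exists2 r : R, 0 < r &
  forall y : 'M[R]_(m, n), `|y - x| <= r -> `|f y| <= `|f x| + 1.
Proof.
move=> /continuous_mxP/(_ 1 ltr01)[d d0 Hd]; exists (d / 2); first by rewrite divr_gt0.
move=> y yx; have /Hd : `|y - x| < d by apply: le_lt_trans yx _; lra.
by move=> h; rewrite -[f y](subrK (f x)) (le_trans (ler_normD _ _)) // addrC lerD2l ltW.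
Qed.

(** One radius and one constant for the whole finite family: the four connection matrices enter the
    Picard and transport estimates together. *)
Lemma Ckmx_loc_lipschitz (I : finType) m n (W : set pt)
    (A : I -> pt -> 'M[R]_(m, n)) (x0 : pt) :
  open W -> (forall c, Ckmx W 1 (A c)) -> W x0 ->
  exists r K : R, [/\ 0 < r, 0 <= K, forall y : pt, `|y - x0| <= r -> W y,
    forall c (y : pt), `|y - x0| <= r -> `|A c y| <= K &
    forall c (y z : pt), `|y - x0| <= r -> `|z - x0| <= r ->
      `|A c y - A c z| <= K * `|y - z|].
Proof.
move=> oW CA Wx.
have [rW rW0 HW] := open_mx_ball oW Wx.
have [r1 r10 H1] : exists2 r : R, 0 < r & forall c, forall y : pt, `|y - x0| <= r ->
    `|A c y| <= `|A c x0| + 1.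
  apply: (@uniform_radius I (fun c r => forall y : pt, `|y - x0| <= r ->
    `|A c y| <= `|A c x0| + 1)).
    by move=> c r r' H _ rr' y yr; apply: H; exact: le_trans rr'.
  by move=> c; apply: continuous_loc_bounded; exact: Ckmx_continuous (CA c) Wx.
have [r2 r20 H2] : exists2 r : R, 0 < r & forall cb : I * 'I_4,
    forall y : pt, `|y - x0| <= r ->
    `|dmx cb.2 (A cb.1) y| <= `|dmx cb.2 (A cb.1) x0| + 1.
  apply: (@uniform_radius _ (fun cb r => forall y : pt, `|y - x0| <= r ->
    `|dmx cb.2 (A cb.1) y| <= `|dmx cb.2 (A cb.1) x0| + 1)).
    by move=> c r r' H _ rr' y yr; apply: H; exact: le_trans rr'.
  move=> [c b] /=; apply: continuous_loc_bounded.
  exact: Ckmx_continuous (Ckmx_dmx oW b (CA c)) Wx.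
pose K1 := \sum_c (`|A c x0| + 1).
pose K2 := \sum_(cb : I * 'I_4) (`|dmx cb.2 (A cb.1) x0| + 1).
have K10 : 0 <= K1 by apply: sumr_ge0 => c _; rewrite addr_ge0.
have K20 : 0 <= K2 by apply: sumr_ge0 => c _; rewrite addr_ge0.
pose r := Num.min (rW / 2) (Num.min r1 r2).
have rr (y : pt) : `|y - x0| <= r -> [/\ `|y - x0| < rW, `|y - x0| <= r1 & `|y - x0| <= r2].
  by rewrite /r !le_min => /and3P[h1 h2 h3]; split => //; apply: le_lt_trans h1 _; lra.
exists r, (K1 + 4 * K2); split.
- by rewrite !lt_min divr_gt0 // r10.
- by rewrite addr_ge0 // mulr_ge0.
- by move=> y /rr[/HW].
- move=> c y /rr[_ /H1 h _]; apply: le_trans (h c) _; rewrite ler_wpDr ?mulr_ge0 //.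
  by rewrite /K1 (bigD1 c) //= lerDl sumr_ge0 // => c' _; rewrite addr_ge0.
- move=> c y z yr zr; apply: (@le_trans _ _ (4 * K2 * `|y - z|)); last first.
    by rewrite ler_wpM2r // lerDr.
  apply: mx_norm_le => [|a b]; first by rewrite !mulr_ge0.
  rewrite mxBE; apply: (@Ck_lipschitz W (fun y => A c y a b) x0 r) => //.
  - exact: CA.
  - by move=> y' /rr[/HW].
  - move=> b' y' /rr[_ _ /H2 h]; rewrite -dmxE (le_trans (mx_entry_le _ _ _)) //.
    apply: le_trans (h (c, b')) _; rewrite /K2 (bigD1 (c, b')) //= lerDl.
    by rewrite sumr_ge0 // => c' _; rewrite addr_ge0.
Qed.

End LocalLipschitz.

(** * Geodesics and projective change *)

Section Geodesics.
Context {R : realType} (M : manifold4 R).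
Local Notation pt := ('cV[R]_4).
Local Notation e_ b := (@delta_mx R 4 1 b 0).

(** The connection term of the geodesic equation, quadratic in the velocity [w]. *)
Definition acc (g : lorentz_metric M) (i : mindex M) (x w : pt) : pt :=
  \sum_b w b 0 *: (Gam g i b x *m w).

Lemma accE g i x w : acc g i x w =
  \col_a \sum_(b < 4) \sum_(d < 4) christoffel g i x a b d * w b 0 * w d 0.
Proof.
apply/matrixP => a k; rewrite (ord1 k) /acc summxE mxE; apply: eq_bigr => b _.
rewrite mxE mxME mulr_sumr; apply: eq_bigr => d _.
by rewrite GamEntry mulrA [w b 0 * _]mulrC.
Qed.

Lemma accZ g i x (c : R) w : acc g i x (c *: w) = (c * c) *: acc g i x w.
Proof.
rewrite /acc scaler_sumr; apply: eq_bigr => b _.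
by rewrite mxE -scalemxAr !scalerA; congr (_ *: _); ring.
Qed.

Lemma acc_bound g i (x w : pt) (K B : R) : 0 <= K -> 0 <= B ->
  (forall b, `|Gam g i b x| <= K) -> `|w| <= B -> `|acc g i x w| <= 16 * K * B * B.
Proof.
move=> K0 B0 GK wB; rewrite /acc (le_trans (ler_norm_sum _ _ _)) //.
have -> : 16 * K * B * B = \sum_(b < 4) B * (4 * K * B).
  by rewrite !big_ord_recl big_ord0; ring.
apply: ler_sum => b _; rewrite normrZ ler_pM // ?(le_trans (mx_entry_le _ _ _)) //.
by rewrite (le_trans (mulmx_norm_le _ _)) // ler_pM ?mulr_ge0 // ler_wpM2l.
Qed.

Lemma acc_lip g i (x y w z : pt) (K B d : R) : 0 <= K -> 0 <= B -> 0 <= d ->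
  (forall b, `|Gam g i b x| <= K) -> (forall b, `|Gam g i b y| <= K) ->
  (forall b, `|Gam g i b x - Gam g i b y| <= K * d) ->
  `|w| <= B -> `|z| <= B -> `|w - z| <= d ->
  `|acc g i x w - acc g i y z| <= 16 * K * B * (2 + B) * d.
Proof.
move=> K0 B0 d0 Gx Gy Gxy wB zB wz.
rewrite /acc -sumrB (le_trans (ler_norm_sum _ _ _)) //.
have -> : 16 * K * B * (2 + B) * d =
    \sum_(b < 4) (d * (4 * K * B) + B * (4 * (K * d) * B) + B * (4 * K * d)).
  by rewrite !big_ord_recl big_ord0; ring.
apply: ler_sum => b _.
(* The three factors are changed one at a time: first velocity, connection matrix, second
   velocity. *)
have -> : w b 0 *: (Gam g i b x *m w) - z b 0 *: (Gam g i b y *m z) =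
    (w - z) b 0 *: (Gam g i b x *m w) + z b 0 *: ((Gam g i b x - Gam g i b y) *m w)
    + z b 0 *: (Gam g i b y *m (w - z)).
  rewrite mulmxBl mulmxBr mxBE scalerBl !scalerBr.
  by rewrite !addrA subrK subrK.
have mm (A : 'M[R]_4) (u : pt) (C E : R) : 0 <= C -> `|A| <= C -> `|u| <= E ->
    `|A *m u| <= 4 * C * E.
  move=> C0 AC uE; rewrite (le_trans (mulmx_norm_le _ _)) // ler_pM ?mulr_ge0 //.
  by rewrite ler_wpM2l.
rewrite (le_trans (ler_normD _ _)) // lerD //.
  rewrite (le_trans (ler_normD _ _)) // lerD // normrZ ler_pM //.
  - exact: le_trans (mx_entry_le _ _ _) wz.
  - exact: mm.
  - exact: le_trans (mx_entry_le _ _ _) zB.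
  - by apply: mm => //; rewrite mulr_ge0.
by rewrite normrZ ler_pM // ?mm // (le_trans (mx_entry_le _ _ _)).
Qed.

Lemma row_mx_norm m n p (A : 'M[R]_(m, n)) (B : 'M[R]_(m, p)) (C : R) :
  `|A| <= C -> `|B| <= C -> `|row_mx A B| <= C.
Proof.
move=> leA leB; apply: mx_norm_le => [|i j]; first exact: le_trans leA.
rewrite mxE; case: (fintype.split j) => k.
  exact: le_trans (mx_entry_le _ _ _) leA.
exact: le_trans (mx_entry_le _ _ _) leB.
Qed.

Lemma lsubmx_norm m n p (A : 'M[R]_(m, n + p)) : `|lsubmx A| <= `|A|.
Proof. by apply: mx_norm_le => // i j; rewrite mxE mx_entry_le. Qed.

Lemma rsubmx_norm m n p (A : 'M[R]_(m, n + p)) : `|rsubmx A| <= `|A|.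
Proof. by apply: mx_norm_le => // i j; rewrite mxE mx_entry_le. Qed.

Lemma is_derive_lsubmx (V : normedModType R) m n p (A : V -> 'M[R]_(m, n + p)) x v A' :
  is_derive x v A A' -> is_derive x v (fun y => lsubmx (A y)) (lsubmx A').
Proof.
move=> /is_derive_mxP HA; apply/is_derive_mxP => a b; rewrite mxE.
rewrite (_ : (fun _ => _) = (fun y => A y a (lshift p b))) //.
by apply/funext => y; rewrite mxE.
Qed.

Lemma is_derive_rsubmx (V : normedModType R) m n p (A : V -> 'M[R]_(m, n + p)) x v A' :
  is_derive x v A A' -> is_derive x v (fun y => rsubmx (A y)) (rsubmx A').
Proof.
move=> /is_derive_mxP HA; apply/is_derive_mxP => a b; rewrite mxE.
rewrite (_ : (fun _ => _) = (fun y => A y a (rshift n b))) //.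
by apply/funext => y; rewrite mxE.
Qed.

(** Time is slowed down by [eps], so that the solution lives on [[-1, 1]] whatever the initial
    velocity; the true velocity of [x] is [eps *: w]. *)
Lemma geodesic_ode g i (x0 v : pt) : mrange i x0 -> v != 0 ->
  exists (eps : R) (x w : R -> pt), [/\ 0 < eps, x 0 = x0, w 0 = v &
    forall t : R, `|t| <= 1 -> [/\ mrange i (x t), w t != 0,
      is_derive t 1 x (eps *: w t) &
      is_derive t 1 w (- (eps *: acc g i (x t) (w t)))]].
Proof.
move=> ix0 v0.
have [r0 [K [r00 K0 rW GK GL]]] :=
  Ckmx_loc_lipschitz (@mrange_open' _ M i) (fun c => @Gam_Ck _ M g i 1 c) ix0.
have nv0 : 0 < `|v| by rewrite normr_gt0.
(* A radius below [|v|] keeps the velocity away from 0, as the definition of geodesic demands. *)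
pose r := Num.min r0 (`|v| / 2).
have r_gt0 : 0 < r by rewrite lt_min r00 divr_gt0.
have rr0 : r <= r0 by rewrite ge_min lexx.
have rv : r < `|v| by rewrite gt_min; apply/orP; right; lra.
pose B := `|v| + r; have B0 : 0 <= B by rewrite addr_ge0 // ltW.
pose C0 := B + 16 * K * B * B; have C00 : 0 <= C0.
  by rewrite addr_ge0 // !mulr_ge0.
pose L0 := 1 + 16 * K * B * (2 + B); have L00 : 0 <= L0.
  by rewrite addr_ge0 // !mulr_ge0 // addr_ge0.
pose eps := Num.min (r / (C0 + 1)) (2^-1 / (L0 + 1)).
have eps0 : 0 < eps by rewrite lt_min !divr_gt0 // ltr_wpDl.
have epsC : eps * C0 * 1 <= r.
  have h : eps <= r / (C0 + 1) by rewrite ge_min lexx.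
  rewrite ler_pdivlMr ?ltr_wpDl // in h; rewrite mulr1; apply: le_trans h.
  by rewrite ler_wpM2l ?(ltW eps0) // lerDl.
have epsL : eps * L0 * 1 <= 2^-1.
  have h : eps <= 2^-1 / (L0 + 1) by rewrite ge_min lexx orbT.
  rewrite ler_pdivlMr ?ltr_wpDl // in h; rewrite mulr1; apply: le_trans h.
  by rewrite ler_wpM2l ?(ltW eps0) // lerDl.
(* Position and velocity are the two columns of one matrix, which turns the second-order equation
   into a first-order system for [picard]. *)
pose y0 : 'M[R]_(4, 1 + 1) := row_mx x0 v.
pose F (t : R) (y : 'M[R]_(4, 1 + 1)) : 'M[R]_(4, 1 + 1) :=
  eps *: row_mx (rsubmx y) (- acc g i (lsubmx y) (rsubmx y)).
have near y : `|y - y0| <= r -> `|lsubmx y - x0| <= r0 /\ `|rsubmx y - v| <= r.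
  move=> yr; split.
    have := lsubmx_norm (y - y0); rewrite linearB /= row_mxKl => h.
    exact: le_trans h (le_trans yr rr0).
  have := rsubmx_norm (y - y0); rewrite linearB /= row_mxKr => h.
  exact: le_trans h yr.
have wB (w : pt) : `|w - v| <= r -> `|w| <= B.
  by move=> h; rewrite -[w](subrK v) (le_trans (ler_normD _ _)) // addrC lerD2l.
have [|||||||||y [yy0 yr yd]] := @picard R _ _ F y0 1 r (eps * L0) (eps * C0).
- exact: ler01.
- exact: ltW.
- by rewrite mulr_ge0 // ltW.
- by rewrite mulr_ge0 // ltW.
- exact: epsC.
- exact: epsL.
- by move=> t y _ _; exact: cst_continuous.
- move=> t y _ /near[lx wv]; rewrite /F normrZ gtr0_norm // ler_wpM2l ?(ltW eps0) //.
  apply: row_mx_norm.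
    by apply: le_trans (wB _ wv) _; rewrite lerDl !mulr_ge0.
  rewrite normrN (le_trans (acc_bound K0 B0 _ (wB _ wv))) ?lerDr //.
  by move=> b; exact: GK.
- move=> t y z _ /near[ly wy] /near[lz wz].
  rewrite /F -scalerBr normrZ gtr0_norm // -mulrA ler_wpM2l ?(ltW eps0) //.
  rewrite opp_row_mx add_row_mx; apply: row_mx_norm.
    rewrite -linearB /= (le_trans (rsubmx_norm _)) // ler_peMl // lerDl.
    by rewrite !mulr_ge0 // addr_ge0.
  rewrite opprK addrC -normrN opprB.
  have := @acc_lip g i (lsubmx y) (lsubmx z) (rsubmx y) (rsubmx z) K B `|y - z| K0 B0.
  move=> /(_ (normr_ge0 _)) H.
  apply: le_trans (H _ _ _ (wB _ wy) (wB _ wz) _) _.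
  - by move=> b; exact: GK.
  - by move=> b; exact: GK.
  - move=> b; apply: le_trans (GL _ _ _ ly lz) _; rewrite ler_wpM2l //.
    by rewrite -linearB lsubmx_norm.
  - by rewrite -linearB rsubmx_norm.
  - by rewrite ler_wpM2r // lerDr.
exists eps, (fun t => lsubmx (y t)), (fun t => rsubmx (y t)); split => //.
- by rewrite yy0 row_mxKl.
- by rewrite yy0 row_mxKr.
move=> t t1; have [lx wv] := near _ (yr _ t1); split.
- exact: rW.
- by apply: contraTneq wv => ->; rewrite sub0r normrN -ltNge.
- by have := is_derive_lsubmx (yd t t1); rewrite /F linearZ /= row_mxKl.
- by have := is_derive_rsubmx (yd t t1); rewrite /F linearZ /= row_mxKr scalerN.
Qed.

(* [geodesic] quantifies over all charts, hence the use of [Gam_trans]. *)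
Lemma chart_geodesic g i (x w : R -> pt) (eps : R) (D : set R) : open D -> eps != 0 ->
  (forall t : R, D t -> [/\ mrange i (x t), w t != 0, is_derive t 1 x (eps *: w t) &
      is_derive t 1 w (- (eps *: acc g i (x t) (w t)))]) ->
  geodesic g D (fun t => mfrom M i (x t)).
Proof.
move=> oD eps0 H t Dt; have [ix w0 dx dw] := H t Dt; split.
  apply: (@continuous_comp _ _ _ x (mfrom M i)); last exact: mfrom_cvg.
  exact: is_derive_continuous dx.
move=> j jx xj; have ijx : overlap i j (x t) by apply/overlapP.
have nov : \forall s \near t, D s /\ overlap i j (x s).
  apply: filterI; first exact: open_nbhs_nbhs.
  apply: (is_derive_continuous dx); apply: open_nbhs_nbhs; split => //.
  exact: overlap_open.
have dxj (s : R) : D s -> overlap i j (x s) ->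
    is_derive s 1 xj (eps *: (jac i j (x s) *m w s)).
  move=> Ds ijs; have [_ _ dxs _] := H s Ds.
  by have := trans_chain ijs dxs; rewrite -scalemxAr.
have d1E (s : R) : D s -> overlap i j (x s) ->
    derive1 xj s = eps *: (jac i j (x s) *m w s).
  by move=> Ds ijs; exact: is_derive_derive1 (dxj s Ds ijs).
rewrite d1E //; split.
- by case: (dxj t Dt ijx).
- rewrite scaler_eq0 negb_or eps0 /=; apply: contraNneq w0 => Jw.
  by rewrite -[w t](mulKmx (jac_unit ijx)) Jw mulmx0.
have dJ : is_derive t 1 (fun s => jac i j (x s))
    (\sum_b (eps *: w t) b 0 *: dmx b (jac i j) (x t)).
  apply/is_derive_mxP => a b; rewrite summxE.
  have := C1_chain (@overlap_open _ M i j) (@jac_Ck _ M i j 1 a b) ijx dx.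
  congr is_derive; apply: eq_bigr => k _.
  by rewrite [RHS]mxE dmxE mulrC.
have dd : is_derive t 1 (derive1 xj)
    (eps *: ((\sum_b (eps *: w t) b 0 *: dmx b (jac i j) (x t)) *m w t
      + jac i j (x t) *m - (eps *: acc g i (x t) (w t)))).
  apply: (@is_derive_near_eq _ _ _ (fun s => eps *: (jac i j (x s) *m w s))).
    by apply: filterS nov => s [Ds ijs]; rewrite d1E.
  by apply: is_deriveZ; exact: is_derive_mulmx.
apply: is_derive_eq dd _; rewrite -accE accZ.
have -> : acc g j (xj t) (jac i j (x t) *m w t) =
    \sum_b w t b 0 *: ((jac i j (x t) *m Gam g i b (x t) - dmx b (jac i j) (x t)) *m w t).
  rewrite /acc.
  under [RHS]eq_bigr => b _ do
    rewrite (Gam_trans g b ijx) addrAC subrr add0r -mulmxA mulmx_suml scaler_sumr.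
  rewrite exchange_big /=; apply: eq_bigr => d _.
  rewrite mxME scaler_suml; apply: eq_bigr => b _.
  by rewrite -scalemxAl scalerA mulrC.
rewrite -[in RHS]scalerA -[RHS]scalerN; congr (_ *: _).
rewrite mulmxN -scalemxAr /acc mulmx_sumr mulmx_suml.
rewrite -[RHS]scalerN.
have -> : \sum_b (eps *: w t) b 0 *: dmx b (jac i j) (x t) *m w t =
    eps *: \sum_b w t b 0 *: (dmx b (jac i j) (x t) *m w t).
  rewrite scaler_sumr; apply: eq_bigr => b _.
  by rewrite mxE -scalemxAl scalerA.
rewrite -scalerBr; congr (_ *: _).
rewrite -[RHS]sumrN -sumrB; apply: eq_bigr => b _.
by rewrite -scalemxAr -scalerBr mulmxBl mulmxA -scalerN opprB.
Qed.

Lemma derive1n_id k (t : R) : derivable (derive1n k (@id R)) t 1.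
Proof.
have D1 : derive1 (@id R) = cst 1 by apply/funext => s; rewrite derive1_id.
have D0 (c : R) : derive1 (cst c : R -> R) = cst 0.
  by apply/funext => s; rewrite derive1_cst.
case: k => [|k]; first by rewrite derive1n0; exact: derivable_id.
have -> : derive1n k.+1 (@id R) = cst (if k is 0%N then 1 else 0).
  elim: k => [|k IH]; first by rewrite derive1n1 D1.
  by rewrite derive1nS IH D0.
exact: derivable_cst.
Qed.

(** A geodesic of [g] with initial velocity along [v] becomes a geodesic of [g'] after a change of
    parameter [s]. Its second derivative, computed from the equation of [g'] and by the chain rule
    from that of [g], differs by the term in [s''], which is a multiple of the velocity. *)
Lemma projective_acc (g g' : lorentz_metric M) i (x0 v : pt) :
  projectively_related g g' -> mrange i x0 -> v != 0 ->
  exists c : R, acc g' i x0 v - acc g i x0 v = c *: v.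
Proof.
move=> pr ix0 v0.
have [eps [x [w [eps0 xx0 wv H]]]] := geodesic_ode g ix0 v0.
pose D : set R := [set` `]-1, 1[%R].
have DE t : D t <-> -1 < t < 1 by rewrite /D /= in_itv.
have oD : open D by exact: interval_open.
have DH (t : R) : D t -> [/\ mrange i (x t), w t != 0, is_derive t 1 x (eps *: w t) &
    is_derive t 1 w (- (eps *: acc g i (x t) (w t)))].
  by move=> /DE /andP[? ?]; apply: H; rewrite ler_norml !ltW.
have gd := chart_geodesic oD (lt0r_neq0 eps0) DH.
have [] := (pr D (fun t => mfrom M i (x t)) _).1 _.
- by split => //; exact: interval_is_interval.
- exists D, id; split => //; last split => //.
  + by split => //; exact: interval_is_interval.
  + by move=> k t _; exact: derive1n_id.
  + by move=> t _; rewrite derive1_id oner_eq0.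
  + by apply/seteqP; split => t; [case=> ? ? <-|exists t].
move=> D' [s [[oD' _] [ss s0 sD] gd']].
(* The new parameter need not send 0 to 0; surjectivity of [s] onto [D] provides a value at which
   the curve passes through [x0]. *)
have [t0 D't0 st0] : (s @` D') 0 by rewrite sD; apply/DE; rewrite ltrN10 ltr01.
have ds (t : R) : D' t -> is_derive t 1 s (derive1 s t).
  by move=> /(ss 0%N); rewrite derive1n0 => h; split; rewrite ?derive1E.
have dds : is_derive t0 1 (derive1 s) (derive1 (derive1 s) t0).
  by have := ss 1%N t0 D't0; rewrite derive1n1 => h; split; rewrite ?derive1E.
have Ds t : D' t -> D (s t) by rewrite -sD => D't; exists t.
have [_ /(_ i)] := gd' t0 D't0.
have [ixt _ _ _] := DH _ (Ds _ D't0).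
move=> /(_ (mrange_dom ixt)); set y := fun t => mto M i _; move=> [_ _].
have near' : \forall t \near t0, D' t by exact: open_nbhs_nbhs.
have dy (t : R) : D' t -> is_derive t 1 y (derive1 s t *: (eps *: w (s t))).
  move=> D't; have [_ _ dx _] := DH _ (Ds _ D't).
  apply: is_derive_near_eq (is_derive_comp1 dx (ds t D't)).
  apply: (near_open oD' D't) => u D'u; have [ixu _ _ _] := DH _ (Ds _ D'u).
  by rewrite /y /= mfromK.
have y0 : y t0 = x0 by rewrite /y /= mfromK // st0.
have dy0 : derive1 y t0 = derive1 s t0 *: (eps *: v).
  by rewrite (is_derive_derive1 (dy t0 D't0)) st0 wv.
rewrite -accE dy0 y0 => dd1.
pose p := derive1 s t0; pose q := derive1 (derive1 s) t0.
have dd2 : is_derive t0 1 (derive1 y)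
    (q *: (eps *: v) + p *: (eps *: (p *: - (eps *: acc g i x0 v)))).
  apply: (@is_derive_near_eq _ _ _ (fun t => derive1 s t *: (eps *: w (s t)))).
    by apply: filterS near' => t /dy /is_derive_derive1 ->.
  have [_ _ _ dw] := DH _ (Ds _ D't0).
  have /is_derive_mxP dw' := is_derive_comp1 dw (ds t0 D't0).
  apply/is_derive_mxP => a b.
  have -> : (fun t => (derive1 s t *: (eps *: w (s t))) a b) =
      (fun t => derive1 s t * (eps * w (s t) a b)).
    by apply/funext => t; rewrite !mxE.
  have Hd := is_derive_mul dds (is_derive_mul (is_derive_cst eps t0 1) (dw' a b)).
  by apply: is_derive_eq Hd _; rewrite mul0r add0r st0 xx0 wv !mxE.
have := is_derive_uniq dd1 dd2; rewrite !scalerA accZ => E.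
have p0 : p != 0 by exact: s0.
(* With [p = s'] and [q = s''], the equation reads [- (p eps)^2 acc' = q eps v - (p eps)^2 acc]. *)
exists (- (q * eps) / (p * eps * (p * eps))).
have pe : p * eps * (p * eps) != 0 by rewrite !mulf_neq0 // lt0r_neq0.
have -> : acc g' i x0 v = (p * eps * (p * eps))^-1 *: (p * eps * (p * eps) *: acc g' i x0 v).
  by rewrite scalerA mulVf // scale1r.
have {E} : p * eps * (p * eps) *: acc g' i x0 v = 
   - (q * eps *: v) + (p * eps * (p * eps)) *: acc g i x0 v.
  apply: oppr_inj; rewrite E opprD opprK; congr (_ + _).
  by rewrite scalerN scalerA; congr (- (_ *: _)); ring.
move=> ->.
by rewrite scalerDr scalerA mulVf // scale1r addrK scalerN scalerA -scaleNr; congr (_ *: _); ring.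
Qed.

End Geodesics.

Lemma mxZE (R : realType) m n (c : R) (A : 'M[R]_(m, n)) a b :
  (c *: A) a b = c * A a b.
Proof. by rewrite mxE. Qed.

Section ProjectiveAlgebra.
Context {R : realType}.
Local Notation e_ b := (@delta_mx R 4 1 b 0).

(* Polarise, and evaluate at [e_b] and [e_b +- e_c]. *)
Lemma quadratic_radial (D : 'I_4 -> 'M[R]_4) (psi : 'cV[R]_4) :
  (forall a b c, D b a c = D c a b) ->
  (forall v : 'cV[R]_4, v != 0 -> exists k : R, \sum_b v b 0 *: (D b *m v) = k *: v) ->
  (forall c, psi c 0 = D c c c / 2) ->
  forall c, D c = (psi c 0)%:M + e_ c *m psi^T.
Proof.
move=> Ds Dv psiE.
have De b (v : 'cV[R]_4) : \sum_k e_ b k 0 *: (D k *m v) = D b *m v.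
  rewrite (bigD1 b) //= big1 => [|k kb]; last by rewrite mxE (negbTE kb) scale0r.
  by rewrite mxE !eqxx scale1r addr0.
have e0 b : e_ b != 0.
  by apply/eqP => /matrixP/(_ b 0); rewrite !mxE !eqxx => /eqP; rewrite oner_eq0.
have diag c a : D c a c = (a == c)%:R * D c c c.
  have [k] := Dv _ (e0 c); rewrite De => /matrixP E.
  have := E c 0; have := E a 0; rewrite !mulmx_delta !mxZE !mxE !eqxx !andbT.
  by rewrite mulr1 => -> ->; rewrite mulrC.
have pol b c (s : R) : b != c -> exists k : R, forall a,
    D b a b + s * D b a c + (s * D c a b + s * s * D c a c) =
    k * ((a == b)%:R + s * (a == c)%:R).
  move=> bc; have : e_ b + s *: e_ c != 0.
    apply/eqP => /matrixP/(_ b 0); rewrite !mxE !eqxx (negbTE bc) mulr0 addr0.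
    by move/eqP; rewrite oner_eq0.
  move=> /Dv[k /matrixP E]; exists k => a; have := E a 0.
  rewrite mxZE mxDE mxZE [e_ b a 0]mxE [e_ c a 0]mxE !andbT => <-.
  under eq_bigr do rewrite mxDE scalerDl.
  rewrite big_split /= De.
  under eq_bigr do rewrite mxZE -scalerA.
  rewrite -scaler_sumr De !mulmxDr -!scalemxAr !mxDE !mxZE !mxDE !mxZE !mulmx_delta.
  ring.
move=> c; apply/matrixP => a b.
have rhs : ((psi c 0)%:M + e_ c *m psi^T) a b =
    psi c 0 * (a == b)%:R + (a == c)%:R * psi b 0.
  rewrite mxDE mxE mulr_natr; congr (_ + _).
  by rewrite mxME big_ord1 !mxE andbT.
rewrite rhs !psiE; have [->|cb] := eqVneq c b.
  by rewrite diag; case: eqP => _ /=; lra.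
(* At the coordinates [c] and [b] the two signs eliminate [k1] and [k2] and give
   [D c c b = D b b b / 2]; at any other coordinate the right-hand side is 0. *)
have [k1 E1] := pol c b 1 cb; have [k2 E2] := pol c b (-1) cb.
have bc : b != c by rewrite eq_sym.
have off d a' : a' != d -> D d a' d = 0.
  by move=> ad; rewrite diag (negbTE ad) mul0r.
have := E1 a; have := E2 a; have := E1 b; have := E2 b; have := E1 c; have := E2 c.
rewrite !eqxx (negbTE cb) (negbTE bc) !(Ds _ b c) (off c b bc) (off b c cb).
have [->|ac] := eqVneq a c.
  rewrite (negbTE cb) (off b c cb).
  by move: (D c c b) (D c b b) (D c c c) (D b b b) => p q r s /=; lra.
have [->|ab] := eqVneq a b.
  rewrite (off c b bc).
  by move: (D c c b) (D c b b) (D c c c) (D b b b) => p q r s /=; lra.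
rewrite (off b a ab) (off c a ac).
by move: (D c a b) (D c c b) (D c b b) (D c c c) (D b b b) => u p q r s /=; lra.
Qed.

End ProjectiveAlgebra.

(** * From projective relatedness to the Sinjukov equation *)

Section Sinjukov.
Context {R : realType} (M : manifold4 R) (g g' : lorentz_metric M).
Hypothesis pr : projectively_related g g'.
Local Notation pt := ('cV[R]_4).
Local Notation e_ b := (@delta_mx R 4 1 b 0).

(** In the tensor [delta^a_b psi_c + delta^a_c psi_b] the component with three equal indices [c] is
    [2 psi_c]. Reading the form off this way makes its smoothness immediate. *)
Definition psi (i : mindex M) (x : pt) : pt :=
  \col_c ((Gam g' i c x c c - Gam g i c x c c) / 2).

Lemma Gam_projective i x c : mrange i x ->
  Gam g' i c x = Gam g i c x + ((psi i x c 0)%:M + e_ c *m (psi i x)^T).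
Proof.
move=> ix; apply/eqP; rewrite addrC -subr_eq; apply/eqP.
apply: (@quadratic_radial R (fun c => Gam g' i c x - Gam g i c x)) => [a b d|v v0|d].
- by rewrite !mxBE (Gam_sym g a b d ix) (Gam_sym g' a b d ix).
- have [k E] := projective_acc pr ix v0; exists k; rewrite -E /acc -sumrB.
  by apply: eq_bigr => b _; rewrite mulmxBl scalerBr.
- by rewrite mxE mxBE.
Qed.

(** The 5 is dimension plus one: the trace of the difference of the connections is [(4 + 1) psi_c],
    and the logarithmic derivative of a metric determinant is twice the trace of its connection, so
    [ln rho] has derivative [2 psi]. *)
Definition rho (i : mindex M) (x : pt) : R :=
  expR (ln (\det (g' i x) / \det (g i x)) / 5).

Lemma is_derive_det_metric (h : lorentz_metric M) i x c : mrange i x ->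
  is_derive x (e_ c) (fun y => \det (h i y)) (2 * \det (h i x) * \tr (Gam h i c x)).
Proof.
move=> ix; have H := is_derive_det (Ckmx_derive c (metric_Ck h i 1) ix).
apply: is_derive_eq H _.
have uh := metric_unit h ix.
have -> : \adj (h i x) = \det (h i x) *: invmx (h i x).
  by rewrite /invmx uh scalerA divff ?scale1r // -unitfE -unitmxE.
rewrite metric_compat // -scalemxAl mxtraceZ mulmxDr mulKmx // mxtraceD.
rewrite mulmxA mxtrace_mulC mulmxA mulmxV // mul1mx mxtrace_tr; ring.
Qed.

Lemma det_ratio_gt0 i x : mrange i x -> 0 < \det (g' i x) / \det (g i x).
Proof. by move=> ix; rewrite nmulr_rgt0 ?invr_lt0 ?metric_det. Qed.

Lemma rho_gt0 i x : 0 < rho i x.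
Proof. exact: expR_gt0. Qed.

Lemma rho_Ck i k : Ck k (mrange i) (rho i).
Proof.
have oi := @mrange_open' _ M i.
apply: Ck_exp => //; apply: CkM => //; last exact: Ck_cst.
apply: Ck_ln => //; first exact: det_ratio_gt0.
apply: CkM => //; first by apply: Ck_det => //; exact: metric_Ck.
apply: CkV => // [x ix|]; first by rewrite lt_eqF // metric_det.
by apply: Ck_det => //; exact: metric_Ck.
Qed.

Lemma rho_derive i x c : mrange i x ->
  is_derive x (e_ c) (rho i) (2 * psi i x c 0 * rho i x).
Proof.
move=> ix; have d0 : \det (g i x) != 0 by rewrite lt_eqF // metric_det.
have d0' : \det (g' i x) != 0 by rewrite lt_eqF // metric_det.
have H1 := is_derive_det_metric g' c ix; have H2 := is_derive_det_metric g c ix.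
have H3 : is_derive x (e_ c) (fun y => (\det (g i y))^-1)
    (- (2 * \tr (Gam g i c x) / \det (g i x))).
  have [d dE] := H2; split; first exact: derivableV.
  by rewrite deriveV // dE /GRing.scale /=; field.
have H4 := is_derive_mul H1 H3.
have H5 := @is_derive_compR _ _ _ _ (fun y => \det (g' i y) / \det (g i y)) _ _ _ _
  (is_derive1_ln (det_ratio_gt0 ix)) H4.
have H6 := @is_derive_compR _ _ _ expR
  (fun y => ln (\det (g' i y) / \det (g i y)) * cst (5^-1 : R) y) _ _ _ _
  (is_derive_expR _) (is_derive_mul H5 (is_derive_cst (5^-1 : R) x (e_ c))).
apply: is_derive_eq H6 _.
have trE : \tr (Gam g' i c x) = \tr (Gam g i c x) + 5 * psi i x c 0.
  rewrite Gam_projective // mxtraceD mxtraceD mxtrace_scalar mxtrace_mulC; congr (_ + _).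
  have -> : \tr ((psi i x)^T *m e_ c) = psi i x c 0.
    by rewrite /mxtrace big_ord1 mulmx_delta mxE.
  by rewrite -mulr_natl; ring.
rewrite trE /GRing.scale /= /cst -/(rho i x); field.
by rewrite d0 d0'.
Qed.

Definition sigma (i : mindex M) (x : pt) : 'M[R]_4 := rho i x *: invmx (g' i x).

Definition Lam (i : mindex M) (x : pt) : pt := - (sigma i x *m psi i x).

Lemma psi_Ck i k : Ckmx (mrange i) k (psi i).
Proof.
have oi := @mrange_open' _ M i; move=> a b.
apply: (@Ck_ext _ k _ (fun x => (Gam g' i a x a a - Gam g i a x a a) / 2)) => //.
  by move=> x _; rewrite mxE.
by apply: CkM => //; [apply: CkB => //; exact: Gam_Ck|exact: Ck_cst].
Qed.

Lemma sigma_Ck i k : Ckmx (mrange i) k (sigma i).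
Proof.
have oi := @mrange_open' _ M i; move=> a b.
apply: (@Ck_ext _ k _ (fun x => rho i x * invmx (g' i x) a b)) => //.
  by move=> x _; rewrite mxE.
apply: CkM => //; first exact: rho_Ck.
by apply: Ckmx_inv => // [x ix|]; [exact: metric_unit|exact: metric_Ck].
Qed.

Lemma Lam_Ck i k : Ckmx (mrange i) k (Lam i).
Proof.
have oi := @mrange_open' _ M i; move=> a b.
apply: (@Ck_ext _ k _ (fun x => - (sigma i x *m psi i x) a b)) => //.
  by move=> x _; rewrite [in RHS]mxE.
by apply: CkN => //; apply: CkmxM => //; [exact: sigma_Ck|exact: psi_Ck].
Qed.

Lemma sigma_sym i x : mrange i x -> (sigma i x)^T = sigma i x.
Proof.
by move=> ix; rewrite /sigma linearZ /= trmx_inv (gcomp_sym g' ix).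
Qed.

(** The inverse of [g'] is parallel for the connection of [g']. Passing to [Gam g] produces a term
    [- 2 psi_c sigma], which the weight [rho] is made to cancel, and two terms of rank one, which
    are those with [Lam]. *)
Lemma sigma_derive i x c : mrange i x -> dmx c (sigma i) x =
  - (Gam g i c x *m sigma i x) - sigma i x *m (Gam g i c x)^T
  + e_ c *m (Lam i x)^T + Lam i x *m (e_ c)^T.
Proof.
move=> ix; have oi := @mrange_open' _ M i.
have u' := metric_unit g' ix.
have CI : Ckmx (mrange i) 1 (fun x => invmx (g' i x)).
  by apply: Ckmx_inv => // [y iy|]; [exact: metric_unit|exact: metric_Ck].
have dI := Ckmx_derive c CI ix.
have IE : dmx c (fun x => invmx (g' i x)) x =
    - (Gam g' i c x *m invmx (g' i x)) - invmx (g' i x) *m (Gam g' i c x)^T.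
  have H := is_derive_mulmx (Ckmx_derive c (metric_Ck g' i 1) ix) dI.
  have E : \near x, g' i x *m invmx (g' i x) = 1%:M.
    by apply: (near_open oi ix) => y iy; rewrite mulmxV // metric_unit.
  have {H} := is_derive_uniq (is_derive_near_eq E H) (is_derive_cst _ _ _).
  rewrite metric_compat // addrC => /(canRL (addrK _)); rewrite sub0r => H.
  rewrite -[LHS](mulKmx u') H mulmxN mulmxDl mulmxDr !mulmxA mulVmx // mul1mx.
  by rewrite -!mulmxA mulmxV // mulmx1 opprD.
have dr : is_derive x (e_ c) (sigma i)
    ((2 * psi i x c 0 * rho i x) *: invmx (g' i x)
     + rho i x *: dmx c (fun x => invmx (g' i x)) x).
  apply/is_derive_mxP => a b.
  have /is_derive_mxP dI' := dI.
  have := is_derive_mul (rho_derive c ix) (dI' a b).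
  rewrite mxDE !mxZE; congr is_derive.
  by apply/funext => y; rewrite mxZE.
rewrite (is_derive_uniq (Ckmx_derive c (@sigma_Ck i 1) ix) dr) IE Gam_projective //.
rewrite scalerBr scalerN.
rewrite [rho i x *: (_ *m invmx _)]scalemxAr [rho i x *: (invmx _ *m _)]scalemxAl.
rewrite -scalerA -/(sigma i x).
have -> : Lam i x *m (e_ c)^T = - (sigma i x *m (e_ c *m (psi i x)^T)^T).
  by rewrite trmx_mul trmxK mulmxA mulNmx.
have -> : e_ c *m (Lam i x)^T = - (e_ c *m (psi i x)^T *m sigma i x).
  by rewrite /Lam linearN /= trmx_mul sigma_sym // mulmxN mulmxA.
rewrite !mulmxDl !(linearD, mulmxDr) /= tr_scalar_mx mul_scalar_mx mul_mx_scalar.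
move: (Gam g i c x *m sigma i x) (sigma i x *m (Gam g i c x)^T) => P Q.
move: (e_ c *m (psi i x)^T *m sigma i x) (sigma i x *m (e_ c *m (psi i x)^T)^T) => S T.
move: (sigma i x) (psi i x c 0) => U p.
by apply/matrixP => a b; rewrite !(mxDE, mxNE, mxZE); ring.
Qed.

(** Each determinant acquires the square of the Jacobian determinant, and the ratio is a scalar. *)
Lemma rho_trans i j x : overlap i j x -> rho i x = rho j (trans i j x).
Proof.
move=> ijx; rewrite /rho (metric_trans g ijx) (metric_trans g' ijx).
rewrite !det_mulmx det_tr; congr (expR (ln _ / 5)).
have J0 : \det (jac i j x) != 0 by rewrite -unitfE -unitmxE jac_unit.
have d0 : \det (g j (trans i j x)) != 0.
  by rewrite lt_eqF // metric_det //; exact: trans_range.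
by field; rewrite J0 d0.
Qed.

(** Comparing gradients of the scalar [rho] yields the transformation rule without touching the
    inhomogeneous one of the Christoffel symbols. *)
Lemma psi_trans i j x : overlap i j x ->
  psi i x = (jac i j x)^T *m psi j (trans i j x).
Proof.
move=> ijx; have [ix _] := (overlapP _ _ _).1 ijx.
apply/matrixP => c k; rewrite (ord1 k) {k}.
have dt : is_derive x (e_ c) (trans i j) (jac i j x *m e_ c).
  exact: (@trans_chain _ M pt i j id x (e_ c) (e_ c) ijx (is_derive_id _ _)).
have H := C1_chain (@mrange_open' _ M j) (@rho_Ck j 1) (trans_range ijx) dt.
have E : \near x, rho j (trans i j x) = rho i x.
  by apply: (near_open (@overlap_open _ M i j) ijx) => y ijy; rewrite -rho_trans.
have := is_derive_uniq (is_derive_near_eq E H) (rho_derive c ix).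
have r0 : 2 * rho i x != 0 by rewrite mulf_neq0 // lt0r_neq0 // rho_gt0.
move=> H2; apply: (mulIf r0); rewrite [LHS]mulrA [_ * 2]mulrC -H2.
rewrite mxME mulr_suml; apply: eq_bigr => a _; rewrite mulmx_delta.
have -> : partial a (rho j) (trans i j x) =
    2 * psi j (trans i j x) a 0 * rho j (trans i j x).
  by have [_] := rho_derive a (trans_range ijx).
by rewrite -rho_trans // [_^T _ _]mxE; ring.
Qed.

Lemma Lam_trans i j x : overlap i j x ->
  Lam j (trans i j x) = jac i j x *m Lam i x.
Proof.
move=> ijx; have uJ := jac_unit ijx; have jt := trans_range ijx.
rewrite /Lam /sigma (psi_trans ijx) (rho_trans ijx) (metric_trans g' ijx).
have ug := metric_unit g' jt.
have uJT : (jac i j x)^T \in unitmx by rewrite unitmx_tr.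
rewrite mulmxN; congr (- _); rewrite -!scalemxAl -scalemxAr; congr (_ *: _).
symmetry; apply: (canRL (mulKmx ug)); apply: (can_inj (mulKmx uJT)).
by rewrite !mulmxA mulmxV ?mul1mx // !unitmx_mul uJT ug.
Qed.

End Sinjukov.

(** * Ricci identities *)

Section Ricci.
Context {R : realType}.
Local Notation pt := ('cV[R]_4).
Local Notation e_ b := (@delta_mx R 4 1 b 0).

Lemma dmx_schwarz m n (W : set pt) (A : pt -> 'M[R]_(m, n)) c d x :
  open W -> Ckmx W 2 A -> W x -> dmx c (dmx d A) x = dmx d (dmx c A) x.
Proof.
move=> oW CA Wx; apply/matrixP => a b; rewrite !dmxE.
have E e : (fun y => dmx e A y a b) = partial e (fun y => A y a b).
  by apply/funext => y; rewrite dmxE.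
by rewrite !E; exact: schwarz oW (CA a b) Wx.
Qed.

Lemma dmx_is_derive m n (W : set pt) (A B : pt -> 'M[R]_(m, n)) c x D :
  open W -> Ckmx W 1 A -> W x -> (forall y, W y -> A y = B y) ->
  is_derive x (e_ c) B D -> dmx c A x = D.
Proof.
move=> oW CA Wx AB dB; apply: is_derive_uniq (Ckmx_derive c CA Wx) _.
apply: is_derive_near_eq dB; apply: (near_open oW Wx) => y Wy; exact/esym/AB.
Qed.

Lemma tr_addmx m n (A B : 'M[R]_(m, n)) : (A + B)^T = A^T + B^T.
Proof. exact: linearD. Qed.

Lemma tr_oppmx m n (A : 'M[R]_(m, n)) : (- A)^T = - A^T.
Proof. exact: linearN. Qed.

Lemma tr_scalemx m n (c : R) (A : 'M[R]_(m, n)) : (c *: A)^T = c *: A^T.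
Proof. exact: linearZ. Qed.

(** The hypotheses are the Sinjukov equation in two directions, equality of the mixed second
    derivatives of [sigma], and symmetry of the connection on coordinate vectors. Over abstract
    matrices the cancellation becomes linear arithmetic in the entries. *)
Lemma ricci_sym_algebra (Gc Gd Kc Kd s Sc Sd : 'M[R]_4) (l nc nd ec ed : pt) :
  Sc = - (Gc *m s) - s *m Gc^T + ec *m l^T + l *m ec^T ->
  Sd = - (Gd *m s) - s *m Gd^T + ed *m l^T + l *m ed^T ->
  - (Kc *m s + Gc *m Sd) - (Sd *m Gc^T + s *m Kc^T) + ec *m nd^T + nd *m ec^T =
  - (Kd *m s + Gd *m Sc) - (Sc *m Gd^T + s *m Kd^T) + ed *m nc^T + nc *m ed^T ->
  Gc *m ed = Gd *m ec ->
  (Kc - Kd + (Gd *m Gc - Gc *m Gd)) *m s + s *m (Kc - Kd + (Gd *m Gc - Gc *m Gd))^T =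
  ec *m (nd + Gd *m l)^T + (nd + Gd *m l) *m ec^T
  - ed *m (nc + Gc *m l)^T - (nc + Gc *m l) *m ed^T.
Proof.
move=> -> -> + Gs.
have Gs' : ed^T *m Gc^T = ec^T *m Gd^T by rewrite -!trmx_mul Gs.
rewrite !(tr_addmx, tr_oppmx, trmx_mul) !(mulmxDl, mulmxDr, mulmxN, mulNmx) !mulmxA Gs.
rewrite -(mulmxA l ed^T) -(mulmxA l ec^T) Gs' !mulmxA.
move=> /matrixP E; apply/matrixP => a b; have := E a b.
rewrite !(mxDE, mxNE).
lra.
Qed.

Variables (M : manifold4 R) (g g' : lorentz_metric M).
Hypothesis pr : projectively_related g g'.
Variable i : mindex M.
Local Notation W := (mrange i).
Local Notation sigma_ := (sigma g g' i).
Local Notation Lam_ := (Lam g g' i).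
Local Notation Gam_ := (Gam g i).
Local Notation Riem_ := (Riem g i).

Definition nabLam (x : pt) : 'M[R]_4 :=
  \matrix_(a, c) (dmx c Lam_ x + Gam_ c x *m Lam_ x) a 0.

Lemma nabLam_delta x c : nabLam x *m e_ c = dmx c Lam_ x + Gam_ c x *m Lam_ x.
Proof.
by apply/matrixP => a k; rewrite (ord1 k) mulmx_delta [LHS]mxE.
Qed.

Lemma Gam_delta_sym x c d : W x -> Gam_ c x *m e_ d = Gam_ d x *m e_ c.
Proof.
by move=> Wx; apply/matrixP => a k; rewrite (ord1 k) !mulmx_delta (Gam_sym g a c d Wx).
Qed.

Lemma ricci_sigma x c d : W x ->
  Riem_ d c x *m sigma_ x + sigma_ x *m (Riem_ d c x)^T =
  e_ c *m (nabLam x *m e_ d)^T + (nabLam x *m e_ d) *m (e_ c)^T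
  - e_ d *m (nabLam x *m e_ c)^T - (nabLam x *m e_ c) *m (e_ d)^T.
Proof.
move=> Wx; have oW := @mrange_open' _ M i; rewrite !nabLam_delta RiemE.
have S a := sigma_derive pr a Wx.
apply: (ricci_sym_algebra (S c) (S d)); last exact: Gam_delta_sym.
have D a b : dmx b (dmx a sigma_) x =
    - (dmx b (Gam_ a) x *m sigma_ x + Gam_ a x *m dmx b sigma_ x)
    - (dmx b sigma_ x *m (Gam_ a x)^T + sigma_ x *m (dmx b (Gam_ a) x)^T)
    + e_ a *m (dmx b Lam_ x)^T + dmx b Lam_ x *m (e_ a)^T.
  apply: dmx_is_derive (fun y Wy => sigma_derive pr a Wy) _ => //.
    by apply: Ckmx_dmx => //; exact: sigma_Ck.
  have ds := Ckmx_derive b (@sigma_Ck _ M g g' i 1) Wx.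
  have dL := Ckmx_derive b (@Lam_Ck _ M g g' i 1) Wx.
  have dG := Ckmx_derive b (@Gam_Ck _ M g i 1 a) Wx.
  apply: is_deriveD; first apply: is_deriveD.
  - apply: is_deriveB; last exact: is_derive_mulmx ds (is_derive_trmx dG).
    by apply: is_deriveN; exact: is_derive_mulmx.
  - have := is_derive_mulmx (is_derive_cst (e_ a) x (e_ b)) (is_derive_trmx dL).
    by rewrite mul0mx add0r.
  - have := is_derive_mulmx dL (is_derive_cst (e_ a)^T x (e_ b)).
    by rewrite mulmx0 addr0.
by rewrite -!D; apply: dmx_schwarz Wx => //; exact: sigma_Ck.
Qed.

Definition Rcontr (x : pt) (B : 'M[R]_4) : 'M[R]_4 :=
  \sum_c \sum_d B c d *: Riem_ c d x.

Lemma skew_sum (B : 'M[R]_4) : B^T = - B ->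
  \sum_c \sum_d B c d *: (e_ c *m (e_ d)^T - e_ d *m (e_ c)^T) = B *+ 2.
Proof.
move=> Bs; have BE : \sum_c \sum_d B c d *: (e_ c *m (e_ d)^T) = B.
  rewrite [RHS]matrix_sum_delta; apply: eq_bigr => c _; apply: eq_bigr => d _.
  by rewrite trmx_delta mul_delta_mx.
under eq_bigr do under eq_bigr do rewrite scalerBr.
under eq_bigr do rewrite sumrB.
rewrite sumrB BE mulr2n; congr (_ + _).
rewrite -[RHS]opprK -Bs; congr (- _).
rewrite exchange_big /= [RHS]matrix_sum_delta; apply: eq_bigr => d _.
by apply: eq_bigr => c _; rewrite mxE trmx_delta mul_delta_mx.
Qed.

(** Contracting [ricci_sigma] with [B] removes the curvature, and by skewness of [B] the other side
    is twice the sum of [nabLam x *m B] and its transpose. *)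
Lemma ricci_kernel x B : W x -> B^T = - B -> Rcontr x B = 0 ->
  (nabLam x *m B)^T = - (nabLam x *m B).
Proof.
move=> Wx Bs RB.
have : Rcontr x B *m sigma_ x + sigma_ x *m (Rcontr x B)^T =
    nabLam x *m (B *+ 2) + (nabLam x *m (B *+ 2))^T.
  rewrite -(skew_sum Bs) /Rcontr !linear_sum /= mulmx_suml -!big_split /=.
  apply: eq_bigr => c _; rewrite !linear_sum /= mulmx_suml -!big_split /=.
  apply: eq_bigr => d _.
  have := ricci_sigma d c Wx; move: (sigma_ x) => s RS.
  rewrite tr_scalemx -scalemxAl -!scalemxAr tr_scalemx -!scalerDr; congr (_ *: _).
  rewrite RS mulmxBr tr_addmx tr_oppmx !trmx_mul !trmxK !mulmxA.
  move: (nabLam x *m _ *m _) (nabLam x *m _ *m _) => P Q.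
  move: (_ *m _^T) (_ *m _^T) => P' Q'.
  by apply/matrixP => a b; rewrite !(mxDE, mxNE); ring.
rewrite RB mul0mx trmx0 mulmx0 addr0.
rewrite (_ : B *+ 2 = 2 *: B); last by rewrite scaler_nat.
rewrite -!scalemxAr tr_scalemx -scalerDr => /esym/eqP.
rewrite scaler_eq0 pnatr_eq0 /= addrC addr_eq0 => /eqP //.
Qed.

Lemma ricci_Lam (k : pt -> R) x c d : Ck 1 W k ->
  (forall y, W y -> nabLam y = (k y)%:M) -> W x ->
  Riem_ c d x *m Lam_ x = partial c k x *: e_ d - partial d k x *: e_ c.
Proof.
move=> Ckk Lk Wx; have oW := @mrange_open' _ M i.
have dLam a y : W y -> dmx a Lam_ y = k y *: e_ a - Gam_ a y *m Lam_ y.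
  move=> Wy; have := nabLam_delta y a; rewrite Lk // mul_scalar_mx => ->.
  by rewrite addrK.
have D a b : dmx b (dmx a Lam_) x = partial b k x *: e_ a
    - (dmx b (Gam_ a) x *m Lam_ x + Gam_ a x *m dmx b Lam_ x).
  apply: dmx_is_derive (dLam a) _ => //.
    by apply: Ckmx_dmx => //; exact: Lam_Ck.
  have dL := Ckmx_derive b (@Lam_Ck _ M g g' i 1) Wx.
  have dG := Ckmx_derive b (@Gam_Ck _ M g i 1 a) Wx.
  apply: is_deriveB; last exact: is_derive_mulmx.
  have dk := Ck_derive b Ckk Wx.
  apply/is_derive_mxP => p q.
  have := is_derive_mul dk (is_derive_cst (e_ a p q) x (e_ b)).
  rewrite mulr0 addr0 mxZE; congr is_derive.
  by apply/funext => y; rewrite mxZE.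
have := dmx_schwarz c d oW (@Lam_Ck _ M g g' i 2) Wx.
rewrite !D !dLam // RiemE !mulmxBr -!scalemxAr (Gam_delta_sym c d Wx) !mulmxA.
rewrite mulmxDl !mulmxBl.
move: (partial c k x *: _) (partial d k x *: _) (k x *: _) => P Q S.
move: (dmx c _ x *m _) (dmx d _ x *m _) (_ *m _ *m _) (_ *m _ *m _) => A B C E.
move=> /matrixP H; apply/matrixP => a b; have := H a b.
rewrite !(mxDE, mxNE); lra.
Qed.

(** Contracting [ricci_Lam] with [B] leaves only the gradient of [k] on the right, doubled by the
    skewness of [B]. *)
Lemma ricci_Lam_kernel (k : pt -> R) x B : Ck 1 W k ->
  (forall y, W y -> nabLam y = (k y)%:M) -> W x -> B^T = - B -> Rcontr x B = 0 ->
  B *m (\col_c partial c k x) = 0.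
Proof.
move=> Ckk Lk Wx Bs RB; set dk := (\col_c _).
have : Rcontr x B *m Lam_ x = - (B *+ 2 *m dk).
  rewrite -(skew_sum Bs) /Rcontr !mulmx_suml -sumrN; apply: eq_bigr => c _.
  rewrite !mulmx_suml -sumrN; apply: eq_bigr => d _.
  rewrite -!scalemxAl (ricci_Lam c d Ckk Lk Wx) -[RHS]scalerN; congr (_ *: _).
  have E a b : e_ a *m (e_ b)^T *m dk = partial b k x *: e_ a.
    rewrite trmx_delta -mulmxA -rowE.
    have -> : row b dk = (partial b k x)%:M.
      by apply/matrixP => p q; rewrite !mxE (ord1 p) (ord1 q) eqxx mulr1n.
    by rewrite mul_mx_scalar.
  by rewrite mulmxBl !E opprB.
rewrite RB mul0mx => /esym/eqP; rewrite oppr_eq0.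
rewrite (_ : B *+ 2 = 2 *: B); last by rewrite scaler_nat.
by rewrite -scalemxAl scaler_eq0 pnatr_eq0 /= => /eqP.
Qed.

End Ricci.

(** * Parallel transport *)

Section LinearODE.
Context {R : realType}.

Lemma continuous_mulmx (T : topologicalType) m n p (A : T -> 'M[R]_(m, n))
    (B : T -> 'M[R]_(n, p)) x :
  {for x, continuous A} -> {for x, continuous B} ->
  {for x, continuous (fun y => A y *m B y)}.
Proof.
move=> cA cB; apply: continuous_mx => i j.
rewrite (_ : (fun _ => _) = (fun y => \sum_k A y i k * B y k j)); last first.
  by apply/funext => y; rewrite mxE.
rewrite /continuous_at /prop_for; apply: cvg_big => [|k _]; first exact: add_continuous.
exact: (continuousM (continuous_entry (i := i) (j := k) cA)
  (continuous_entry (i := k) (j := j) cB)).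
Qed.

Lemma linear_ode n p (A : R -> 'M[R]_n) (B : R -> 'M[R]_(n, p)) E0 (T a b : R) :
  0 <= T -> n%:R * a * T <= 4^-1 -> 0 <= a -> 0 <= b ->
  (forall t : R, `|t| <= T -> {for t, continuous A} /\ {for t, continuous B}) ->
  (forall t, `|t| <= T -> `|A t| <= a /\ `|B t| <= b) ->
  exists E : R -> 'M[R]_(n, p), E 0 = E0 /\
    forall t : R, `|t| <= T -> is_derive t 1 E (A t *m E t + B t).
Proof.
move=> T0 na a0 b0 cAB lAB.
(* The Lipschitz constant of a linear equation does not depend on the radius, so [r] may be taken
   large enough to absorb [E0] and the inhomogeneous term on the given interval. *)
pose r := 1 + `|E0| + 4 * b * T.
have bT : 0 <= b * T by rewrite mulr_ge0.
have r0 : 0 <= r by rewrite !addr_ge0 // -mulrA mulr_ge0.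
have na0 : 0 <= n%:R * a by rewrite mulr_ge0.
have mm t (y : 'M[R]_(n, p)) : `|t| <= T -> `|A t *m y| <= n%:R * a * `|y|.
  move=> /lAB[lA _]; apply: le_trans (mulmx_norm_le _ _) _.
  by rewrite ler_wpM2r // ler_wpM2l.
have [||||||||| y [y0 _ yd]] := @picard R _ _ (fun t y => A t *m y + B t) E0 T r
    (n%:R * a) (n%:R * a * (`|E0| + r) + b).
- exact: T0.
- exact: r0.
- by rewrite addr_ge0 // mulr_ge0 // addr_ge0.
- exact: na0.
- rewrite mulrDl mulrAC.
  have : n%:R * a * T * (`|E0| + r) <= 4^-1 * (`|E0| + r).
    by rewrite ler_wpM2r // addr_ge0.
  have := normr_ge0 E0; rewrite /r; lra.
- by apply: le_trans na _; lra.
- move=> t y /cAB[cA cB] _; apply: continuous_mx => i j.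
  have cAy : {for t, continuous (fun t => A t *m y)}.
    by apply: continuous_mulmx cA _; exact: cst_continuous.
  have -> : (fun u => (A u *m y + B u) i j) = (fun u => (A u *m y) i j + B u i j).
    by apply/funext => u; rewrite mxDE.
  exact: (continuousD (continuous_entry (i := i) (j := j) cAy)
    (continuous_entry (i := i) (j := j) cB)).
- move=> t y tT yr; apply: le_trans (ler_normD _ _) _; rewrite lerD //; last first.
    by have [] := lAB t tT.
  apply: le_trans (mm _ _ tT) _; rewrite ler_wpM2l //.
  by rewrite -[y](subrK E0) (le_trans (ler_normD _ _)) // addrC lerD2l.
- move=> t y z tT _ _; rewrite opprD addrACA subrr addr0 -mulmxBr; exact: mm.
by exists y.
Qed.

End LinearODE.

Section Transport.
Context {R : realType} (M : manifold4 R) (g : lorentz_metric M).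
Local Notation pt := ('cV[R]_4).
Local Notation e_ b := (@delta_mx R 4 1 b 0).
Implicit Types i j : mindex M.

Definition GamV i (v x : pt) : 'M[R]_4 := \sum_b v b 0 *: Gam g i b x.

Lemma GamVE i (v x : pt) :
  \matrix_(a, d) (\sum_(b < 4) christoffel g i x a b d * v b 0) = GamV i v x.
Proof.
apply/matrixP => a d; rewrite mxE summxE; apply: eq_bigr => b _.
by rewrite mxZE GamEntry mulrC.
Qed.

Lemma GamVZ i (c : R) (v x : pt) : GamV i (c *: v) x = c *: GamV i v x.
Proof.
by rewrite /GamV scaler_sumr; apply: eq_bigr => b _; rewrite mxZE scalerA.
Qed.

Lemma Ckmx_chain (V : normedModType R) m n (W : set pt) (A : pt -> 'M[R]_(m, n))
    (y : V -> pt) (t v : V) y' :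
  open W -> Ckmx W 1 A -> W (y t) -> is_derive t v y y' ->
  is_derive t v (fun u => A (y u)) (\sum_b y' b 0 *: dmx b A (y t)).
Proof.
move=> oW CA Wy dy; apply/is_derive_mxP => a b; rewrite summxE.
have := C1_chain oW (CA a b) Wy dy; congr is_derive.
by apply: eq_bigr => k _; rewrite mxZE dmxE mulrC.
Qed.

Lemma metric_compatV i (v x : pt) : mrange i x ->
  \sum_b v b 0 *: dmx b (g i) x = g i x *m GamV i v x + (GamV i v x)^T *m g i x.
Proof.
move=> ix; rewrite /GamV mulmx_sumr linear_sum /= mulmx_suml -big_split /=.
apply: eq_bigr => b _.
by rewrite metric_compat // scalerDr -scalemxAr tr_scalemx -scalemxAl.
Qed.

Lemma frame_isometry i (x : R -> pt) (E : R -> 'M[R]_4) (t : R) x' :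
  mrange i (x t) -> is_derive t 1 x x' ->
  is_derive t 1 E (- (GamV i x' (x t) *m E t)) ->
  is_derive t 1 (fun s => (E s)^T *m g i (x s) *m E s) 0.
Proof.
move=> ix dx dE.
have dg := Ckmx_chain (@mrange_open' _ M i) (metric_Ck g i 1) ix dx.
have H := is_derive_mulmx (is_derive_mulmx (is_derive_trmx dE) dg) dE.
apply: is_derive_eq H _; rewrite (metric_compatV _ ix) tr_oppmx trmx_mul.
rewrite !(mulmxDl, mulmxDr, mulmxN, mulNmx) !mulmxA.
move: (_ *m _ *m _ *m _) (_ *m _ *m _ *m _) => P Q.
by apply/matrixP => a b; rewrite !(mxDE, mxNE) mxE; ring.
Qed.

(** Besides carrying tetrads to tetrads, this gives the invertibility of every transport matrix and
    recovers that both end points lie in their chart domains. *)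
Lemma transport_isometry i p j q T : transport g i p j q T ->
  [/\ mdom M i p, mdom M j q &
      T^T *m g j (mto M j q) *m T = g i (mto M i p)].
Proof.
elim=> {i p j q T} [i x E sx rx [E0 dE]|i j p ip jp|i j k p q r S T _ [ip _ HS] _ [_ kr HT]].
- have r0 : mrange i (x 0) by apply: rx; rewrite lexx ler01.
  have r1 : mrange i (x 1) by apply: rx; rewrite lexx ler01.
  split; [exact: mrange_dom|exact: mrange_dom|rewrite !mfromK //].
  have H : forall t : R, 0 <= t <= 1 ->
      is_derive t 1 (fun s => (E s)^T *m g i (x s) *m E s) 0.
    move=> t t01; apply: (frame_isometry (x' := derive1 x t)) (rx t t01) _ _.
      by have := sx 0%N t I; rewrite derive1n0 => d; split; rewrite ?derive1E.
    by have := dE t t01; rewrite GamVE.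
  have := derive0_cst_mx H (t := 1); rewrite lexx ler01 => /(_ isT) ->.
  by rewrite E0 trmx1 mul1mx mulmx1.
- by split => //; rewrite -(gcomp_tensor g ip jp).
- by split => //; rewrite trmx_mul -!mulmxA (mulmxA T^T) (mulmxA (_ *m _) T) HT mulmxA HS.
Qed.

Lemma transport_unit i p j q T : transport g i p j q T -> T \in unitmx.
Proof.
move=> /transport_isometry[ip jq E].
have := metric_unit g (mrange_to ip); rewrite -E !unitmx_mul unitmx_tr.
by case/andP.
Qed.

Lemma is_derive_affine (W : normedModType R) (f : R -> W) (a b t : R) d :
  is_derive (b + t * a) 1 f d -> is_derive t 1 (fun u => f (b + u * a)) (a *: d).
Proof.
move=> df; apply: (@is_derive_comp1 _ _ f (fun u : R => b + u * a)) => //.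
exact: (@is_derive_line _ R R id b a t a).
Qed.

Lemma smooth_affine (x : R -> pt) (a b : R) : smooth_curve_on setT x ->
  smooth_curve_on setT (fun t => x (b + t * a)).
Proof.
move=> sx.
have E k : derive1n k (fun t => x (b + t * a)) =
    (fun t => a ^+ k *: derive1n k x (b + t * a)).
  elim: k => [|k IH]; first by apply/funext => t; rewrite !derive1n0 expr0 scale1r.
  apply/funext => t; rewrite derive1nS IH.
  have d := sx k (b + t * a) I.
  have H := is_derive_affine (derivableP d).
  have H' := is_deriveZ (a ^+ k) H.
  by rewrite (is_derive_derive1 H') scalerA -exprSr derive1nS derive1E.
move=> k t _; rewrite E.
have d := sx k (b + t * a) I.
have H := is_derive_affine (derivableP d).
by case: (is_deriveZ (a ^+ k) H).
Qed.

Lemma transport_inv i p j q T : transport g i p j q T ->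
  transport g j q i p (invmx T).
Proof.
elim=> {i p j q T} [i x E sx rx [E0 dE]|i j p ip jp|i j k p q r S T HS IS HT IT].
(* The reversed arc; its frame is the old one renormalised to be the identity at the new starting
   point. *)
- pose y t := x (1 + t * -1); pose F t := E (1 + t * -1) *m invmx (E 1).
  have arc : transport g i (mfrom M i (x 0)) i (mfrom M i (x 1)) (E 1).
    exact: transport_arc.
  have uE := transport_unit arc.
  have y1 : y 1 = x 0 by rewrite /y mul1r subrr.
  have y0 : y 0 = x 1 by rewrite /y mul0r addr0.
  have F1 : F 1 = invmx (E 1) by rewrite /F mul1r subrr E0 mul1mx.
  rewrite -y0 -y1 -F1; apply: transport_arc.
  + exact: smooth_affine.
  + by move=> t /andP[t0 t1]; apply: rx; apply/andP; split; lra.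
  + split; first by rewrite /F mul0r addr0 mulmxV.
    move=> t /andP[t0 t1].
    have t01 : 0 <= 1 + t * -1 <= 1 by apply/andP; split; lra.
    have dx : is_derive (1 + t * -1) 1 x (derive1 x (1 + t * -1)).
      by have := sx 0%N (1 + t * -1) I; rewrite derive1n0 => d; split; rewrite ?derive1E.
    rewrite (is_derive_derive1 (is_derive_affine dx)) GamVE.
    have H := is_derive_affine (dE _ t01).
    have H' := is_derive_mulmx H (is_derive_cst (invmx (E 1)) t 1).
    apply: is_derive_eq H' _.
    by rewrite mulmx0 addr0 GamVE GamVZ !scaleN1r opprK mulNmx opprK /F mulmxA.
- have ijx : overlap i j (mto M i p) by exists p.
  have tE : trans i j (mto M i p) = mto M j p by rewrite /trans /= mtoK.
  have -> : invmx (jac i j (mto M i p)) = jac j i (mto M j p).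
    have := jacK ijx; rewrite tE => JJ.
    by rewrite -[LHS]mul1mx -JJ -mulmxA mulmxV ?mulmx1 // jac_unit.
  exact: transport_chart.
- have uS := transport_unit HS; have uT := transport_unit HT.
  have -> : invmx (T *m S) = invmx S *m invmx T.
    have uTS : T *m S \in unitmx by rewrite unitmx_mul uT.
    apply: (can_inj (mulKmx uTS)).
    by rewrite mulmxV // mulmxA -(mulmxA T) mulmxV // mulmx1 mulmxV.
  exact: transport_comp IT IS.
Qed.

Lemma GamV_bound i (v x : pt) (K : R) :
  (forall b, `|Gam g i b x| <= K) -> `|GamV i v x| <= 4 * `|v| * K.
Proof.
move=> GK; rewrite /GamV (le_trans (ler_norm_sum _ _ _)) //.
have -> : 4 * `|v| * K = \sum_(b < 4) `|v| * K.
  by rewrite !big_ord_recl big_ord0; ring.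
by apply: ler_sum => b _; rewrite normrZ ler_pM // mx_entry_le.
Qed.

Lemma GamV_Ck i v k : Ckmx (mrange i) k (GamV i v).
Proof.
have oi := @mrange_open' _ M i; move=> a b.
apply: (@Ck_ext _ k _ (fun x => \sum_c v c 0 * Gam g i c x a b)) => //.
  by move=> x _; rewrite summxE; apply: eq_bigr => c _; rewrite mxZE.
by apply: Ck_sum => // c; apply: CkM => //; [exact: Ck_cst|exact: Gam_Ck].
Qed.

(** The parameter interval is symmetric, so that 0 is interior: the loops of the curvature argument
    are differentiated there. *)
Definition line_frame i (y w : pt) (E : R -> 'M[R]_4) : Prop :=
  E 0 = 1%:M /\ forall t : R, `|t| <= 1 ->
    mrange i (y + t *: w) /\
    is_derive t 1 E (- (GamV i w (y + t *: w) *m E t)).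

Lemma line_derive (y w : pt) (t : R) : is_derive t 1 (fun s : R => y + s *: w) w.
Proof. by apply: is_derive_line. Qed.

Lemma line_chain m n (W : set pt) (A : pt -> 'M[R]_(m, n)) (y w : pt) (t : R) :
  open W -> Ckmx W 1 A -> W (y + t *: w) ->
  is_derive t 1 (fun s : R => A (y + s *: w)) (\sum_b w b 0 *: dmx b A (y + t *: w)).
Proof.
move=> oW CA Wy.
exact: (@Ckmx_chain _ _ _ W A (fun s : R => y + s *: w) t 1 w oW CA Wy (line_derive _ _ _)).
Qed.

Lemma line_in_ball (x0 y w : pt) (r t : R) : `|y - x0| <= r / 2 -> `|w| <= r / 2 ->
  `|t| <= 1 -> `|y + t *: w - x0| <= r.
Proof.
move=> yr wr t1; rewrite addrAC (le_trans (ler_normD _ _)) // normrZ.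
have : `|t| * `|w| <= 1 * (r / 2) by rewrite ler_pM.
lra.
Qed.

(** The equation has size 4 and coefficient at most [4 |w| K], so the smallness condition of
    [linear_ode] is [16 |w| K <= 1/4]; hence the 64. *)
Lemma line_frame_exists i x0 (y w : pt) (r K : R) : 0 <= K ->
  (forall x : pt, `|x - x0| <= r -> mrange i x) ->
  (forall b (x : pt), `|x - x0| <= r -> `|Gam g i b x| <= K) ->
  `|y - x0| <= r / 2 -> `|w| <= r / 2 -> 64 * (`|w| * K) <= 1 ->
  exists E, line_frame i y w E.
Proof.
move=> K0 rW GK yr wr wK.
have inr (t : R) : `|t| <= 1 -> `|y + t *: w - x0| <= r by exact: line_in_ball.
have [||||||E [E0 dE]] := @linear_ode R 4 4 (fun t => - GamV i w (y + t *: w))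
    (fun=> 0) 1%:M 1 (4 * `|w| * K) 0.
- exact: ler01.
- by lra.
- by rewrite !mulr_ge0.
- exact: lexx.
- move=> t t1; split; last exact: cst_continuous.
  have H := line_chain (@mrange_open' _ M i) (@GamV_Ck i w 1) (rW _ (inr t t1)).
  exact: is_derive_continuous (is_deriveN H).
- move=> t t1; rewrite normr0; split => //; rewrite normrN.
  by apply: GamV_bound => b; apply: GK; exact: inr.
exists E; split => // t t1; split; first exact/rW/inr.
by have := dE t t1; rewrite addr0 mulNmx.
Qed.

Lemma smooth_line (y w : pt) : smooth_curve_on setT (fun s : R => y + s *: w).
Proof.
case=> [|k] t _; first by rewrite derive1n0; case: (line_derive y w t).
have -> : derive1n k.+1 (fun s : R => y + s *: w) = cst (if k is 0%N then w else 0).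
  elim: k => [|k IH].
    rewrite derive1n1; apply/funext => s; exact: is_derive_derive1 (line_derive y w s).
  by rewrite derive1nS IH; apply/funext => s; rewrite derive1_cst.
exact: derivable_cst.
Qed.

Lemma line_transport i y w E : line_frame i y w E -> forall t : R, `|t| <= 1 ->
  transport g i (mfrom M i y) i (mfrom M i (y + t *: w)) (E t).
Proof.
move=> [E0 dE] t t1.
pose x (s : R) : pt := y + s *: (t *: w); pose F (s : R) := E (0 + s * t).
have st s : 0 <= s <= 1 -> `|s * t| <= 1.
  move=> /andP[s0 s1]; rewrite normrM (ger0_norm s0).
  by rewrite -[leRHS]mulr1 ler_pM.
have x0 : x 0 = y by rewrite /x scale0r addr0.
have x1 : x 1 = y + t *: w by rewrite /x scale1r.
have F1 : F 1 = E t by rewrite /F mul1r add0r.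
rewrite -[in mfrom M i y]x0 -x1 -F1; apply: transport_arc.
- exact: smooth_line.
- by move=> s /st st1; rewrite /x scalerA; have [] := dE _ st1.
- split; first by rewrite /F mul0r addr0.
  move=> s /st st1; have [rs] := dE _ st1; rewrite -{1}[s * t]add0r => dEs.
  have H := is_derive_affine dEs.
  rewrite (is_derive_derive1 (line_derive y (t *: w) s)) GamVE.
  apply: is_derive_eq H _.
  by rewrite GamVZ scalerN scalemxAl /F /x scalerA add0r.
Qed.

Lemma transport_near p : exists2 U : set M, open U /\ U p &
  forall q, U q -> exists j T, mdom M j p /\ transport g j p j q T.
Proof.
have [j jp] := mcover p.
have [r [K [r0 K0 rW GK _]]] := Ckmx_loc_lipschitz (@mrange_open' _ M j)
  (fun c => @Gam_Ck _ M g j 1 c) (mrange_to jp).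
pose e := Num.min (r / 2) (64 * K + 1)^-1.
have K1 : 0 < 64 * K + 1 by rewrite ltr_wpDl // mulr_ge0.
have e0 : 0 < e by rewrite lt_min divr_gt0 // invr_gt0.
have nb : nbhs p (mdom M j `&` mto M j @^-1` ball (mto M j p) e).
  apply: filterI; first by apply: open_nbhs_nbhs; split => //; exact: mdom_open.
  by apply: (mto_cvg jp); exact: nbhsx_ballx.
exists (interior (mdom M j `&` mto M j @^-1` ball (mto M j p) e)).
  by split; [exact: open_interior|exact: nb].
move=> q /interior_subset[jq]; rewrite /= -ball_normE /ball_ /= distrC => qe.
have wr : `|mto M j q - mto M j p| <= r / 2.
  by rewrite (le_trans (ltW qe)) // ge_min lexx.
have wK : 64 * (`|mto M j q - mto M j p| * K) <= 1.
  have h : `|mto M j q - mto M j p| <= (64 * K + 1)^-1.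
    by rewrite (le_trans (ltW qe)) // ge_min lexx orbT.
  rewrite -[leRHS]mul1r ler_pdivlMr // in h.
  have := normr_ge0 (mto M j q - mto M j p); lra.
have [|E HE] := @line_frame_exists j (mto M j p) (mto M j p)
    (mto M j q - mto M j p) r K K0 rW GK _ wr wK.
  by rewrite subrr normr0 divr_ge0 // ltW.
exists j, (E 1); split => //; have := line_transport HE (t := 1).
by rewrite normr1 lexx scale1r addrC subrK !mtoK //; exact.
Qed.

(** The set of reachable points is open by short straight segments, and closed because these can be
    run backwards; connectedness does the rest. Every curvature endomorphism can thus be compared
    with the holonomy at one base point. *)
Lemma transport_exists i p j q : mdom M i p -> mdom M j q ->
  exists T, transport g i p j q T.
Proof.
move=> ip jq.
pose S : set M := [set q | exists j T, mdom M j q /\ transport g i p j q T].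
have Sj q' j' : S q' -> mdom M j' q' -> exists T, transport g i p j' q' T.
  move=> [k [T [kq HT]]] jq'; exists (jac k j' (mto M k q') *m T).
  by apply: transport_comp HT _; exact: transport_chart.
suff ST : S = setT by apply: Sj => //; rewrite ST.
have oS : open S.
  rewrite openE => q' Sq'; have [U [oU Uq'] HU] := transport_near q'.
  apply: filterS (open_nbhs_nbhs (conj oU Uq')) => q2 /HU[k [T [kq HT]]].
  have [T1 HT1] := Sj _ _ Sq' kq.
  exists k, (T *m T1); split; first by have [] := transport_isometry HT.
  exact: transport_comp HT.
have cS : closed S.
  rewrite -openC openE => q' nSq'; have [U [oU Uq'] HU] := transport_near q'.
  apply: filterS (open_nbhs_nbhs (conj oU Uq')) => q2 /HU[k [T [kq HT]]] Sq2.
  apply: nSq'; have [_ kq2 _] := transport_isometry HT.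
  have [T1 HT1] := Sj _ _ Sq2 kq2.
  exists k, (invmx T *m T1); split => //.
  exact: transport_comp HT1 (transport_inv HT).
have := @mconnected _ M S; rewrite -[in S = _](setTI S).
apply.
- by exists p, i, (jac i i (mto M i p)); split => //; exact: transport_chart.
- by exists S; rewrite ?setTI.
- by exists S; rewrite ?setTI.
Qed.

End Transport.

(** * Curvature and holonomy *)

Section ParameterDependence.
Context {R : realType}.

Lemma mvt_mx_segment m n (f df : R -> 'M[R]_(m, n)) (a b C : R) : 0 <= C ->
  (forall s : R, 0 <= s <= 1 -> is_derive (a + s * (b - a)) 1 f (df (a + s * (b - a)))) ->
  (forall s : R, 0 <= s <= 1 -> `|df (a + s * (b - a))| <= C) ->
  `|f b - f a| <= C * `|b - a|.
Proof.
move=> C0 dfE dfC.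
have H := @mvt_mx R _ _ (fun s => f (a + s * (b - a)))
  (fun s => (b - a) *: df (a + s * (b - a))) 0 1 (C * `|b - a|) ler01.
move: H; rewrite mul1r mul0r addr0 (addrC a) subrK subr0 mulr1; apply.
- by rewrite mulr_ge0.
- by move=> s s01; apply: is_derive_affine; exact: dfE.
- by move=> s s01; rewrite normrZ mulrC ler_wpM2r //; exact: dfC.
Qed.

Lemma is_derive_quadratic m n (f : R -> 'M[R]_(m, n)) (t : R) d (r C : R) : 0 < r -> 0 <= C ->
  (forall h : R, `|h| <= r -> `|f (t + h) - f t - h *: d| <= C * `|h| ^+ 2) ->
  is_derive t 1 f d.
Proof.
move=> r0 C0 H.
suff cf : h^-1 *: (f (h *: 1 + t) - f t) @[h --> 0^'] --> d.
  by split; [apply/cvg_ex; exists d; exact: cf|apply/cvg_lim => //; exact: cf].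
apply/cvgrPdist_le => e e0.
have C1 : 0 < C + 1 by rewrite ltr_wpDl.
near=> h.
have h0 : h != 0 by near: h; exact: nbhs_dnbhs_neq.
have hr : `|h| <= r by near: h; exact: dnbhs0_le.
have he : `|h| <= e / (C + 1) by near: h; apply: dnbhs0_le; rewrite divr_gt0.
have -> : d - h^-1 *: (f (h *: 1 + t) - f t) =
    - (h^-1 *: (f (t + h) - f t - h *: d)).
  rewrite -[h *: 1]/(h * 1) mulr1 (addrC h) !scalerBr scalerA mulVf // scale1r.
  by rewrite [RHS]opprB.
rewrite normrN normrZ normfV -ler_pdivlMl ?invr_gt0 ?normr_gt0 // invrK.
apply: le_trans (H h hr) _; rewrite expr2 mulrA mulrC ler_wpM2l //.
rewrite ler_pdivlMr // in he; apply: le_trans he; rewrite mulrC ler_wpM2l // lerDl //.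
Unshelve. all: by end_near. Qed.

Lemma norm1mx_le n : `|1%:M : 'M[R]_n| <= 1.
Proof.
apply: mx_norm_le => // i j; rewrite !mxE.
by case: eqP => _; rewrite ?normr1 ?normr0.
Qed.

(** [S] solves the linear equation with coefficient [A], and [A1] stands for the [u]-derivative of
    [A]. [Q] is the candidate for the [u]-derivative of [S]: it solves the variational equation
    obtained by formal differentiation. *)
Variables (n : nat) (A A1 S Q : R -> R -> 'M[R]_n) (a C : R).
Hypotheses (a0 : 0 <= a) (C0 : 0 <= C) (na : n%:R * a <= 2^-1).
Hypothesis A_le : forall u v, `|u| <= 1 -> `|v| <= 1 -> `|A u v| <= a.
Hypothesis A1_le : forall u v, `|u| <= 1 -> `|v| <= 1 -> `|A1 u v| <= C.
Hypothesis A_lip : forall u u' v, `|u| <= 1 -> `|u'| <= 1 -> `|v| <= 1 ->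
  `|A u' v - A u v| <= C * `|u' - u|.
Hypothesis A1_lip : forall u u' v, `|u| <= 1 -> `|u'| <= 1 -> `|v| <= 1 ->
  `|A1 u' v - A1 u v| <= C * `|u' - u|.
Hypothesis A_taylor : forall u u' v, `|u| <= 1 -> `|u'| <= 1 -> `|v| <= 1 ->
  `|A u' v - A u v - (u' - u) *: A1 u v| <= C * `|u' - u| ^+ 2.
Hypothesis S0 : forall u, `|u| <= 1 -> S u 0 = 1%:M.
Hypothesis dS : forall u v : R, `|u| <= 1 -> `|v| <= 1 ->
  is_derive v 1 (S u) (A u v *m S u v).
Hypothesis Q0 : forall u, `|u| <= 1 -> Q u 0 = 0.
Hypothesis dQ : forall u v : R, `|u| <= 1 -> `|v| <= 1 ->
  is_derive v 1 (Q u) (A u v *m Q u v + A1 u v *m S u v).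

Let N : R := n%:R.
Let N0 : 0 <= N. Proof. exact: ler0n. Qed.

Let mm (X Y : 'M[R]_n) x y : 0 <= x -> `|X| <= x -> `|Y| <= y -> `|X *m Y| <= N * x * y.
Proof.
move=> x0 Xx Yy; apply: le_trans (mulmx_norm_le _ _) _.
by rewrite ler_pM ?mulr_ge0 // ler_wpM2l.
Qed.

Let gron (w : R -> 'M[R]_n) (u : R) (F : R -> 'M[R]_n) (e : R) : `|u| <= 1 -> 0 <= e ->
  w 0 = 0 -> (forall v : R, `|v| <= 1 -> is_derive v 1 w (A u v *m w v + F v)) ->
  (forall v, `|v| <= 1 -> `|F v| <= e) -> forall v, `|v| <= 1 -> `|w v| <= 2 * e.
Proof.
move=> u1 e0 w0 dw' Fe v v1; rewrite -[e]mulr1.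
apply: (@gronwall_short _ _ _ w (fun v => A u v *m w v + F v) 1 (N * a)) => //.
- by rewrite mulr_ge0.
- by rewrite mulr1.
- move=> s s1; apply: le_trans (ler_normD _ _) _; rewrite lerD ?Fe //.
  by apply: mm => //; exact: A_le.
Qed.

Let S_bounded : exists2 B : R, 0 <= B & forall u v, `|u| <= 1 -> `|v| <= 1 -> `|S u v| <= B.
Proof.
exists (2 * (N * a * 1) + 1); first by rewrite addr_ge0 // !mulr_ge0.
move=> u v u1 v1; rewrite -[S u v](subrK 1%:M) (le_trans (ler_normD _ _)) //.
rewrite lerD ?norm1mx_le //.
apply: (@gron (fun v => S u v - 1%:M) u (A u)) => //.
- by rewrite !mulr_ge0.
- by rewrite S0 // subrr.
- move=> s s1; have := is_deriveB (dS u1 s1) (is_derive_cst 1%:M s 1).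
  by rewrite subr0 mulmxBr mulmx1 subrK.
- move=> s s1; rewrite -[A u s]mulmx1; apply: mm => //; first exact: A_le.
  exact: norm1mx_le.
Qed.

Let Q_bounded : exists2 B : R, 0 <= B & forall u v, `|u| <= 1 -> `|v| <= 1 -> `|Q u v| <= B.
Proof.
have [B B0 SB] := S_bounded; exists (2 * (N * C * B)); first by rewrite !mulr_ge0.
move=> u v u1 v1; apply: (@gron (Q u) u (fun v => A1 u v *m S u v)) => //.
- by rewrite !mulr_ge0.
- exact: Q0.
- by move=> s s1; exact: dQ.
- by move=> s s1; apply: mm => //; [exact: A1_le|exact: SB].
Qed.

Let S_lip : exists2 B : R, 0 <= B & forall u u' v, `|u| <= 1 -> `|u'| <= 1 -> `|v| <= 1 ->
  `|S u' v - S u v| <= B * `|u' - u|.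
Proof.
have [B B0 SB] := S_bounded; exists (2 * (N * C * B)); first by rewrite !mulr_ge0.
move=> u u' v u1 u'1 v1.
have -> : 2 * (N * C * B) * `|u' - u| = 2 * (N * (C * `|u' - u|) * B) by ring.
apply: (@gron (fun v => S u' v - S u v) u'
  (fun v => (A u' v - A u v) *m S u v)) => //.
- by rewrite !mulr_ge0.
- by rewrite !S0 // subrr.
- move=> s s1; apply: is_derive_eq (is_deriveB (dS u'1 s1) (dS u1 s1)) _.
  by rewrite mulmxBl mulmxBr addrA subrK.
- by move=> s s1; apply: mm => //; [rewrite mulr_ge0|exact: A_lip|exact: SB].
Qed.

(** The first-order remainder of [S] in [u] satisfies the same linear equation with a forcing term
    quadratic in the increment, so [gron] bounds it quadratically. *)
Lemma ode_param_derive (u v : R) : `|u| < 1 -> `|v| <= 1 ->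
  is_derive u 1 (S^~ v) (Q u v).
Proof.
move=> u1 v1; have u1' := ltW u1.
have [B B0 SB] := S_bounded; have [B1 B10 SL] := S_lip.
apply: (@is_derive_quadratic _ _ _ _ _ (1 - `|u|) (2 * (N * C * B1 + N * C * B))).
- by rewrite subr_gt0.
- by rewrite mulr_ge0 // addr_ge0 // !mulr_ge0.
move=> h hr; pose u' := u + h.
have u'1 : `|u'| <= 1 by rewrite (le_trans (ler_normD _ _)) //; lra.
have hE : h = u' - u by rewrite /u' addrC addKr.
rewrite -mulrA -/u' hE.
apply: (@gron (fun v => S u' v - S u v - (u' - u) *: Q u v) u (fun v =>
    (A u' v - A u v) *m (S u' v - S u v) +
    (A u' v - A u v - (u' - u) *: A1 u v) *m S u v)) => //.
- by rewrite !mulr_ge0 ?exprn_ge0 // addr_ge0 // !mulr_ge0.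
- by rewrite !S0 // Q0 // scaler0 subr0 subrr.
- move=> s s1.
  apply: is_derive_eq (is_deriveB (is_deriveB (dS u'1 s1) (dS u1' s1))
    (is_deriveZ (u' - u) (dQ u1' s1))) _; move: (u' - u) => k.
  rewrite !(mulmxDl, mulmxDr, mulmxBl, mulmxBr, mulmxN, mulNmx) -!scalemxAr -!scalemxAl.
  rewrite !scalerDr.
  move: (_ *m _) (_ *m _) (_ *m _) (_ *m _) (_ *m _) => X1 X2 X3 X4 X5.
  by apply/matrixP => i j; rewrite !(mxDE, mxNE, mxZE); ring.
- move=> s s1; apply: le_trans (ler_normD _ _) _; rewrite mulrDl lerD //.
    have -> : N * C * B1 * `|u' - u| ^+ 2 = N * (C * `|u' - u|) * (B1 * `|u' - u|).
      by ring.
    by apply: mm; [rewrite mulr_ge0|exact: A_lip|exact: SL].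
  have -> : N * C * B * `|u' - u| ^+ 2 = N * (C * `|u' - u| ^+ 2) * B by ring.
  by apply: mm; [rewrite mulr_ge0 // exprn_ge0|exact: A_taylor|exact: SB].
Qed.

(** Continuity of the derivative matters because [lie_algebra] admits C^1 curves only. The
    difference of two values of [Q] is bounded linearly by the same estimate. *)
Lemma ode_param_continuous (u v : R) : `|u| < 1 -> `|v| <= 1 ->
  {for u, continuous (Q^~ v)}.
Proof.
move=> u1 v1; have u1' := ltW u1.
have [B B0 SB] := S_bounded; have [B1 B10 SL] := S_lip; have [B2 B20 QB] := Q_bounded.
pose D := N * C * B2 + (N * C * B1 + N * C * B).
have D0 : 0 <= D by rewrite !addr_ge0 // !mulr_ge0.
have L (u' : R) : `|u'| <= 1 -> `|Q u' v - Q u v| <= 2 * (D * `|u' - u|).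
  move=> u'1; apply: (@gron (fun v => Q u' v - Q u v) u' (fun v =>
    (A u' v - A u v) *m Q u v + (A1 u' v *m (S u' v - S u v)
      + (A1 u' v - A1 u v) *m S u v))) => //.
  - by rewrite mulr_ge0.
  - by rewrite !Q0 // subrr.
  - move=> s s1; apply: is_derive_eq (is_deriveB (dQ u'1 s1) (dQ u1' s1)) _.
    rewrite !(mulmxBl, mulmxBr).
    move: (_ *m _) (_ *m _) (_ *m _) (_ *m _) (_ *m _) => X1 X2 X3 X4 X5.
    by apply/matrixP => i j; rewrite !(mxDE, mxNE, mxZE); ring.
  - move=> s s1; rewrite mulrDl mulrDl.
    apply: le_trans (ler_normD _ _) _; rewrite lerD //.
      have -> : N * C * B2 * `|u' - u| = N * (C * `|u' - u|) * B2 by ring.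
      by apply: mm; [rewrite mulr_ge0|exact: A_lip|exact: QB].
    apply: le_trans (ler_normD _ _) _; rewrite lerD //.
      by rewrite -mulrA; apply: mm => //; [exact: A1_le|exact: SL].
    have -> : N * C * B * `|u' - u| = N * (C * `|u' - u|) * B by ring.
    by apply: mm; [rewrite mulr_ge0|exact: A1_lip|exact: SB].
apply/cvgrPdist_le => e e0.
have k0 : 0 < e / (2 * D + 1) by rewrite divr_gt0 // ltr_wpDl // mulr_ge0.
near=> u'.
have h1 : `|u' - u| <= 1 - `|u|.
  rewrite distrC; near: u'; apply: cvgr_dist_le; first exact: cvg_id.
  by rewrite subr_gt0.
have h2 : `|u' - u| <= e / (2 * D + 1).
  by rewrite distrC; near: u'; apply: cvgr_dist_le => //; exact: cvg_id.
rewrite distrC (le_trans (L u' _)) //.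
  by rewrite -[u'](subrK u) (le_trans (ler_normD _ _)) //; lra.
rewrite ler_pdivlMr ?ltr_wpDl ?mulr_ge0 // in h2; apply: le_trans h2.
rewrite mulrA mulrC ler_wpM2l // lerDl //.
Unshelve. all: by end_near. Qed.

End ParameterDependence.

Section ClosedSubspace.
Context {R : realType}.

Lemma is_derive_scale_cst (V W : normedModType R) (f : V -> R) (A : W) x v d :
  is_derive x v f d -> is_derive x v (fun y => f y *: A) (d *: A).
Proof.
move=> df; apply: (@is_derive_compR _ _ _ (fun t => t *: A) f x v A d) => //.
have := @is_derive_line _ W W id 0 A (f x) A (is_derive_id _ _).
by congr is_derive; apply/funext => t /=; rewrite add0r.
Qed.

Lemma is_derive_linear (V : normedModType R) m n p q (L : {linear 'M[R]_(m, n) -> 'M[R]_(p, q)})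
    (f : V -> 'M[R]_(m, n)) x v D :
  is_derive x v f D -> is_derive x v (fun y => L (f y)) (L D).
Proof.
move=> /is_derive_mxP df.
have LE A : L A = \sum_a \sum_b A a b *: L (delta_mx a b).
  rewrite {1}[A]matrix_sum_delta linear_sum; apply: eq_bigr => a _.
  by rewrite linear_sum; apply: eq_bigr => b _; rewrite linearZ.
rewrite LE (_ : (fun _ => _) = (fun y => \sum_a \sum_b f y a b *: L (delta_mx a b))).
  apply: is_derive_big => a; apply: is_derive_big => b; exact: is_derive_scale_cst.
by apply/funext => y; exact: LE.
Qed.

(** Closedness of a subspace in algebraic form: [f] minus its projection vanishes on [[0, 1]], and
    the linear projection commutes with the derivative. *)
Lemma derive_mem_vspace m n (V : {vspace 'M[R]_(m, n)}) (f : R -> 'M[R]_(m, n)) D :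
  (forall t, 0 <= t <= 1 -> f t \in V) -> is_derive (0 : R) 1 f D -> D \in V.
Proof.
move=> fV df.
have H : is_derive (0 : R) 1 (fun t => f t - projv V (f t)) (D - projv V D).
  exact: is_deriveB df (is_derive_linear (projv V) df).
have /eqP : D - projv V D = 0.
  apply: (is_derive_right_cst ltr01 _ H) => t /fV ft.
  by rewrite projv_id // subrr.
by rewrite subr_eq0 => /eqP ->; exact: memv_proj.
Qed.

End ClosedSubspace.

Section CurvatureHolonomy.
Context {R : realType} (M : manifold4 R) (g : lorentz_metric M).
Local Notation pt := ('cV[R]_4).
Local Notation e_ b := (@delta_mx R 4 1 b 0).
Implicit Types i j : mindex M.

Lemma frame_gram j y w E : line_frame g j y w E -> forall t : R, `|t| <= 1 ->
  (E t)^T *m g j (y + t *: w) *m E t = g j y.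
Proof.
move=> HE t t1; have := transport_isometry (line_transport HE t1).
have [E0 dE] := HE; have [rt _] := dE t t1.
have [|r0 _] := dE 0; first by rewrite normr0 ler01.
rewrite scale0r addr0 in r0.
by case=> _ _; rewrite !mfromK.
Qed.

Lemma frame_unit j y w E : line_frame g j y w E -> forall t : R, `|t| <= 1 ->
  E t \in unitmx.
Proof. by move=> HE t t1; exact: transport_unit (line_transport HE t1). Qed.

(* Parallel frames preserve the metric, so the inverse of [E t] is
   [g(y)^-1 (E t)^T g(y + t w)], which is differentiable. *)
Lemma frame_inv_derive j y w E : line_frame g j y w E -> forall t : R, `|t| < 1 ->
  is_derive t 1 (fun s => invmx (E s)) (invmx (E t) *m GamV g j w (y + t *: w)).
Proof.
move=> HE t t1; have t1' := ltW t1; have [E0 dE] := HE; have [rt dEt] := dE t t1'.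
have near1 : \forall s \near t, `|s| <= 1.
  have d0 : 0 < 1 - `|t| by rewrite subr_gt0.
  near=> s; have : `|t - s| <= 1 - `|t|.
    by near: s; apply: cvgr_dist_le => //; exact: cvg_id.
  by rewrite distrC => h; rewrite -[s](subrK t) (le_trans (ler_normD _ _)) //; lra.
have [|r0 _] := dE 0; first by rewrite normr0 ler01.
rewrite scale0r addr0 in r0.
have ug := metric_unit g r0.
pose I s := invmx (g j y) *m (E s)^T *m g j (y + s *: w).
have IE : \forall s \near t, I s = invmx (E s).
  apply: filterS near1 => s s1.
  have uE := frame_unit HE s1.
  have IE : I s *m E s = 1%:M.
    by rewrite /I -!mulmxA (mulmxA _^T) (frame_gram HE s1) mulVmx.
  by rewrite -[LHS]mulmx1 -(mulmxV uE) mulmxA IE mul1mx.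
have dg := line_chain (@mrange_open' _ M j) (metric_Ck g j 1) rt.
have dI := is_derive_mulmx (is_derive_mulmx
  (is_derive_cst (invmx (g j y)) t 1) (is_derive_trmx dEt)) dg.
have dJ := is_derive_near_eq IE dI.
set D := (X in is_derive t 1 _ X) in dJ.
have uE := frame_unit HE t1'.
have H := is_derive_mulmx dJ dEt.
have EE : \forall s \near t, invmx (E s) *m E s = 1%:M.
  by apply: filterS near1 => s s1; rewrite mulVmx // (frame_unit HE s1).
have := is_derive_uniq (is_derive_near_eq EE H) (is_derive_cst _ _ _).
rewrite mulmxN => /eqP; rewrite subr_eq0 => /eqP DE.
suff <- : D = invmx (E t) *m GamV g j w (y + t *: w) by [].
by rewrite -[LHS]mulmx1 -(mulmxV uE) mulmxA DE -!mulmxA mulmxV // mulmx1.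
Unshelve. all: by end_near. Qed.

Lemma GamV_delta j d x : GamV g j (e_ d) x = Gam g j d x.
Proof.
rewrite /GamV (bigD1 d) //= big1 => [|k kd]; last by rewrite mxE (negbTE kd) scale0r.
by rewrite mxE !eqxx scale1r addr0.
Qed.

Lemma sum_delta m n (F : 'I_4 -> 'M[R]_(m, n)) (k : R) c :
  \sum_b (k *: e_ c) b 0 *: F b = k *: F c.
Proof.
rewrite (bigD1 c) //= big1 => [|b bc]; last by rewrite !mxE (negbTE bc) mulr0 scale0r.
by rewrite !mxE !eqxx mulr1 addr0.
Qed.

Lemma bounded_on_segment m n (f : R -> 'M[R]_(m, n)) (T : R) : 0 <= T ->
  (forall t : R, `|t| <= T -> {for t, continuous f}) ->
  exists2 b : R, 0 <= b & forall t, `|t| <= T -> `|f t| <= b.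
Proof.
move=> T0 fc.
have wc : {within `[- T, T], continuous (fun t => `|f t|)}.
  apply: continuous_in_subspaceT => t /set_mem /= /[!in_itv]/=.
  rewrite -ler_norml => tT; apply: (@continuous_comp _ _ _ f Num.norm).
    exact: fc.
  exact: norm_continuous.
have [|c _ fmax] := @EVT_max _ (fun t => `|f t|) (- T) T _ wc; first lra.
by exists `|f c| => // t; rewrite ler_norml => tT; apply: fmax; rewrite in_itv.
Qed.

(* The frames along the sides of the parallelograms with vertices x0, x0 + u X,
   x0 + v Y, x0 + u X + v Y, for u and v in [-1, 1]; [Q] is the derivative of [S]
   with respect to u. *)
Lemma parallelogram_frames j (x0 : pt) (c d : 'I_4) : mrange j x0 ->
  exists2 del : R, 0 < del & let X := del *: e_ c in let Y := del *: e_ d in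
  exists (S Q T : R -> R -> 'M[R]_4),
  [/\ forall u : R, `|u| <= 1 -> line_frame g j (x0 + u *: X) Y (S u),
      forall v : R, `|v| <= 1 -> line_frame g j (x0 + v *: Y) X (T v),
      forall u v : R, `|u| < 1 -> `|v| <= 1 -> is_derive u 1 (S^~ v) (Q u v),
      forall u v : R, `|u| < 1 -> `|v| <= 1 -> {for u, continuous (Q^~ v)} &
      Q 0 0 = 0 /\
      is_derive (0 : R) 1 (Q 0) (- ((del * del) *: dmx c (Gam g j d) x0))].
Proof.
move=> jx0; have oj := @mrange_open' _ M j.
have [r [K [r0 K0 rW GK _]]] := Ckmx_loc_lipschitz oj (fun c => @Gam_Ck _ M g j 1 c) jx0.
(* The connection matrix and its derivative form one family, so that a single radius and constant
   serve both [A] and [A1]. *)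
pose FG (b : bool) := if b then Gam g j d else dmx c (Gam g j d).
have CFG b : Ckmx (mrange j) 1 (FG b) by case: b; [exact: Gam_Ck|apply: Ckmx_dmx => //; exact: Gam_Ck].
have [r' [K' [r'0 K'0 rW' FK FL]]] := Ckmx_loc_lipschitz oj CFG jx0.
(* In turn: the parallelogram stays in both balls, [64 del K <= 1] for the frames along the sides,
   [16 del K' <= 1] for the variational equation, and [del * del <= 1]. *)
pose del := Num.min (Num.min (r / 2) (r' / 2))
  (Num.min (Num.min (64 * K + 1)^-1 (16 * K' + 1)^-1) 1).
have p1 : 0 < 64 * K + 1 by rewrite ltr_wpDl // mulr_ge0.
have p2 : 0 < 16 * K' + 1 by rewrite ltr_wpDl // mulr_ge0.
have del0 : 0 < del by rewrite !lt_min !divr_gt0 // !invr_gt0 p1 p2 ltr01.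
have : del <= del by [].
rewrite {2}/del !le_min => /andP[/andP[dr dr'] /andP[/andP[dK dK'] d1]].
rewrite -[leRHS]mul1r ler_pdivlMr // in dK.
rewrite -[leRHS]mul1r ler_pdivlMr // in dK'.
clearbody del; exists del => // X Y.
have nX (u : R) : `|u| <= 1 -> `|u *: X| <= del.
  move=> u1; rewrite scalerA (le_trans (delta_norm_le _ _)) // normrM (gtr0_norm del0).
  by rewrite ler_piMl // ltW.
have nY (u : R) : `|u| <= 1 -> `|u *: Y| <= del.
  move=> u1; rewrite scalerA (le_trans (delta_norm_le _ _)) // normrM (gtr0_norm del0).
  by rewrite ler_piMl // ltW.
have nX1 : `|X| <= del by rewrite -[X]scale1r nX // normr1.
have nY1 : `|Y| <= del by rewrite -[Y]scale1r nY // normr1.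
have frame (y w : pt) : `|y - x0| <= del -> `|w| <= del -> exists E, line_frame g j y w E.
  move=> yd wd; apply: (@line_frame_exists _ M g j x0 y w r K) => //.
  - exact: le_trans dr.
  - exact: le_trans dr.
  - have : `|w| * K <= del * K by rewrite ler_wpM2r.
    lra.
have /choice[S HS] : forall u : R, exists S, `|u| <= 1 ->
    line_frame g j (x0 + u *: X) Y S.
  move=> u; have [u1|] := pselect (`|u| <= 1); last by exists (fun=> 0).
  have [|//|E HE] := frame (x0 + u *: X) Y; last by exists E.
  by rewrite addrC addKr nX.
have /choice[T HT] : forall v : R, exists T, `|v| <= 1 ->
    line_frame g j (x0 + v *: Y) X T.
  move=> u; have [u1|] := pselect (`|u| <= 1); last by exists (fun=> 0).
  have [|//|E HE] := frame (x0 + u *: Y) X; last by exists E.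
  by rewrite addrC addKr nY.
pose P (u v : R) : pt := x0 + v *: Y + u *: X.
have PE u v : P u v = x0 + u *: X + v *: Y by rewrite /P addrAC.
have Pr (u v : R) : `|u| <= 1 -> `|v| <= 1 -> `|P u v - x0| <= r'.
  move=> u1 v1; rewrite /P -(addrA x0) (addrC x0) addrK (le_trans (ler_normD _ _)) //.
  have := nX u u1; have := nY v v1; lra.
have PB (u u' v : R) : `|P u' v - P u v| <= `|u' - u|.
  rewrite /P opprD addrACA subrr add0r -scalerBl scalerA.
  rewrite (le_trans (delta_norm_le _ _)) // normrM (gtr0_norm del0).
  by rewrite ler_piMr.
pose A u v := - (del *: FG true (P u v)).
pose A1 u v := - ((del * del) *: FG false (P u v)).
have dd1 : del * del <= 1 by rewrite -[leRHS]mulr1 ler_pM // ltW.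
have PW (u v : R) : `|u| <= 1 -> `|v| <= 1 -> mrange j (P u v).
  by move=> u1 v1; apply: rW'; exact: Pr.
have AE u v : A u v = - GamV g j Y (x0 + u *: X + v *: Y).
  by rewrite /A GamVZ GamV_delta -PE.
have dA (u v : R) : `|u| <= 1 -> `|v| <= 1 -> is_derive u 1 (A^~ v) (A1 u v).
  move=> u1 v1; have H := line_chain oj (CFG true) (PW u v u1 v1).
  rewrite sum_delta in H.
  apply: is_derive_eq (is_deriveN (is_deriveZ del H)) _.
  by rewrite [del *: (del *: _)]scalerA.
have A_le (u v : R) : `|u| <= 1 -> `|v| <= 1 -> `|A u v| <= del * K'.
  move=> u1 v1; rewrite normrN normrZ (gtr0_norm del0) ler_wpM2l ?(ltW del0) //.
  by apply: FK; exact: Pr.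
have A1_le (u v : R) : `|u| <= 1 -> `|v| <= 1 -> `|A1 u v| <= K'.
  move=> u1 v1; rewrite normrN normrZ gtr0_norm ?mulr_gt0 //.
  apply: (@le_trans _ _ (1 * K')); last by rewrite mul1r.
  by rewrite ler_pM ?mulr_ge0 ?(ltW del0) //; apply: FK; exact: Pr.
have A_lip (u u' v : R) : `|u| <= 1 -> `|u'| <= 1 -> `|v| <= 1 ->
    `|A u' v - A u v| <= K' * `|u' - u|.
  move=> u1 u'1 v1; rewrite /A opprK addrC -scalerBr normrZ (gtr0_norm del0) distrC.
  apply: (@le_trans _ _ (1 * (K' * `|u' - u|))); last by rewrite mul1r.
  rewrite ler_pM ?(ltW del0) //; apply: le_trans (FL true _ _ (Pr _ _ u'1 v1) (Pr _ _ u1 v1)) _.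
  by rewrite ler_wpM2l.
have A1_lip (u u' v : R) : `|u| <= 1 -> `|u'| <= 1 -> `|v| <= 1 ->
    `|A1 u' v - A1 u v| <= K' * `|u' - u|.
  move=> u1 u'1 v1; rewrite /A1 opprK addrC -scalerBr normrZ gtr0_norm ?mulr_gt0 // distrC.
  apply: (@le_trans _ _ (1 * (K' * `|u' - u|))); last by rewrite mul1r.
  rewrite ler_pM ?mulr_ge0 ?(ltW del0) //.
  apply: le_trans (FL false _ _ (Pr _ _ u'1 v1) (Pr _ _ u1 v1)) _.
  by rewrite ler_wpM2l.
have A_taylor (u u' v : R) : `|u| <= 1 -> `|u'| <= 1 -> `|v| <= 1 ->
    `|A u' v - A u v - (u' - u) *: A1 u v| <= K' * `|u' - u| ^+ 2.
  move=> u1 u'1 v1.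
  have seg (s : R) : 0 <= s <= 1 -> `|u + s * (u' - u)| <= 1.
    move=> /andP[s0 s1]; have -> : u + s * (u' - u) = (1 - s) * u + s * u' by ring.
    rewrite (le_trans (ler_normD _ _)) // !normrM (ger0_norm s0) ger0_norm ?subr_ge0 //.
    have : (1 - s) * `|u| <= (1 - s) * 1 by rewrite ler_wpM2l // subr_ge0.
    have : s * `|u'| <= s * 1 by rewrite ler_wpM2l.
    lra.
  have := @mvt_mx_segment _ _ _ (fun s => A s v - s *: A1 u v)
    (fun s => A1 s v - A1 u v) u u' (K' * `|u' - u|).
  have -> : A u' v - u' *: A1 u v - (A u v - u *: A1 u v) =
      A u' v - A u v - (u' - u) *: A1 u v.
    move: (A u' v) (A u v) (A1 u v) => B1 B2 B3.
    by apply/matrixP => p q; rewrite !(mxDE, mxNE, mxZE); ring.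
  rewrite -mulrA -expr2; apply.
  - by rewrite mulr_ge0.
  - move=> s s01; apply: is_deriveB; first exact: dA (seg s s01) v1.
    by have := @is_derive_scale_cst _ _ _ id (A1 u v) (u + s * (u' - u)) 1 1
      (is_derive_id _ _); rewrite scale1r.
  - move=> s s01; apply: le_trans (A1_lip _ _ _ u1 (seg s s01) v1) _.
    have /andP[s0 s1] := s01.
    by rewrite ler_wpM2l // addrC addKr normrM (ger0_norm s0) ler_piMl.
have dS (u v : R) : `|u| <= 1 -> `|v| <= 1 -> is_derive v 1 (S u) (A u v *m S u v).
  by move=> u1 v1; have [_ /(_ v v1)[_]] := HS u u1; rewrite AE mulNmx.
have AcontV (u v : R) : `|u| <= 1 -> `|v| <= 1 -> forall b,
    {for v, continuous (fun v => FG b (P u v))}.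
  move=> u1 v1 b.
  have Wuv : mrange j (x0 + u *: X + v *: Y) by rewrite -PE; exact: PW.
  have -> : (fun v => FG b (P u v)) = (fun s : R => FG b (x0 + u *: X + s *: Y)).
    by apply/funext => s; rewrite PE.
  exact: is_derive_continuous (line_chain oj (CFG b) Wuv).
have cA (u v : R) : `|u| <= 1 -> `|v| <= 1 -> {for v, continuous (A u)}.
  by move=> u1 v1; apply: continuousN; apply: continuousZr; exact: (AcontV u v u1 v1 true).
have cA1 (u v : R) : `|u| <= 1 -> `|v| <= 1 -> {for v, continuous (A1 u)}.
  by move=> u1 v1; apply: continuousN; apply: continuousZr; exact: (AcontV u v u1 v1 false).
have /choice[Q HQ] : forall u : R, exists Q : R -> 'M[R]_4, `|u| <= 1 -> Q 0 = 0 /\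
    forall v : R, `|v| <= 1 -> is_derive v 1 Q (A u v *m Q v + A1 u v *m S u v).
  move=> u; have [u1|] := pselect (`|u| <= 1); last by exists (fun=> 0).
  have cB (v : R) : `|v| <= 1 -> {for v, continuous (fun v => A1 u v *m S u v)}.
    move=> v1; apply: continuous_mulmx; first exact: cA1.
    exact: is_derive_continuous (dS u v u1 v1).
  have [b b0 Bb] := bounded_on_segment ler01 cB.
  have [||||||E [E0 dE]] := @linear_ode R 4 4 (A u) (fun v => A1 u v *m S u v) 0 1
    (del * K') b.
  - exact: ler01.
  - by rewrite mulr1; lra.
  - by rewrite mulr_ge0 // ltW.
  - exact: b0.
  - by move=> v v1; split; [exact: cA|exact: cB].
  - by move=> v v1; split; [exact: A_le|exact: Bb].
  by exists E.
have na : 4 * (del * K') <= 2^-1 by lra.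
have dK0 : 0 <= del * K' by rewrite mulr_ge0 // ltW.
have S0 (u : R) : `|u| <= 1 -> S u 0 = 1%:M by move=> /HS[].
have Q0 (u : R) : `|u| <= 1 -> Q u 0 = 0 by move=> /HQ[].
have dQ (u v : R) : `|u| <= 1 -> `|v| <= 1 ->
    is_derive v 1 (Q u) (A u v *m Q u v + A1 u v *m S u v).
  by move=> /HQ[_]; exact.
exists S, Q, T; split.
- exact: HS.
- exact: HT.
- move=> u v u1 v1.
  exact: (ode_param_derive dK0 K'0 na A_le A_lip A_taylor S0 dS Q0 dQ u1 v1).
- move=> u v u1 v1.
  exact: (ode_param_continuous dK0 K'0 na A_le A1_le A_lip A1_lip S0 dS Q0 dQ u1 v1).
- have z1 : `|0 : R| <= 1 by rewrite normr0 ler01.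
  rewrite Q0 //; split => //.
  have := dQ 0 0 z1 z1; rewrite Q0 // S0 // mulmx0 add0r mulmx1 /A1 /P.
  by rewrite !scale0r !addr0.
Qed.

End CurvatureHolonomy.

Section CurvatureInHolonomy.
Context {R : realType} (M : manifold4 R) (g : lorentz_metric M).
Local Notation pt := ('cV[R]_4).
Local Notation e_ b := (@delta_mx R 4 1 b 0).

Lemma continuous_addmx (T : topologicalType) m n (A B : T -> 'M[R]_(m, n)) x :
  {for x, continuous A} -> {for x, continuous B} ->
  {for x, continuous (fun y => A y + B y)}.
Proof. exact: continuousD. Qed.

Lemma continuous_oppmx (T : topologicalType) m n (A : T -> 'M[R]_(m, n)) x :
  {for x, continuous A} -> {for x, continuous (fun y => - A y)}.
Proof. exact: continuousN. Qed.

Lemma continuous_scalemx (T : topologicalType) m n (k : T -> R) (A : T -> 'M[R]_(m, n)) x :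
  {for x, continuous k} -> {for x, continuous A} ->
  {for x, continuous (fun y => k y *: A y)}.
Proof.
move=> ck cA; apply: continuous_mx => i j.
rewrite (_ : (fun _ => _) = (fun y => k y * A y i j)); last first.
  by apply/funext => y; rewrite mxE.
exact: (continuousM ck (continuous_entry (i := i) (j := j) cA)).
Qed.

Lemma GamV_line_continuous (j : mindex M) (y w z : pt) (t : R) : mrange j (y + t *: w) ->
  {for t, continuous (fun s : R => GamV g j z (y + s *: w))}.
Proof.
move=> jt; apply: is_derive_continuous.
exact: (line_chain (@mrange_open' _ M j) (@GamV_Ck _ M g j z 1) jt).
Qed.

(* The holonomy around the parallelogram (u, v), for fixed v, is a C^1 curve in u
   through the identity; its velocity at u = 0 has v-derivative the curvature. *)
Lemma riemann_holonomy (i : mindex M) p (V : {vspace 'M[R]_4}) :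
  (forall A, lie_algebra (holonomy_group g i p) A -> A \in V) ->
  forall j q T, transport g i p j q T -> forall c d,
  invmx T *m Riem g j d c (mto M j q) *m T \in V.
Proof.
move=> GV j q T HT c d; have [ip jq _] := transport_isometry HT.
have uT := transport_unit HT; set x0 := mto M j q.
have jx0 : mrange j x0 by exact: mrange_to.
have oj := @mrange_open' _ M j.
have [del del0 /= [S [Q [Tt [HS HTt dSu cQ [Q00 dQ0]]]]]] :=
  parallelogram_frames g c d jx0.
set X := del *: e_ c in HS HTt; set Y := del *: e_ d in HS HTt.
have z1 : `|0 : R| <= 1 by rewrite normr0 ler01.
have z1' : `|0 : R| < 1 by rewrite normr0 ltr01.
have HS0 : line_frame g j x0 Y (S 0).
  by have := HS 0 z1; rewrite scale0r addr0.
have HT0 : line_frame g j x0 X (Tt 0).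
  by have := HTt 0 z1; rewrite scale0r addr0.
have S00 : S 0 0 = 1%:M by case: HS0.
(* The velocity at [u = 0] of the holonomy around the parallelogram with sides [u X] and [v Y]. *)
pose K v := invmx (S 0 v) *m GamV g j X (x0 + v *: Y) *m S 0 v
  + invmx (S 0 v) *m Q 0 v - GamV g j X x0.
have KV (v : R) : `|v| <= 1 -> invmx T *m K v *m T \in V.
  move=> v1; have HTv := HTt v v1.
  (* The loop based at [x0], read from the right: along [u X], along [v Y], back along [X], back
     along [Y]. *)
  pose H u := invmx (S 0 v) *m (invmx (Tt v u) *m S u v *m Tt 0 u).
  pose H' u := invmx (S 0 v) *m
    ((invmx (Tt v u) *m GamV g j X (x0 + v *: Y + u *: X) *m S u v
      + invmx (Tt v u) *m Q u v) *m Tt 0 u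
     + invmx (Tt v u) *m S u v *m (- (GamV g j X (x0 + u *: X) *m Tt 0 u))).
  have dH (u : R) : `|u| < 1 -> is_derive u 1 H (H' u).
    move=> u1; have u1' := ltW u1.
    have [_ /(_ u u1')[_ dT0]] := HT0.
    have dI := frame_inv_derive HTv u1.
    have h := is_derive_mulmx (is_derive_mulmx dI (dSu u v u1 v1)) dT0.
    have := is_derive_mulmx (is_derive_cst (invmx (S 0 v)) u 1) h.
    by rewrite mul0mx add0r.
  have cH' (u : R) : `|u| < 1 -> {for u, continuous H'}.
    move=> u1; have u1' := ltW u1.
    have [_ /(_ u u1')[ju dT0]] := HT0.
    have [_ /(_ u u1')[juv _]] := HTv.
    have cI := is_derive_continuous (frame_inv_derive HTv u1).
    have cT0 := is_derive_continuous dT0.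
    have cS := is_derive_continuous (dSu u v u1 v1).
    have cG1 := GamV_line_continuous (z := X) juv.
    have cG0 := GamV_line_continuous (z := X) ju.
    have cQu := cQ u v u1 v1.
    have c1 := continuous_mulmx (continuous_mulmx cI cG1) cS.
    have c2 := continuous_mulmx cI cQu.
    have c3 := continuous_mulmx (continuous_mulmx cI cS)
      (continuous_oppmx (continuous_mulmx cG0 cT0)).
    have c4 := continuous_addmx (continuous_mulmx (continuous_addmx c1 c2) cT0) c3.
    exact: (continuous_mulmx (@cst_continuous _ _ (invmx (S 0 v)) u) c4).
  (* [lie_algebra] asks for curves defined on the whole line, while the loops exist for [|u| < 1];
     half the sine stays in that range. Its derivative 1/2 at 0 is undone afterwards by the factor
     2. *)
  pose th (t : R) : R := 2^-1 * sin t.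
  have th1 t : `|th t| < 1.
    rewrite normrM (ger0_norm (_ : 0 <= 2^-1)) ?invr_ge0 //.
    have : `|sin t| <= 1 by rewrite ler_norml sin_geN1 sin_le1.
    lra.
  have dth (t : R) : is_derive t 1 th (2^-1 * cos t).
    exact: is_deriveZ (is_derive_sin t).
  pose f t := invmx T *m H (th t) *m T.
  pose f' t := (2^-1 * cos t) *: (invmx T *m H' (th t) *m T).
  have df (t : R) : is_derive t 1 f (f' t).
    have h := is_derive_comp1 (dH (th t) (th1 t)) (dth t).
    have h2 := is_derive_mulmx (is_derive_mulmx (is_derive_cst (invmx T) t 1) h)
      (is_derive_cst T t 1).
    apply: is_derive_eq h2 _.
    by rewrite mulmx0 addr0 mul0mx add0r -scalemxAr -scalemxAl.
  have th0 : th 0 = 0 by rewrite /th sin0 mulr0.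
  have Tv0 : Tt v 0 = 1%:M by case: HTv.
  have T00 : Tt 0 0 = 1%:M by case: HT0.
  have uS := frame_unit HS0 v1.
  have inv1 : invmx (1%:M : 'M[R]_4) = 1%:M.
    by rewrite -[LHS]mul1mx mulmxV // unitmx1.
  have H'0 : H' 0 = K v.
    rewrite /H' Tv0 T00 inv1 scale0r !addr0 !mul1mx !mulmx1 mulmxN /K.
    by rewrite !mulmxDr mulmxN !mulmxA mulVmx // mul1mx.
  have : f' 0 \in V.
    apply: GV; exists f; split.
    - by rewrite /f th0 /H Tv0 T00 inv1 mul1mx mulmx1 mulVmx // mulmx1 mulVmx.
    - move=> t; have u1 := ltW (th1 t).
      have t1 := line_transport HT0 u1; rewrite mtoK // in t1.
      have t2 := line_transport (HS _ u1) v1.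
      have t3 := transport_inv (line_transport HTv u1).
      have t4 := transport_inv (line_transport HS0 v1); rewrite mtoK // in t4.
      rewrite [x0 + v *: Y + _]addrAC in t3.
      have t5 := transport_comp HT (transport_comp (transport_comp
        (transport_comp (transport_comp t1 t2) t3) t4) (transport_inv HT)).
      rewrite /holonomy_group /=; move: t5; rewrite /f /H !mulmxA; exact.
    - by move=> t; case: (df t).
    - have -> : derive1 f = f'.
        by apply/funext => t; exact: is_derive_derive1 (df t).
      move=> t; apply: (@continuous_scalemx _ _ _ (fun t => 2^-1 * cos t)
        (fun t => invmx T *m H' (th t) *m T) t).
        by apply: continuousM; [exact: cst_continuous|exact: continuous_cos].
      have cc : {for t, continuous (fun s => H' (th s))}.
        apply: (@continuous_comp _ _ _ th H'); last exact: cH' (th1 t).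
        exact: is_derive_continuous (dth t).
      exact: (continuous_mulmx (continuous_mulmx (@cst_continuous _ _ (invmx T) t) cc)
        (@cst_continuous _ _ T t)).
    - exact: is_derive_derive1 (df 0).
  rewrite /f' cos0 mulr1 th0 H'0 => h.
  have := memvZ 2 h; rewrite scalerA mulfV ?scale1r // pnatr_eq0 //.
have [_ /(_ 0 z1)[_ dS0]] := HS0.
(* At [v = 0] the first summand contributes [∂_d Gam_c] and the commutator, the second
   [- ∂_c Gam_d], each with the factor [del * del]. *)
have dK : is_derive (0 : R) 1 K ((del * del) *: Riem g j d c x0).
  have dI := frame_inv_derive HS0 z1'.
  have jx00 : mrange j (x0 + 0 *: Y) by rewrite scale0r addr0.
  have dG := line_chain oj (@GamV_Ck _ M g j X 1) jx00.
  have h1 := is_derive_mulmx (is_derive_mulmx dI dG) dS0.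
  have h2 := is_derive_mulmx dI dQ0.
  have h3 := is_deriveB (is_deriveD h1 h2) (is_derive_cst (GamV g j X x0) (0 : R) 1).
  apply: is_derive_eq h3 _.
  have inv1 : invmx (1%:M : 'M[R]_4) = 1%:M.
    by rewrite -[LHS]mul1mx mulmxV // unitmx1.
  rewrite scale0r addr0 S00 inv1 Q00 mulmx0 add0r subr0 !mul1mx !mulmx1.
  have -> : \sum_b Y b 0 *: dmx b (GamV g j X) x0 = (del * del) *: dmx d (Gam g j c) x0.
    rewrite sum_delta -scalerA; congr (_ *: _).
    have H := is_deriveZ del (Ckmx_derive d (@Gam_Ck _ M g j 1 c) jx0).
    apply: (dmx_is_derive oj (@GamV_Ck _ M g j X 1) jx0 _ H).
    by move=> y _; rewrite GamVZ GamV_delta.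
  rewrite !GamVZ !GamV_delta RiemE mulmxN -!scalemxAl -!scalemxAr !scalerA.
  move: (dmx _ _ _) (dmx _ _ _) (_ *m _) (_ *m _) => A1 A2 A3 A4.
  by apply/matrixP => a b; rewrite !(mxDE, mxNE, mxZE); ring.
have h := is_derive_mulmx (is_derive_mulmx (is_derive_cst (invmx T) (0 : R) 1) dK)
  (is_derive_cst T (0 : R) 1).
have : invmx T *m ((del * del) *: Riem g j d c x0) *m T \in V.
  have := derive_mem_vspace (V := V) _ h.
  rewrite mulmx0 addr0 mul0mx add0r; apply => t /andP[t0 t1].
  by apply: KV; rewrite ger0_norm.
rewrite -scalemxAr -scalemxAl => /(memvZ (del * del)^-1).
by rewrite scalerA mulVf ?scale1r // mulf_neq0 // lt0r_neq0.
Qed.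

End CurvatureInHolonomy.

(** * Algebra of null tetrads *)

Section TetradAlgebra.
Context {R : realType}.
Local Notation pt := ('cV[R]_4).
Local Notation e_ b := (@delta_mx R 4 1 b 0).
Variable h : 'M[R]_4.
Hypothesis hsym : h^T = h.
Local Notation dot := (Defs.inner h).

Lemma dotE (v w : pt) : v^T *m h *m w = (dot v w)%:M.
Proof.
by apply/matrixP => a b; rewrite (ord1 a) (ord1 b) [RHS]mxE eqxx mulr1n.
Qed.

Lemma dotC v w : dot v w = dot w v.
Proof.
rewrite /Defs.inner -[in LHS](trmxK (v^T *m h *m w)) [LHS]mxE.
by rewrite !trmx_mul trmxK hsym mulmxA.
Qed.

Lemma dotDr u v w : dot u (v + w) = dot u v + dot u w.
Proof. by rewrite /Defs.inner mulmxDr mxDE. Qed.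

Lemma dotZr u (c : R) v : dot u (c *: v) = c * dot u v.
Proof. by rewrite /Defs.inner -scalemxAr mxZE. Qed.

Lemma dotDl u v w : dot (v + w) u = dot v u + dot w u.
Proof. by rewrite dotC dotDr !(dotC u). Qed.

Lemma dotZl u (c : R) v : dot (c *: v) u = c * dot v u.
Proof. by rewrite dotC dotZr (dotC u). Qed.

Lemma dotNr u v : dot u (- v) = - dot u v.
Proof. by rewrite -scaleN1r dotZr mulN1r. Qed.

Lemma dotNl u v : dot (- v) u = - dot v u.
Proof. by rewrite dotC dotNr (dotC u). Qed.

Lemma dot0r u : dot u 0 = 0.
Proof. by rewrite /Defs.inner mulmx0 mxE. Qed.

Lemma dot0l u : dot 0 u = 0.
Proof. by rewrite dotC dot0r. Qed.

Definition bivector (p q : pt) : 'M[R]_4 := p *m q^T - q *m p^T.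

Lemma bivector_skew p q : (bivector p q)^T = - bivector p q.
Proof. by rewrite /bivector tr_addmx tr_oppmx !trmx_mul !trmxK opprB. Qed.

Lemma wedgeE p q : Defs.wedge h p q = bivector p q *m h.
Proof. by []. Qed.

Lemma bivector_app p q v : bivector p q *m h *m v = dot q v *: p - dot p v *: q.
Proof.
have E a b : a *m b^T *m h *m v = dot b v *: a.
  by rewrite -!mulmxA (mulmxA b^T) dotE mul_mx_scalar.
by rewrite /bivector !mulmxBl !E.
Qed.

(* If [L (p ^ q)] is skew then p and q are eigenvectors of L for the same
   eigenvalue; [a], [b] is a dual pair witnessing the independence of p, q. *)
Lemma blade_eigen (L : 'M[R]_4) p q a b :
  dot p a = 1 -> dot q a = 0 -> dot p b = 0 -> dot q b = 1 ->
  (L *m bivector p q)^T = - (L *m bivector p q) ->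
  exists k : R, L *m p = k *: p /\ L *m q = k *: q.
Proof.
move=> pa qa pb qb sk.
have E v : dot (L *m p) v *: q - dot (L *m q) v *: p =
    dot p v *: (L *m q) - dot q v *: (L *m p).
  have app (s t : pt) : s *m t^T *m h *m v = dot t v *: s.
    by rewrite -!mulmxA (mulmxA t^T) dotE mul_mx_scalar.
  have := congr1 (fun A => A *m (h *m v)) sk; rewrite mulNmx.
  rewrite /bivector mulmxBr !mulmxA tr_addmx tr_oppmx.
  rewrite (trmx_mul (L *m p)) (trmx_mul (L *m q)) !trmxK.
  by rewrite !mulmxBl !app => ->; rewrite opprB.
have Ea := E a; rewrite pa qa scale1r scale0r subr0 in Ea.
have Eb := E b; rewrite pb qb scale1r scale0r sub0r in Eb.
(* The product of [Ea] with [a] itself says that this number equals its own negative. *)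
have qa0 : dot (L *m q) a = 0.
  have := congr1 (dot^~ a) Ea; rewrite /= dotDl dotNl !dotZl qa pa.
  by move=> e; lra.
have pb0 : dot (L *m p) b = 0.
  have := congr1 (dot^~ b) Eb; rewrite /= dotDl !dotNl !dotZl qb pb.
  by move=> e; lra.
rewrite qa0 scale0r subr0 in Ea; rewrite pb0 scale0r sub0r in Eb.
exists (dot (L *m p) a); split=> //; apply: oppr_inj.
by rewrite -Eb -Ea dotZl qb mulr1.
Qed.

Lemma bivector_kill p q a b v :
  dot p a = 1 -> dot q a = 0 -> dot p b = 0 -> dot q b = 1 ->
  bivector p q *m h *m v = 0 -> dot p v = 0 /\ dot q v = 0.
Proof.
move=> pa qa pb qb; rewrite bivector_app => e.
have ea := congr1 (dot^~ a) e; have eb := congr1 (dot^~ b) e.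
move: ea eb; rewrite /= !dotDl !dotNl !dotZl pa qa pb qb !dot0l.
by move=> ea eb; split; lra.
Qed.

(** Full contraction of the contravariant [W] with [A], whose upper index is lowered by [h]; for
    skew arguments its vanishing is orthogonality of bivectors. *)
Definition pairing (W A : 'M[R]_4) : R := \sum_c \sum_d W c d * (h *m A) c d.

Lemma pairingD W W' A : pairing (W + W') A = pairing W A + pairing W' A.
Proof.
rewrite /pairing -big_split; apply: eq_bigr => c _.
by rewrite -big_split; apply: eq_bigr => d _; rewrite mxDE mulrDl.
Qed.

Lemma pairingZ (k : R) W A : pairing (k *: W) A = k * pairing W A.
Proof.
rewrite /pairing mulr_sumr; apply: eq_bigr => c _.
by rewrite mulr_sumr; apply: eq_bigr => d _; rewrite mxZE mulrA.
Qed.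

Lemma pairing_bivector p q A :
  pairing (bivector p q) A = dot p (A *m q) - dot q (A *m p).
Proof.
have E (u v : pt) : \sum_c \sum_d u c 0 * v d 0 * (h *m A) c d = dot u (A *m v).
  rewrite /Defs.inner -!mulmxA (mulmxA h A) mxME; apply: eq_bigr => c _.
  rewrite mxE mxME mulr_sumr; apply: eq_bigr => d _.
  by rewrite -mulrA (mulrC (v d 0)).
rewrite -!E /pairing -sumrB; apply: eq_bigr => c _.
rewrite -sumrB; apply: eq_bigr => d _.
by rewrite mxBE !mxME !big_ord1 !mxE; ring.
Qed.

Definition tetrad (l n x y : pt) : Prop :=
  [/\ forall v, exists a b c d : R, v = a *: l + b *: n + c *: x + d *: y,
      [/\ dot l n = 1, dot x x = 1 & dot y y = 1],
      [/\ dot l l = 0, dot n n = 0 & dot x y = 0],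
      dot l x = 0 /\ dot l y = 0 & dot n x = 0 /\ dot n y = 0].

(** The general bivector without [n ∧ x] and [n ∧ y] components. These are the ones having [l] as an
    eigenvector, and they contain all three holonomy algebras. *)
Definition null_biv (l n x y : pt) (al be ga de : R) : 'M[R]_4 :=
  al *: bivector l n + be *: bivector l x + ga *: bivector l y
  + de *: bivector x y.

Lemma null_biv_skew l n x y al be ga de :
  (null_biv l n x y al be ga de)^T = - null_biv l n x y al be ga de.
Proof.
rewrite /null_biv !tr_addmx !tr_scalemx !bivector_skew !scalerN.
by rewrite -!opprD.
Qed.

Lemma null_biv_app l n x y al be ga de v :
  null_biv l n x y al be ga de *m h *m v =
  al *: (dot n v *: l - dot l v *: n) + be *: (dot x v *: l - dot l v *: x)
  + ga *: (dot y v *: l - dot l v *: y) + de *: (dot y v *: x - dot x v *: y).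
Proof. by rewrite /null_biv !mulmxDl -!scalemxAl !bivector_app. Qed.

(** Each holonomy algebra is cut out of the family [null_biv] by linear conditions on the
    coefficients, so that most of the argument is carried out once for all three. *)
Definition kind6 (al be ga de : R) : Prop := ga = 0 /\ de = 0.
Definition kind8 (al be ga de : R) : Prop := al = 0 /\ de = 0.
Definition kind12 (om al be ga de : R) : Prop := de = om * al.

Definition hol_kind (K : R -> R -> R -> R -> Prop) : Prop :=
  [\/ K = kind6, K = kind8 | exists2 om, om != 0 & K = kind12 om].

(** The common feature behind the orthogonality to [l]: a pure rotation [x ∧ y] would annihilate
    [n], and no type contains one. *)
Lemma hol_kind_de K al be ga de : hol_kind K -> K al be ga de -> al = 0 -> de = 0.
Proof.
by case=> [->|->|[om _ ->]]; [case|case|move=> -> ->; rewrite mulr0].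
Qed.

Section Tetrad.
Variables l n x y : pt.
Hypothesis tet : tetrad l n x y.

Lemma tetrad_dots : (((dot l n = 1) * (dot n l = 1) * (dot x x = 1) * (dot y y = 1))
  * ((dot l l = 0) * (dot n n = 0) * (dot x y = 0) * (dot y x = 0))
  * ((dot l x = 0) * (dot x l = 0) * (dot l y = 0) * (dot y l = 0))
  * ((dot n x = 0) * (dot x n = 0) * (dot n y = 0) * (dot y n = 0)))%type.
Proof.
case: tet => _ [ln xx yy] [ll nn xy] [lx ly] [nx ny].
by rewrite (dotC n l) (dotC y x) (dotC x l) (dotC y l) (dotC x n) (dotC y n).
Qed.

Lemma tetrad_expand v :
  v = dot n v *: l + dot l v *: n + dot x v *: x + dot y v *: y.
Proof.
case: tet => sp _ _ _ _; have [a [b [c [d ->]]]] := sp v.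
rewrite !dotDr !dotZr !tetrad_dots.
by congr (_ *: _ + _ *: _ + _ *: _ + _ *: _); ring.
Qed.

Lemma tetrad_eq0 v : dot l v = 0 -> dot n v = 0 -> dot x v = 0 -> dot y v = 0 -> v = 0.
Proof.
by move=> lv nv xv yv; rewrite (tetrad_expand v) lv nv xv yv !scale0r !addr0.
Qed.

Lemma tetrad_scalar (L : 'M[R]_4) k : L *m l = k *: l -> L *m n = k *: n ->
  L *m x = k *: x -> L *m y = k *: y -> L = k%:M.
Proof.
move=> Ll Ln Lx Ly; have E (v : pt) : L *m v = k *: v.
  rewrite (tetrad_expand v) !mulmxDr -!scalemxAr Ll Ln Lx Ly !scalerDr.
  by rewrite !scalerA ![k * _]mulrC.
apply/matrixP => a b; rewrite -mulmx_delta E mxZE !mxE eqxx andbT.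
by rewrite mulr_natr.
Qed.

Section NullBiv.
Variables al be ga de : R.
Local Notation A := (null_biv l n x y al be ga de *m h).

Lemma dot_l_biv v : dot l (A *m v) = - al * dot l v.
Proof.
by rewrite null_biv_app !(dotDr, dotZr, dotNr) !tetrad_dots; ring.
Qed.

Lemma dot_n_biv v : dot n (A *m v) = al * dot n v + be * dot x v + ga * dot y v.
Proof.
by rewrite null_biv_app !(dotDr, dotZr, dotNr) !tetrad_dots; ring.
Qed.

Lemma dot_x_biv v : dot x (A *m v) = - be * dot l v + de * dot y v.
Proof.
by rewrite null_biv_app !(dotDr, dotZr, dotNr) !tetrad_dots; ring.
Qed.

Lemma dot_y_biv v : dot y (A *m v) = - ga * dot l v - de * dot x v.
Proof.
by rewrite null_biv_app !(dotDr, dotZr, dotNr) !tetrad_dots; ring.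
Qed.

(** If [v] had a component along [n], the products of [A v] with [l], [x] and [y] would force the
    coefficients to vanish one after the other. *)
Lemma null_biv_kill v : (al = 0 -> de = 0) -> A != 0 -> A *m v = 0 -> dot l v = 0.
Proof.
move=> alde A0 Av; apply/eqP; apply: contraNT A0 => lv0.
have al0 : al = 0.
  have := dot_l_biv v; rewrite Av dot0r => /esym/eqP.
  by rewrite mulf_eq0 oppr_eq0 (negPf lv0) orbF => /eqP.
have de0 := alde al0.
have be0 : be = 0.
  have := dot_x_biv v; rewrite Av dot0r de0 mul0r addr0 => /esym/eqP.
  by rewrite mulf_eq0 oppr_eq0 (negPf lv0) orbF => /eqP.
have ga0 : ga = 0.
  have := dot_y_biv v; rewrite Av dot0r de0 mul0r subr0 => /esym/eqP.
  by rewrite mulf_eq0 oppr_eq0 (negPf lv0) orbF => /eqP.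
by rewrite /null_biv al0 de0 be0 ga0 !scale0r !addr0 mul0mx.
Qed.

(** Without rotation part the bivector is the blade [l ∧ w]. Commutation with the symmetric [s] says
    that [s h] times this blade is skew, and [blade_eigen] gives a common eigenvalue of [l] and
    [w]. *)
Lemma null_biv_commute (s : 'M[R]_4) : s^T = s -> de = 0 -> A != 0 ->
  A *m s + s *m A^T = 0 -> exists k : R,
  [/\ s *m h *m l = k *: l
    & s *m h *m (al *: n + be *: x + ga *: y)
      = k *: (al *: n + be *: x + ga *: y)].
Proof.
move=> ss de0 A0 Es; set w := al *: n + be *: x + ga *: y.
have Ew : null_biv l n x y al be ga de = bivector l w.
  rewrite /null_biv de0 scale0r addr0 /bivector /w !tr_addmx !tr_scalemx.
  rewrite !mulmxDr !mulmxDl -!scalemxAr -!scalemxAl.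
  by apply/matrixP => a b; rewrite !(mxDE, mxNE, mxZE); ring.
have sk : (s *m h *m bivector l w)^T = - (s *m h *m bivector l w).
  rewrite !trmx_mul ss hsym bivector_skew mulNmx; congr (- _).
  move: Es; rewrite Ew trmx_mul hsym bivector_skew mulmxN mulmxN.
  by move/eqP; rewrite subr_eq0 => /eqP; rewrite !mulmxA.
have wn : dot w n = 0 by rewrite /w !dotDl !dotZl !tetrad_dots; ring.
have [al0|al0] := eqVneq al 0; last first.
  have lb : dot l (al^-1 *: l) = 0 by rewrite dotZr !tetrad_dots mulr0.
  have wb : dot w (al^-1 *: l) = 1.
    by rewrite /w dotZr !dotDl !dotZl !tetrad_dots; field.
  have [k [kl kw]] := blade_eigen (tetrad_dots.1.1.1.1.1.1) wn lb wb sk.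
  by exists k.
have N0 : be ^+ 2 + ga ^+ 2 != 0.
  apply: contraNneq A0; move=> /eqP.
  rewrite paddr_eq0 ?sqr_ge0// !sqrf_eq0 => /andP[/eqP be0 /eqP ga0].
  by rewrite /null_biv al0 de0 be0 ga0 !scale0r !addr0 mul0mx.
(* Here [w] lies in the spacelike plane of [x] and [y], so [w] divided by its squared length is dual
   to it and orthogonal to [l]; when [al] is nonzero the dual vector is a multiple of [l]. *)
pose b := (be ^+ 2 + ga ^+ 2)^-1 *: (be *: x + ga *: y).
have lb : dot l b = 0.
  by rewrite /b !dotZr dotDr !dotZr !tetrad_dots; ring.
have wb : dot w b = 1.
  rewrite /b /w dotZr !dotDr !dotDl !dotZr !dotZl !tetrad_dots al0; field.
  by [].
have [k [kl kw]] := blade_eigen (tetrad_dots.1.1.1.1.1.1) wn lb wb sk.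
by exists k.
Qed.

End NullBiv.

Definition annihilates (K : R -> R -> R -> R -> Prop) (W : 'M[R]_4) : Prop :=
  W^T = - W /\ forall al be ga de, K al be ga de ->
    pairing W (null_biv l n x y al be ga de *m h) = 0.

Lemma annihilates_lx K : annihilates K (bivector l x).
Proof.
split=> [|al be ga de _]; first exact: bivector_skew.
by rewrite pairing_bivector dot_l_biv dot_x_biv !tetrad_dots; ring.
Qed.

Lemma annihilates_ly K : annihilates K (bivector l y).
Proof.
split=> [|al be ga de _]; first exact: bivector_skew.
by rewrite pairing_bivector dot_l_biv dot_y_biv !tetrad_dots; ring.
Qed.

(** The blades [l ∧ x] and [l ∧ y] say nothing about [n]; each type supplies one more bivector. For
    R12 the pairings of [l ∧ n] and [x ∧ y] with themselves have opposite signs, and the weight [om]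
    balances them. *)
Lemma annihilates_third K : hol_kind K ->
  [\/ annihilates K (bivector n y), annihilates K (bivector l n)
    | exists2 om, om != 0 & annihilates K (om *: bivector l n + bivector x y)].
Proof.
case=> [->|->|[om om0 ->]].
- apply: Or31; split=> [|al be ga de [-> ->]]; first exact: bivector_skew.
  by rewrite pairing_bivector dot_n_biv dot_y_biv !tetrad_dots; ring.
- apply: Or32; split=> [|al be ga de [-> ->]]; first exact: bivector_skew.
  by rewrite pairing_bivector dot_n_biv dot_l_biv !tetrad_dots; ring.
- apply: Or33; exists om => //; split=> [|al be ga de ->].
    by rewrite tr_addmx tr_scalemx !bivector_skew scalerN -opprD.
  rewrite pairingD pairingZ !pairing_bivector dot_n_biv dot_l_biv.
  by rewrite dot_x_biv dot_y_biv !tetrad_dots; ring.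
Qed.

Lemma tetrad_neq0 : (l != 0) * (y != 0).
Proof.
split; apply/eqP => e; have := oner_neq0 R.
  by rewrite -(tetrad_dots.1.1.1.1.1.2) e dot0r eqxx.
by have := tetrad_dots.1.1.1.2; rewrite e dot0r => <-; rewrite eqxx.
Qed.

Lemma annihilated_scalar K (L : 'M[R]_4) : hol_kind K ->
  (forall W, annihilates K W -> (L *m W)^T = - (L *m W)) -> exists k : R, L = k%:M.
Proof.
move=> hK HL; have tn := tetrad_neq0.
have [k [kl kx]] := blade_eigen (a := n) (b := x) (tetrad_dots.1.1.1.1.1.1)
  (tetrad_dots.2.1.1.2) (tetrad_dots.1.2.1.1.1) (tetrad_dots.1.1.1.1.2)
  (HL _ (annihilates_lx K)).
have [k1 [kl1 ky]] := blade_eigen (a := n) (b := y) (tetrad_dots.1.1.1.1.1.1)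
  (tetrad_dots.2.2) (tetrad_dots.1.2.1.2) (tetrad_dots.1.1.1.2)
  (HL _ (annihilates_ly K)).
have same (u : pt) (a b : R) : u != 0 -> L *m u = a *: u -> L *m u = b *: u -> a = b.
  move=> u0 -> /eqP; rewrite -subr_eq0 -scalerBl scaler_eq0 (negPf u0) orbF subr_eq0.
  by move/eqP.
have e1 := same l _ _ tn.1 kl kl1; rewrite -{}e1 in ky.
exists k; suff kn : L *m n = k *: n by exact: tetrad_scalar.
have ln_case : (L *m bivector l n)^T = - (L *m bivector l n) -> L *m n = k *: n.
  move=> Hln; have [k2 [kl2 kn]] := blade_eigen (a := n) (b := l)
    (tetrad_dots.1.1.1.1.1.1) (tetrad_dots.1.1.2.1.1.2)
    (tetrad_dots.1.1.2.1.1.1) (tetrad_dots.1.1.1.1.1.2) Hln.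
  by rewrite kn (same l _ _ tn.1 kl kl2).
case: (annihilates_third hK) => [/HL Hny|/HL|[om om0 /HL Hom]].
- have [k2 [kn ky2]] := blade_eigen (a := l) (b := y) (tetrad_dots.1.1.1.1.1.2)
    (tetrad_dots.1.2.2) (tetrad_dots.2.1.2) (tetrad_dots.1.1.1.2) Hny.
  by rewrite kn (same y _ _ tn.2 ky ky2).
- exact: ln_case.
(* On the plane of [x] and [y] the map [L] is already the scalar [k], so its product with [x ∧ y] is
   skew and can be subtracted. *)
- apply: ln_case; apply: (scalerI om0).
  have Lxy : L *m bivector x y = k *: bivector x y.
    by rewrite /bivector mulmxBr !mulmxA kx ky -!scalemxAl scalerBr.
  move: Hom; rewrite mulmxDr Lxy -scalemxAr tr_addmx !tr_scalemx bivector_skew.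
  move=> e; rewrite scalerN; apply: (addIr (k *: - bivector x y)); rewrite e.
  by rewrite scalerN opprD.
Qed.

Lemma annihilated_eq0 K (u : pt) : h \in unitmx -> hol_kind K ->
  (forall W, annihilates K W -> W *m u = 0) -> u = 0.
Proof.
move=> uh hK HW; pose v := invmx h *m u.
have uE : u = h *m v by rewrite mulKVmx.
have E W : annihilates K W -> W *m h *m v = 0 by move/HW; rewrite uE mulmxA.
suff v0 : v = 0 by rewrite uE v0 mulmx0.
have tn := tetrad_neq0.
have two p q a b : dot p a = 1 -> dot q a = 0 -> dot p b = 0 -> dot q b = 1 ->
    annihilates K (bivector p q) -> dot p v = 0 /\ dot q v = 0.
  by move=> pa qa pb qb /E; exact: bivector_kill pa qa pb qb.
have [lv xv] := two l x n x (tetrad_dots.1.1.1.1.1.1)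
  (tetrad_dots.2.1.1.2) (tetrad_dots.1.2.1.1.1) (tetrad_dots.1.1.1.1.2)
  (annihilates_lx K).
have [_ yv] := two l y n y (tetrad_dots.1.1.1.1.1.1)
  (tetrad_dots.2.2) (tetrad_dots.1.2.1.2) (tetrad_dots.1.1.1.2)
  (annihilates_ly K).
suff nv : dot n v = 0 by exact: tetrad_eq0.
case: (annihilates_third hK) => [||[om om0 /E]].
- by case/(two n y l y (tetrad_dots.1.1.1.1.1.2)
    (tetrad_dots.1.2.2) (tetrad_dots.2.1.2) (tetrad_dots.1.1.1.2)).
- by case/(two l n n l (tetrad_dots.1.1.1.1.1.1) (tetrad_dots.1.1.2.1.1.2)
    (tetrad_dots.1.1.2.1.1.1) (tetrad_dots.1.1.1.1.1.2)).
- rewrite 2!mulmxDl -!scalemxAl 2!bivector_app lv xv yv !scale0r !subr0 addr0.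
  move/eqP; rewrite !scaler_eq0 (negPf om0) (negPf tn.1) orbF => /eqP//.
Qed.

End Tetrad.
End TetradAlgebra.

Section TetradTransport.
Context {R : realType}.
Local Notation pt := ('cV[R]_4).
Variables (h h' T : 'M[R]_4).
Hypotheses (uT : T \in unitmx) (hT : T^T *m h' *m T = h).

Lemma dot_transport v w : Defs.inner h' (T *m v) (T *m w) = Defs.inner h v w.
Proof. by rewrite /Defs.inner -hT trmx_mul !mulmxA. Qed.

Lemma tetrad_transport l n x y : tetrad h l n x y ->
  tetrad h' (T *m l) (T *m n) (T *m x) (T *m y).
Proof.
case=> sp d1 d2 d3 d4; split; rewrite ?dot_transport// => v.
have [a [b [c [d e]]]] := sp (invmx T *m v); exists a, b, c, d.
by rewrite -(mulKVmx uT v) e !mulmxDr -!scalemxAr.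
Qed.

Lemma bivector_transport p q :
  bivector (T *m p) (T *m q) = T *m bivector p q *m T^T.
Proof. by rewrite /bivector !trmx_mul mulmxBr mulmxBl !mulmxA. Qed.

Lemma null_biv_transport l n x y al be ga de :
  T *m (null_biv l n x y al be ga de *m h) *m invmx T =
  null_biv (T *m l) (T *m n) (T *m x) (T *m y) al be ga de *m h'.
Proof.
have -> : null_biv (T *m l) (T *m n) (T *m x) (T *m y) al be ga de =
    T *m null_biv l n x y al be ga de *m T^T.
  rewrite /null_biv !bivector_transport.
  move: (bivector _ _) (bivector _ _) (bivector _ _) (bivector _ _) => X Y Z U.
  by rewrite !mulmxDr !mulmxDl -!scalemxAr -!scalemxAl.
by rewrite -hT !mulmxA mulmxK.
Qed.

End TetradTransport.

Section TetradSpan.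
Context {R : realType}.
Local Notation pt := ('cV[R]_4).

Lemma mem_span_cons (V : vectType R) (u v : V) (X : seq V) :
  v \in <<u :: X>>%VS -> exists a : R, exists2 w, w \in <<X>>%VS & v = a *: u + w.
Proof.
rewrite span_cons => /memv_addP[u' /vlineP[a ->] [w wX ->]].
by exists a, w.
Qed.

Lemma mem_span1 (V : vectType R) (u v : V) :
  v \in <<[:: u]>>%VS -> exists a : R, v = a *: u.
Proof. by rewrite span_seq1 => /vlineP. Qed.

Lemma null_tetradW (h : 'M[R]_4) l n x y : null_tetrad h l n x y -> tetrad h l n x y.
Proof.
case=> B d1 d2 d3 d4; split=> // v.
have : v \in <<[:: l; n; x; y]>>%VS by rewrite (span_basis B) memvf.
case/mem_span_cons=> a [_ /mem_span_cons[b [_ /mem_span_cons[c [_ /mem_span1[d ->] ->]] ->]] ->].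
by exists a, b, c, d; rewrite !addrA.
Qed.

Lemma span_kind6 (h : 'M[R]_4) l n x y A :
  A \in <<[:: Defs.wedge h l n; Defs.wedge h l x]>>%VS ->
  exists al be ga de, kind6 al be ga de /\ A = null_biv l n x y al be ga de *m h.
Proof.
case/mem_span_cons=> al [_ /mem_span1[be ->] ->].
exists al, be, 0, 0; split=> //.
by rewrite /null_biv !scale0r !addr0 mulmxDl -!scalemxAl.
Qed.

Lemma span_kind8 (h : 'M[R]_4) l n x y A :
  A \in <<[:: Defs.wedge h l x; Defs.wedge h l y]>>%VS ->
  exists al be ga de, kind8 al be ga de /\ A = null_biv l n x y al be ga de *m h.
Proof.
case/mem_span_cons=> be [_ /mem_span1[ga ->] ->].
exists 0, be, ga, 0; split=> //.
by rewrite /null_biv !scale0r add0r addr0 mulmxDl -!scalemxAl.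
Qed.

Lemma span_kind12 (h : 'M[R]_4) l n x y om A :
  A \in <<[:: Defs.wedge h l x; Defs.wedge h l y;
              (Defs.wedge h l n + om *: Defs.wedge h x y)%R]>>%VS ->
  exists al be ga de, kind12 om al be ga de /\ A = null_biv l n x y al be ga de *m h.
Proof.
case/mem_span_cons=> be [_ /mem_span_cons[ga [_ /mem_span1[al ->] ->]] ->].
exists al, be, ga, (om * al); split=> //.
rewrite /null_biv !wedgeE.
move: (bivector _ _) (bivector _ _) (bivector _ _) (bivector _ _) => X Y Z U.
rewrite !mulmxDl -!scalemxAl scalerDr scalerA (mulrC al).
move: (_ *m h) (_ *m h) (_ *m h) (_ *m h) => X' Y' Z' U'.
by apply/matrixP => a b; rewrite !(mxDE, mxZE); ring.
Qed.

End TetradSpan.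

(** * The vector field [Lam] *)

Section CurvaturePairing.
Context {R : realType} (M : manifold4 R) (g : lorentz_metric M).
Local Notation pt := ('cV[R]_4).
Implicit Types j : mindex M.

(** The four cyclic identities that begin with each of the indices, combined through the two skew
    symmetries, form a linear system that yields the exchange of pairs. *)
Lemma pair_symmetry (I : Type) (r : I -> I -> I -> I -> R) :
  (forall a b c d, r a b c d = - r b a c d) ->
  (forall a b c d, r a b c d = - r a b d c) ->
  (forall a b c d, r a b c d + r a c d b + r a d b c = 0) ->
  forall a b c d, r a b c d = r c d a b.
Proof.
move=> s1 s2 bi a b c d.
have := bi a b c d; have := bi b c d a; have := bi c d a b; have := bi d a b c.
have := s1 b c d a; have := s2 c b d a; have := s1 c d a b; have := s2 c d a b.
have := s1 d a b c; have := s2 d a b c; have := s1 a c d b; have := s2 a c d b.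
have := s1 b d a c; have := s2 b d a c; have := s2 a b c d; have := s1 b a c d.
have := s2 b a c d; have := s1 a b c d; have := s1 d b c a; have := s2 b d c a.
have := s1 c a b d; have := s2 a c b d; have := s2 c a b d; have := s1 a d b c.
have := s2 a d b c; have := s1 b c a d; have := s2 d a c b; have := s1 d c b a.
have := s2 c d b a; have := s1 b a d c; have := s1 d b a c; have := s2 d b a c.
lra.
Qed.

(** Pair symmetry moves the contraction with [W] from the form indices of the curvature to its
    endomorphism indices, where orthogonality to the holonomy algebra is available. *)
Lemma Rcontr_eq0 j (z : pt) (W : 'M[R]_4) : mrange j z ->
  (forall c d, (g j z *m Riem g j c d z)^T = - (g j z *m Riem g j c d z)) ->
  (forall a b, pairing (g j z) W (Riem g j a b z) = 0) -> Rcontr g j z W = 0.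
Proof.
move=> jz sk W0; have uh := metric_unit g jz.
suff : g j z *m Rcontr g j z W = 0 by move/(congr1 (mulmx (invmx (g j z)))); rewrite mulKmx // mulmx0.
pose r a b c d := (g j z *m Riem g j c d z) a b.
have ps : forall a b c d, r a b c d = r c d a b.
  apply: pair_symmetry => a b c d.
  - by have /matrixP/(_ b a) := sk c d; rewrite mxNE [LHS]mxE.
  - by rewrite /r Riem_anti mulmxN mxNE.
  - rewrite /r !mxME -!big_split /=; apply: big1 => e _.
    by rewrite -!mulrDr Riem_bianchi // mulr0.
apply/matrixP => a b; rewrite [RHS]mxE -(W0 a b) /Rcontr /pairing.
rewrite mulmx_sumr summxE; apply: eq_bigr => c _.
rewrite mulmx_sumr summxE; apply: eq_bigr => d _.
by rewrite -scalemxAr mxZE; congr (_ * _); exact: ps.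
Qed.

End CurvaturePairing.

Section ParallelDerivative.
Context {R : realType} (M : manifold4 R) (g g' : lorentz_metric M).
Hypothesis pr : projectively_related g g'.
Local Notation pt := ('cV[R]_4).
Local Notation e_ b := (@delta_mx R 4 1 b 0).
Implicit Types i j : mindex M.
Local Notation Lam_ := (Lam g g').
Local Notation sigma_ := (sigma g g').

(** As [E^T g E] is constant, [E^T g] is the inverse frame up to a constant matrix, with no
    inversion to differentiate. Multiplying a vector field by it turns its covariant derivative into
    an ordinary one. *)
Lemma coframe_derive j (x : R -> pt) (E : R -> 'M[R]_4) (t : R) x' :
  mrange j (x t) -> is_derive t 1 x x' ->
  is_derive t 1 E (- (GamV g j x' (x t) *m E t)) ->
  is_derive t 1 (fun s => (E s)^T *m g j (x s)) ((E t)^T *m g j (x t) *m GamV g j x' (x t)).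
Proof.
move=> jx dx dE.
have dg := Ckmx_chain (@mrange_open' _ M j) (metric_Ck g j 1) jx dx.
have H := is_derive_mulmx (is_derive_trmx dE) dg.
apply: is_derive_eq H _; rewrite (metric_compatV g _ jx) tr_oppmx trmx_mul.
rewrite mulmxDr mulNmx !mulmxA.
move: (_ *m _ *m _) (_ *m _ *m _) => P Q.
by apply/matrixP => a b; rewrite !(mxDE, mxNE); ring.
Qed.

Lemma nabLamV j (v z : pt) :
  \sum_b v b 0 *: dmx b (Lam_ j) z = nabLam g g' j z *m v - GamV g j v z *m Lam_ j z.
Proof.
have -> : nabLam g g' j z *m v = \sum_b v b 0 *: (nabLam g g' j z *m e_ b).
  rewrite [in LHS](matrix_sum_delta v) linear_sum /=; apply: eq_bigr => b _.
  by rewrite big_ord1 -scalemxAr.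
rewrite /GamV mulmx_suml -sumrB; apply: eq_bigr => b _.
by rewrite nabLam_delta -scalemxAl -scalerBr addrK.
Qed.

Lemma sigmaV j (v z : pt) : mrange j z ->
  \sum_b v b 0 *: dmx b (sigma_ j) z =
  - (GamV g j v z *m sigma_ j z) - sigma_ j z *m (GamV g j v z)^T
  + v *m (Lam_ j z)^T + Lam_ j z *m v^T.
Proof.
move=> jz; have vE : v = \sum_b v b 0 *: e_ b.
  rewrite [LHS](matrix_sum_delta v); apply: eq_bigr => b _.
  by rewrite big_ord1.
have -> : v *m (Lam_ j z)^T = \sum_b v b 0 *: (e_ b *m (Lam_ j z)^T).
  by rewrite [in LHS]vE mulmx_suml; apply: eq_bigr => b _; rewrite -scalemxAl.
have -> : Lam_ j z *m v^T = \sum_b v b 0 *: (Lam_ j z *m (e_ b)^T).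
  rewrite [in LHS]vE linear_sum /= linear_sum /=; apply: eq_bigr => b _.
  by rewrite tr_scalemx -scalemxAr.
rewrite /GamV mulmx_suml linear_sum /= linear_sum /=.
rewrite mulmx_sumr -sumrN -!big_split /=; apply: eq_bigr => b _.
rewrite (sigma_derive pr) //; move: (sigma_ j z) => S.
rewrite tr_scalemx -scalemxAl -scalemxAr.
by rewrite -!scalerN -!scalerDr.
Qed.

Lemma Lam_parallel_derive j (x : R -> pt) (E : R -> 'M[R]_4) (t : R) x' :
  mrange j (x t) -> is_derive t 1 x x' ->
  is_derive t 1 E (- (GamV g j x' (x t) *m E t)) ->
  is_derive t 1 (fun s => (E s)^T *m g j (x s) *m Lam_ j (x s))
    ((E t)^T *m g j (x t) *m (nabLam g g' j (x t) *m x')).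
Proof.
move=> jx dx dE.
have dP := coframe_derive jx dx dE.
have dL := Ckmx_chain (@mrange_open' _ M j) (@Lam_Ck _ M g g' j 1) jx dx.
have H := is_derive_mulmx dP dL.
apply: is_derive_eq H _; rewrite nabLamV mulmxBr !mulmxA.
by rewrite addrC subrK.
Qed.

Lemma sigma_parallel_derive j (x : R -> pt) (E : R -> 'M[R]_4) (t : R) x' :
  mrange j (x t) -> is_derive t 1 x x' ->
  is_derive t 1 E (- (GamV g j x' (x t) *m E t)) ->
  is_derive t 1
    (fun s => (E s)^T *m g j (x s) *m sigma_ j (x s) *m ((E s)^T *m g j (x s))^T)
    ((E t)^T *m g j (x t) *m (x' *m (Lam_ j (x t))^T + Lam_ j (x t) *m x'^T)
     *m ((E t)^T *m g j (x t))^T).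
Proof.
move=> jx dx dE.
have dP := coframe_derive jx dx dE.
have dS := Ckmx_chain (@mrange_open' _ M j) (@sigma_Ck _ M g g' j 1) jx dx.
have H := is_derive_mulmx (is_derive_mulmx dP dS) (is_derive_trmx dP).
apply: is_derive_eq H _; rewrite sigmaV //.
move: ((E t)^T *m g j (x t)) (GamV _ _ _ _) (Lam_ _ _) (sigma_ _ _) => P G L S.
rewrite trmx_mul !(mulmxDl, mulmxDr, mulmxN, mulNmx) !mulmxA.
move: (P *m G *m S *m _) (P *m S *m _ *m _) (P *m x' *m _ *m _)
  (P *m L *m _ *m _) => A B C D.
by apply/matrixP => a b; rewrite !(mxDE, mxNE); ring.
Qed.

(** [sigma] with both indices lowered. The transposed metric, equal to the metric on the range of
    the chart, lets [sigma_form_derive] compare functions at all parameters, including those that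
    leave the range. *)
Definition sigma_form j (z u v : pt) : R :=
  Defs.inner (g j z) u (sigma_ j z *m (g j z)^T *m v).

Lemma sigma_form_derive j (x : R -> pt) (E : R -> 'M[R]_4) (t : R) x' (u v : pt) :
  mrange j (x t) -> is_derive t 1 x x' ->
  is_derive t 1 E (- (GamV g j x' (x t) *m E t)) ->
  is_derive t 1 (fun s => sigma_form j (x s) (E s *m u) (E s *m v))
    (Defs.inner (g j (x t)) (E t *m u) x'
       * Defs.inner (g j (x t)) (Lam_ j (x t)) (E t *m v)
     + Defs.inner (g j (x t)) (E t *m u) (Lam_ j (x t))
       * Defs.inner (g j (x t)) x' (E t *m v)).
Proof.
move=> jx dx dE; have dS := sigma_parallel_derive jx dx dE.
have H := is_derive_mulmx (is_derive_mulmx (is_derive_cst u^T t 1) dS)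
  (is_derive_cst v t 1).
rewrite mul0mx add0r mulmx0 addr0 in H.
have /is_derive_mxP/(_ 0 0) := H; congr is_derive.
  apply/funext => s; rewrite /sigma_form /Defs.inner !trmx_mul !mulmxA.
  by rewrite trmxK.
have gs := gcomp_sym g jx.
have app (a b : pt) : u^T *m ((E t)^T *m g j (x t) *m (a *m b^T)
    *m ((E t)^T *m g j (x t))^T) *m v =
    (Defs.inner (g j (x t)) (E t *m u) a * Defs.inner (g j (x t)) b (E t *m v))%:M.
  rewrite !trmx_mul trmxK gs !mulmxA -trmx_mul dotE mul_scalar_mx -!scalemxAl.
  by rewrite -(mulmxA _ (E t)) dotE scale_scalar_mx.
rewrite mulmxDr mulmxDl mulmxDr mulmxDl !app mxDE.
by rewrite [X in X + _]mxE [X in _ + X]mxE !mulr1n.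
Qed.

Lemma Lam_transport : (forall j z, mrange j z -> nabLam g g' j z = 0) ->
  forall i p j q T, transport g i p j q T -> Lam_ j (mto M j q) = T *m Lam_ i (mto M i p).
Proof.
move=> N0 i p j q T; elim=> {i p j q T} [i x E sx rx [E0 dE]|i j p ip jp|i j k p q r S T _ HS _ HT].
- have r0 : mrange i (x 0) by apply: rx; rewrite lexx ler01.
  have r1 : mrange i (x 1) by apply: rx; rewrite lexx ler01.
  rewrite !mfromK //.
  have dx (t : R) : is_derive t 1 x (derive1 x t).
    by have := sx 0%N t I; rewrite derive1n0 => d; split; rewrite ?derive1E.
  have dE' (t : R) : 0 <= t <= 1 -> is_derive t 1 E (- (GamV g i (derive1 x t) (x t) *m E t)).
    by move=> t01; have := dE t t01; rewrite GamVE.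
  have H1 : forall t : R, 0 <= t <= 1 ->
      is_derive t 1 (fun s => (E s)^T *m g i (x s) *m Lam_ i (x s)) 0.
    move=> t t01; have := Lam_parallel_derive (rx t t01) (dx t) (dE' t t01).
    by rewrite N0 ?mul0mx ?mulmx0; last exact: rx.
  have H2 : forall t : R, 0 <= t <= 1 ->
      is_derive t 1 (fun s => (E s)^T *m g i (x s) *m E s) 0.
    by move=> t t01; apply: frame_isometry (rx t t01) (dx t) (dE' t t01).
  have := derive0_cst_mx H2 (t := 1); rewrite lexx ler01 => /(_ isT).
  have := derive0_cst_mx H1 (t := 1); rewrite lexx ler01 => /(_ isT).
  rewrite E0 trmx1 !mul1mx mulmx1 => e1 e2.
  have uP : (E 1)^T *m g i (x 1) \in unitmx.
    by have := metric_unit g r0; rewrite -e2 unitmx_mul => /andP[].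
  apply: (can_inj (mulKmx uP)); rewrite e1 mulmxA.
  by rewrite e2.
- by have := Lam_trans pr (i := i) (j := j) (x := mto M i p); rewrite /trans /= mtoK //; apply; apply/overlapP; split; [exact: mrange_to|rewrite mtoK].
- by rewrite HT HS mulmxA.
Qed.

(* A curve in a group fixing Lambda has velocity annihilating Lambda. *)
Lemma lie_algebra_Lam i p A : (forall j z, mrange j z -> nabLam g g' j z = 0) ->
  lie_algebra (holonomy_group g i p) A -> A *m Lam_ i (mto M i p) = 0.
Proof.
move=> N0 [f [f0 Gf df _ <-]]; set v := Lam_ i (mto M i p).
have fv (t : R) : f t *m v = v by rewrite -(Lam_transport N0 (Gf t)).
have d0 : is_derive (0 : R) 1 f (derive1 f 0).
  by have := df 0 => d; split; rewrite ?derive1E.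
have H := is_derive_mulmx d0 (is_derive_cst v (0 : R) 1).
rewrite mulmx0 addr0 in H.
exact: (@is_derive_right_cst _ _ (fun t => f t *m v) 0 1 _ v ltr01 (fun t _ => fv t) H).
Qed.

Lemma line_frame_near j (z v : pt) (O : set pt) : mrange j z -> open O -> O z ->
  exists2 s : R, 0 < s & exists2 E, line_frame g j z (s *: v) E &
    forall t : R, `|t| <= 1 -> O (z + t *: (s *: v)).
Proof.
move=> jz oO Oz; have oj := @mrange_open' _ M j.
have [r [K [r0 K0 rW GK _]]] := Ckmx_loc_lipschitz oj (fun c => @Gam_Ck _ M g j 1 c) jz.
have [rO rO0 HO] := open_mx_ball oO Oz.
have K1 : 0 < 64 * K + 1 by rewrite ltr_wpDl // mulr_ge0.
pose e := Num.min (Num.min (r / 2) (rO / 2)) (64 * K + 1)^-1.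
have e0 : 0 < e by rewrite !lt_min !divr_gt0 // invr_gt0.
have v1 : 0 < `|v| + 1 by rewrite ltr_wpDl.
pose s := e / (`|v| + 1); have s0 : 0 < s by exact: divr_gt0.
have wn : `|s *: v| <= e.
  rewrite normrZ gtr0_norm // /s mulrAC ler_pdivrMr // ler_pM2l //.
  by rewrite lerDl.
have wr : `|s *: v| <= r / 2 by rewrite (le_trans wn) // !ge_min lexx.
have wO : `|s *: v| <= rO / 2 by rewrite (le_trans wn) // !ge_min lexx orbT.
have wK : 64 * (`|s *: v| * K) <= 1.
  have h : `|s *: v| <= (64 * K + 1)^-1 by rewrite (le_trans wn) // !ge_min lexx orbT.
  rewrite -[leRHS]mul1r ler_pdivlMr // in h.
  have := normr_ge0 (s *: v); lra.
exists s => //.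
have [|E HE] := @line_frame_exists _ M g j z z (s *: v) r K K0 rW GK _ wr wK.
  by rewrite subrr normr0 divr_ge0 // ltW.
exists E => // t t1; apply: HO; rewrite addrC addKr normrZ.
have : `|t| * `|s *: v| <= 1 * (rO / 2) by rewrite ler_pM.
lra.
Qed.

End ParallelDerivative.

Section RealFunctions.
Context {R : realType}.

Lemma near_neq0 (T : topologicalType) (f : T -> R) t :
  {for t, continuous f} -> f t != 0 -> \forall s \near t, f s != 0.
Proof.
move=> cf ft; apply: (cf [set u | u != 0]).
by apply: open_nbhs_nbhs; split=> //; exact: open_neq.
Qed.

Lemma near_mx_neq0 (T : topologicalType) m k (f : T -> 'M[R]_(m, k)) t :
  {for t, continuous f} -> f t != 0 -> \forall s \near t, f s != 0.
Proof.
move=> cf ft.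
have [a [b ab]] : exists a b, f t a b != 0.
  apply: contrapT => H; case/eqP: ft; apply/matrixP => a b.
  rewrite mxE; apply/eqP; apply: contrapT => /negP ab; apply: H.
  by exists a, b.
have := near_neq0 (continuous_entry (i := a) (j := b) cf) ab.
by apply: filterS => s; apply: contraNneq => ->; rewrite mxE.
Qed.

(** The equation says that [f] is an eigenvalue of the constant symmetric matrix with rows [(a, b)]
    and [(b, c)]. If [d] were nonzero, differentiation would make the eigenvalue at 0 a double root;
    then [b = 0] and [a = c], and [f] is constant after all. *)
Lemma quadratic_level (f : R -> R) (a b c d : R) :
  (forall t : R, 0 <= t <= 1 -> (a - f t) * (c - f t) = b ^+ 2) ->
  is_derive (0 : R) 1 f d -> d = 0.
Proof.
move=> fq df; apply/eqP; apply: contrapT => /negP d0.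
have z01 : 0 <= (0 : R) <= 1 by rewrite lexx ler01.
have sq0 : (a - f 0) + (c - f 0) = 0.
  have da := is_deriveB (is_derive_cst a (0 : R) 1) df.
  have dc := is_deriveB (is_derive_cst c (0 : R) 1) df.
  have := is_derive_right_cst ltr01 fq (is_derive_mul da dc).
  rewrite -[(cst c - f) 0]/(c - f 0) -[(cst a - f) 0]/(a - f 0) !sub0r => e; apply/eqP.
  have : d * ((a - f 0) + (c - f 0)) == 0 by apply/eqP; lra.
  by rewrite mulf_eq0 (negPf d0).
have q0 := fq 0 z01; have cE : c - f 0 = - (a - f 0) by lra.
rewrite cE mulrN -expr2 in q0.
have := sqr_ge0 b; have := sqr_ge0 (a - f 0) => a2 b2.
have /eqP : (a - f 0) ^+ 2 = 0 by lra.
have b0 : b ^+ 2 = 0 by lra.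
rewrite sqrf_eq0 => /eqP a0; rewrite a0 oppr0 in cE.
have fc (t : R) : 0 <= t <= 1 -> f t = a.
  move=> /fq; rewrite b0 (_ : c = a); last by lra.
  by rewrite -expr2 => /eqP; rewrite sqrf_eq0 subr_eq0 => /eqP.
by case/eqP: d0; exact: is_derive_right_cst ltr01 fc df.
Qed.

Lemma derive0_cst (f : R -> R) (a b : R) :
  (forall t : R, a <= t <= b -> is_derive t 1 f 0) -> forall t : R, a <= t <= b -> f t = f a.
Proof.
move=> df t tab; have := @derive0_cst_mx R 1 1 (fun t => const_mx (f t)) a b _ t tab.
have H (s : R) : a <= s <= b -> is_derive s 1 (fun t => const_mx (f t) : 'M[R]_1) 0.
  move=> sab; apply/is_derive_mxP => i k; rewrite mxE.
  have := df s sab; congr is_derive.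
  by apply/funext => r; rewrite mxE.
by move=> /(_ H)/matrixP/(_ 0 0); rewrite !mxE.
Qed.

End RealFunctions.

(** * Constraints on [Lam] from the holonomy type *)

Section HolonomyReduction.
Context {R : realType} (M : manifold4 R) (g g' : lorentz_metric M).
Hypothesis pr : projectively_related g g'.
Local Notation pt := ('cV[R]_4).
Implicit Types j : mindex M.
Variables (i0 : mindex M) (p0 : M) (l n x y : pt) (K : R -> R -> R -> R -> Prop).
Hypothesis dom0 : mdom M i0 p0.
Hypothesis tet0 : tetrad (g i0 (mto M i0 p0)) l n x y.
Hypothesis hK : hol_kind K.
Hypothesis HR : forall j q T, transport g i0 p0 j q T -> forall c d,
  exists al be ga de, K al be ga de /\ Riem g j c d (mto M j q) =
    null_biv (T *m l) (T *m n) (T *m x) (T *m y) al be ga de *m g j (mto M j q).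

Local Notation Lam_ := (Lam g g').
Local Notation sigma_ := (sigma g g').
Local Notation dot j z := (Defs.inner (g j z)).

Lemma tetrad_at j q T : transport g i0 p0 j q T ->
  tetrad (g j (mto M j q)) (T *m l) (T *m n) (T *m x) (T *m y).
Proof.
move=> HT; have [_ _ iso] := transport_isometry HT.
exact: tetrad_transport (transport_unit HT) iso _ _ _ _ tet0.
Qed.

Lemma Rcontr_annihilated j q T W : transport g i0 p0 j q T ->
  annihilates (g j (mto M j q)) (T *m l) (T *m n) (T *m x) (T *m y) K W ->
  Rcontr g j (mto M j q) W = 0.
Proof.
move=> HT [_ HW]; have [_ jq _] := transport_isometry HT.
have jz := mrange_to jq; apply: Rcontr_eq0 => // [c d|a b].
  have [al [be [ga [de [_ ->]]]]] := HR HT c d.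
  by rewrite !trmx_mul (gcomp_sym g jz) null_biv_skew mulmxN mulNmx mulmxA.
by have [al [be [ga [de [Kab ->]]]]] := HR HT a b; exact: HW.
Qed.

Lemma reach j z : mrange j z -> exists T, transport g i0 p0 j (mfrom M j z) T.
Proof. by move=> jz; apply: transport_exists => //; exact: mrange_dom. Qed.

(** The matrix will turn out to be scalar; reading the factor off a fixed entry makes it C^1
    beforehand, which [ricci_Lam] requires. *)
Definition kap j z : R := nabLam g g' j z 0 0.

Lemma nabLam_kap j z : mrange j z -> nabLam g g' j z = (kap j z)%:M.
Proof.
move=> jz; have [T HT] := reach jz.
have [k] : exists k : R, nabLam g g' j z = k%:M.
  have := tetrad_at HT; rewrite mfromK // => tet.
  apply: (annihilated_scalar (gcomp_sym g jz) tet hK) => W HW.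
  have [skW _] := HW; apply: (ricci_kernel pr) => //.
  by have := @Rcontr_annihilated _ _ _ W HT; rewrite mfromK //; apply.
by rewrite /kap => ->; rewrite [in RHS]mxE eqxx mulr1n.
Qed.

Lemma kap_Ck j : Ck 1 (mrange j) (kap j).
Proof.
have oj := @mrange_open' _ M j.
apply: (@Ck_ext _ 1 _ (fun z => dmx 0 (Lam_ j) z 0 0 + (Gam g j 0 z *m Lam_ j z) 0 0)) => //.
  by move=> z _; rewrite /kap [RHS]mxE mxDE.
apply: CkD => //; first by apply: Ckmx_dmx => //; exact: Lam_Ck.
by apply: CkmxM => //; [exact: Gam_Ck|exact: Lam_Ck].
Qed.

Lemma kap_partial j z c : mrange j z -> partial c (kap j) z = 0.
Proof.
move=> jz; have [T HT] := reach jz.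
suff e : \col_c partial c (kap j) z = 0.
  by have /matrixP/(_ c 0) := e; rewrite !mxE.
have := tetrad_at HT; rewrite mfromK // => tet.
apply: (annihilated_eq0 (gcomp_sym g jz) tet (metric_unit g jz) hK) => W HW.
have [skW _] := HW.
apply: (ricci_Lam_kernel (kap_Ck j) (@nabLam_kap j) jz) => //.
by have := @Rcontr_annihilated _ _ _ W HT; rewrite mfromK //; apply.
Qed.

Lemma Riem_Lam j z c d : mrange j z -> Riem g j c d z *m Lam_ j z = 0.
Proof.
move=> jz; rewrite (ricci_Lam c d (kap_Ck j) (@nabLam_kap j) jz).
by rewrite !kap_partial // !scale0r subr0.
Qed.

Definition curved (q : M) : Prop :=
  exists i c d, mdom M i q /\ Riem g i c d (mto M i q) != 0.

Lemma curved_near q : curved q -> \forall q' \near q, curved q'.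
Proof.
move=> [i [c [d [iq Rq]]]].
have cR := Ckmx_continuous (@Riem_Ck _ M g i 1 c d) (mrange_to iq).
have H1 : \forall q' \near q, mdom M i q'.
  by apply: open_nbhs_nbhs; split => //; exact: mdom_open.
have H2 : \forall q' \near q, Riem g i c d (mto M i q') != 0.
  exact: (mto_cvg iq (near_mx_neq0 cR Rq)).
apply: filterS2 H1 H2 => q' i' R'.
by exists i, c, d.
Qed.

Lemma curved_dense : non_flat g -> forall U : set M, open U -> U !=set0 ->
  exists2 q, U q & curved q.
Proof.
move=> nf U oU U0; have [q [i [a [b [c [d [Uq iq r0]]]]]]] := nf U oU U0.
exists q => //; exists i, c, d; split => //.
by apply: contraNneq r0 => e; rewrite -RiemEntry e mxE.
Qed.

Lemma dot_l_Lam j q T : transport g i0 p0 j q T -> curved q ->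
  dot j (mto M j q) (T *m l) (Lam_ j (mto M j q)) = 0.
Proof.
move=> HT [i [c [d [iq Rq]]]]; have [_ jq _] := transport_isometry HT.
(* The curvature is known to be nonzero in the chart [i] only. The change of chart is itself a
   transport and an isometry, so the product can be computed there. *)
have Hc := transport_chart g jq iq; have HTi := transport_comp HT Hc.
have [_ _ iso] := transport_isometry Hc.
have ov : overlap j i (mto M j q) by apply/overlapP; split; [exact: mrange_to|rewrite mtoK].
have LE : Lam_ i (mto M i q) = jac j i (mto M j q) *m Lam_ j (mto M j q).
  by have := Lam_trans pr ov; rewrite /trans /= mtoK.
rewrite -(dot_transport iso) mulmxA -LE.
have iz := mrange_to iq; have [al [be [ga [de [Kab E]]]]] := HR HTi c d.
apply: (null_biv_kill (be := be) (ga := ga) (gcomp_sym g iz) (tetrad_at HTi) (hol_kind_de hK Kab)).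
  by rewrite -E.
by rewrite -E; exact: Riem_Lam.
Qed.

Lemma kap_curved j q : mdom M j q -> curved q -> kap j (mto M j q) = 0.
Proof.
move=> jq cq; have jz := mrange_to jq; set z := mto M j q in jz *.
have [T HT] := transport_exists g dom0 jq.
pose O := interior [set z' | curved (mfrom M j z')].
have Oz : O z.
  have cz : \forall q' \near mfrom M j z, curved q' by rewrite mtoK //; exact: curved_near.
  exact: (mfrom_cvg jz cz).
have [s s0 [E HE OE]] := line_frame_near g (T *m n) jz (@open_interior _ _) Oz.
have ld (t : R) := line_derive z (s *: (T *m n)) t.
have [E0 dE] := HE.
have n0 : `|0 : R| <= 1 by rewrite normr0 ler01.
have [jz0 dE0] := dE 0 n0.
have dL := Lam_parallel_derive g' (x := fun t : R => z + t *: (s *: (T *m n))) jz0 (ld 0) dE0.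
have H := is_derive_mulmx (is_derive_cst (T *m l)^T (0 : R) 1) dL.
have F0 (t : R) : 0 <= t <= 1 -> (T *m l)^T *m ((E t)^T *m g j (z + t *: (s *: (T *m n)))
    *m Lam_ j (z + t *: (s *: (T *m n)))) = 0.
  move=> /andP[t0 t1]; have t1' : `|t| <= 1 by rewrite ger0_norm.
  have [jt _] := dE t t1'; have := line_transport HE t1'; rewrite mtoK // => HEt.
  have := dot_l_Lam (transport_comp HT HEt) (interior_subset (OE t t1')).
  rewrite mfromK // => d0; rewrite !mulmxA -trmx_mul !mulmxA dotE d0.
  by rewrite raddf0.
(* Since [l] and [n] have product 1, the derivative of the vanishing function is [s] times
   [kap j z]. *)
have := is_derive_right_cst ltr01 F0 H.
rewrite mul0mx add0r scale0r addr0 E0 trmx1 mul1mx nabLam_kap // mul_scalar_mx.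
rewrite scalerA -scalemxAr -scalemxAr mulmxA dotE.
have -> : dot j z (T *m l) (T *m n) = 1.
  by have [_ [-> _ _] _ _ _] := tetrad_at HT.
move/matrixP/(_ 0 0); rewrite mxZE !mxE eqxx mulr1n mulr1 => /eqP.
by rewrite mulf_eq0 (gt_eqF s0) orbF => /eqP.
Qed.

Lemma kap_eq0 : non_flat g -> forall j z, mrange j z -> kap j z = 0.
Proof.
move=> nf j z jz; apply/eqP; apply: contrapT => /negP k0.
pose q := mfrom M j z; have jq : mdom M j q by exact: mrange_dom.
have ck := Ck_continuous (kap_Ck j) jz.
have H1 : \forall q' \near q, mdom M j q'.
  by apply: open_nbhs_nbhs; split => //; exact: mdom_open.
have H2 : \forall q' \near q, kap j (mto M j q') != 0.
  have kz : \forall z' \near mto M j q, kap j z' != 0 by rewrite mfromK //; exact: near_neq0.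
  exact: (mto_cvg jq kz).
have [|q' /interior_subset[jq' kq'] cq'] :=
    curved_dense nf (@open_interior _ [set q' | mdom M j q' /\ kap j (mto M j q') != 0]).
  by exists q; apply: filterS2 H1 H2.
by case/eqP: kq'; exact: kap_curved.
Qed.

Lemma nabLam_eq0 : non_flat g -> forall j z, mrange j z -> nabLam g g' j z = 0.
Proof.
by move=> nf j z jz; rewrite nabLam_kap // kap_eq0 // raddf0.
Qed.

Lemma sigma_formE j z u v : mrange j z ->
  sigma_form g g' j z u v = dot j z u (sigma_ j z *m g j z *m v).
Proof. by move=> jz; rewrite /sigma_form (gcomp_sym g jz). Qed.

Lemma sigma_form_eigen j z u v k : mrange j z ->
  sigma_ j z *m g j z *m u = k *: u -> sigma_form g g' j z u v = k * dot j z u v.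
Proof.
move=> jz e; rewrite sigma_formE // -(dotZl (gcomp_sym g jz)) -e.
rewrite /Defs.inner !trmx_mul (gcomp_sym g jz) (sigma_sym g g' jz).
by rewrite !mulmxA.
Qed.

Definition Lam0 : pt := Lam_ i0 (mto M i0 p0).

(** The common data for R6 and R8: a segment in the direction of the transported [n], along which
    the curvature stays nonzero. The coefficients and the eigenvalue are produced separately for
    each [t], with no continuity claimed. *)
Lemma curved_line : non_flat g ->
  (forall al be ga de, K al be ga de -> de = 0) ->
  exists (j : mindex M) (z w : pt) (s : R) (A : R -> 'M[R]_4),
  [/\ 0 < s, w = s *: (A 0 *m n) & forall t : R, `|t| <= 1 ->
   [/\ mrange j (z + t *: w),
       tetrad (g j (z + t *: w)) (A t *m l) (A t *m n) (A t *m x) (A t *m y),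
       Lam_ j (z + t *: w) = A t *m Lam0,
       forall u v, is_derive t 1
         (fun r => sigma_form g g' j (z + r *: w) (A r *m u) (A r *m v))
         (dot j (z + t *: w) (A t *m u) w
            * dot j (z + t *: w) (Lam_ j (z + t *: w)) (A t *m v)
          + dot j (z + t *: w) (A t *m u) (Lam_ j (z + t *: w))
            * dot j (z + t *: w) w (A t *m v))
     & exists k al be ga : R,
       [/\ K al be ga 0, [|| al != 0, be != 0 | ga != 0],
         sigma_ j (z + t *: w) *m g j (z + t *: w) *m (A t *m l) = k *: (A t *m l)
       & sigma_ j (z + t *: w) *m g j (z + t *: w)
           *m (al *: (A t *m n) + be *: (A t *m x) + ga *: (A t *m y))
         = k *: (al *: (A t *m n) + be *: (A t *m x) + ga *: (A t *m y))]]].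
Proof.
move=> nf Kde; have N0 := nabLam_eq0 nf.
have [|q _ [j [c [d [jq Rq]]]]] := curved_dense nf (@openT M); first by exists p0.
have jz := mrange_to jq; set z := mto M j q in jz Rq.
have [T HT] := transport_exists g dom0 jq.
have cR := Ckmx_continuous (@Riem_Ck _ M g j 1 c d) jz.
have [s s0 [E HE OE]] := line_frame_near g (T *m n) jz (@open_interior _ _)
  (near_mx_neq0 cR Rq : interior [set z' | Riem g j c d z' != 0] z).
exists j, z, (s *: (T *m n)), s, (fun t => E t *m T); have [E0 dE] := HE.
split=> //; first by rewrite E0 mul1mx.
move=> t t1; have [jt dEt] := dE t t1.
set zt := z + t *: (s *: (T *m n)) in jt dEt *.
have := line_transport HE t1; rewrite mtoK // -/zt => HEt.
have HTt := transport_comp HT HEt.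
have tet := tetrad_at HTt; rewrite mfromK // in tet.
have Rt : Riem g j c d zt != 0 := interior_subset (OE t t1).
split=> //.
- by have := Lam_transport pr N0 HTt; rewrite mfromK.
- move=> u v.
  have := sigma_form_derive pr (x := fun r : R => z + r *: (s *: (T *m n)))
    (T *m u) (T *m v) jt (line_derive z (s *: (T *m n)) t) dEt.
  rewrite -/zt !mulmxA; congr is_derive.
  by apply/funext => r; rewrite !mulmxA.
- have [al [be [ga [de [Kab RE]]]]] := HR HTt c d; rewrite mfromK // in RE.
  have de0 := Kde _ _ _ _ Kab.
  have RS := ricci_sigma pr d c jt; rewrite N0 // !mul0mx trmx0 !mulmx0 !subr0 addr0 in RS.
  have := Rt; rewrite RE in RS * => nz.
  have [k [kl kw]] := null_biv_commute (gcomp_sym g jt) tet (sigma_sym g g' jt) de0 nz RS.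
  exists k, al, be, ga; split => //; first by rewrite -de0.
  apply: contraNT Rt; rewrite !negb_or !negbK => /and3P[/eqP a0 /eqP b0 /eqP c0].
  by rewrite RE /null_biv de0 a0 b0 c0 !scale0r !addr0 mul0mx.
Qed.

(** As an eigenvector orthogonal to [y], [l] makes [sigma_form] of [l] and [y] vanish along the
    segment; its derivative at 0 is [s * a]. *)
Lemma kind6_Lam a : non_flat g -> K = kind6 -> Lam0 = a *: y -> a = 0.
Proof.
move=> nf K6 La.
have [|j [z [w [s [A [s0 wE HA]]]]]] := curved_line nf.
  by rewrite K6 => al be ga de [].
have n0 : `|0 : R| <= 1 by rewrite normr0 ler01.
have F0 (t : R) : 0 <= t <= 1 ->
    sigma_form g g' j (z + t *: w) (A t *m l) (A t *m y) = 0.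
  move=> /andP[t0 t1]; have t1' : `|t| <= 1 by rewrite ger0_norm.
  have [jt tet _ _ [k [al [be [ga [_ _ kl _]]]]]] := HA t t1'.
  by rewrite (sigma_form_eigen _ jt kl) (tetrad_dots (gcomp_sym g jt) tet) mulr0.
have [jt tet LE /(_ l y) dF _] := HA 0 n0.
have D := tetrad_dots (gcomp_sym g jt) tet.
have := is_derive_right_cst ltr01 F0 dF.
rewrite LE La; move: D (gcomp_sym g jt); move: (g j _) => h D hs.
rewrite wE -!scalemxAr !(dotZr, dotZl hs) !D.
rewrite !(mulr0, mulr1, mul0r, addr0) => /eqP.
by rewrite mulf_eq0 (gt_eqF s0) => /eqP.
Qed.

(* The eigenvalue of [l] has constant nonzero derivative, while the restriction of
   the form to the span of [x], [y] is constant and shares that eigenvalue. *)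
Lemma kind8_Lam a : non_flat g -> K = kind8 -> Lam0 = a *: l -> a = 0.
Proof.
move=> nf K8 La.
have [|j [z [w [s [A [s0 wE HA]]]]]] := curved_line nf.
  by rewrite K8 => al be ga de [].
have n0 : `|0 : R| <= 1 by rewrite normr0 ler01.
pose F u v (t : R) := sigma_form g g' j (z + t *: w) (A t *m u) (A t *m v).
(* Both the direction [n] and [Lam], a multiple of [l], are orthogonal to [x] and [y], so all terms
   of the derivative vanish. *)
have Fcst u v : u = x \/ u = y -> v = x \/ v = y ->
    forall t : R, 0 <= t <= 1 -> F u v t = F u v 0.
  move=> Hu Hv; apply: derive0_cst => t /andP[t0 t1].
  have t1' : `|t| <= 1 by rewrite ger0_norm.
  have [jt tet LE /(_ u v) dF _] := HA t t1'.
  have D := tetrad_dots (gcomp_sym g jt) tet.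
  apply: is_derive_eq dF _; rewrite LE La -!scalemxAr.
  rewrite !(dotZr, dotZl (gcomp_sym g jt)).
  by case: Hu => ->; case: Hv => ->; rewrite !D !(mulr0, mul0r, addr0).
have Q (t : R) : 0 <= t <= 1 ->
    (F x x 0 - F l n t) * (F y y 0 - F l n t) = F x y 0 ^+ 2.
  move=> t01; have /andP[t0 t1] := t01; have t1' : `|t| <= 1 by rewrite ger0_norm.
  have [jt tet _ _ [k [al [be [ga [Kab nz kl kw]]]]]] := HA t t1'.
  have D := tetrad_dots (gcomp_sym g jt) tet.
  move: Kab; rewrite K8 => -[al0 _]; rewrite al0 eqxx /= in nz.
  rewrite al0 scale0r add0r in kw.
  have C u v Hu Hv := Fcst u v Hu Hv t t01.
  rewrite -(C x x (or_introl erefl) (or_introl erefl)).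
  rewrite -(C y y (or_intror erefl) (or_intror erefl)).
  rewrite -(C x y (or_introl erefl) (or_intror erefl)).
  have -> : F l n t = k by rewrite /F (sigma_form_eigen _ jt kl) !D mulr1.
  (* The eigenvector equation for [be x + ga y], tested on [v]. Taking [v] to be [x] and [y] gives a
     homogeneous system of size 2 with a nonzero solution, and its determinant is the relation
     sought. *)
  have row v : be * F x v t + ga * F y v t =
      k * (be * dot j (z + t *: w) (A t *m x) (A t *m v)
           + ga * dot j (z + t *: w) (A t *m y) (A t *m v)).
    have := sigma_form_eigen (A t *m v) jt kw.
    rewrite /F /sigma_form !(dotDl (gcomp_sym g jt)) !(dotZl (gcomp_sym g jt)).
    by [].
  have ex := row x; have ey := row y; rewrite !D in ex ey.
  have yx : F y x t = F x y t.
    rewrite /F !sigma_formE // (dotC (gcomp_sym g jt)) /Defs.inner !trmx_mul.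
    by rewrite (gcomp_sym g jt) (sigma_sym g g' jt) !mulmxA.
  rewrite yx in ex.
  have [be0|be0] := eqVneq be 0.
    rewrite be0 eqxx /= in nz.
    have h1 : F x y t = 0 by apply: (mulfI nz); rewrite be0 in ex; lra.
    have h2 : F y y t = k by apply: (mulfI nz); rewrite be0 in ey; lra.
    by rewrite h1 h2 subrr mulr0 expr0n.
  apply: (mulfI be0).
  have h1 : be * (F x x t - k) = - (ga * F x y t) by lra.
  have h2 : ga * (F y y t - k) = - (be * F x y t) by lra.
  by rewrite mulrA h1 mulNr mulrAC h2; ring.
have [jt tet LE /(_ l n) dF _] := HA 0 n0.
have D := tetrad_dots (gcomp_sym g jt) tet.
have := quadratic_level Q dF.
rewrite LE La; move: D (gcomp_sym g jt); move: (g j _) => h D hs.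
rewrite wE -!scalemxAr !(dotZr, dotZl hs) !D.
rewrite !(mulr0, mulr1, mul0r, addr0) => /eqP.
by rewrite mulf_eq0 (gt_eqF s0) => /eqP.
Qed.

(** The parallel field vanishes everywhere once it vanishes at the base point. Since [Lam] is minus
    the invertible [sigma] applied to [psi], the form [psi] vanishes too. *)
Lemma connection_of_Lam0 : non_flat g -> Lam0 = 0 -> same_connection g g'.
Proof.
move=> nf L0 j q jq a b c; have jz := mrange_to jq.
have [T HT] := transport_exists g dom0 jq.
have := Lam_transport pr (nabLam_eq0 nf) HT; rewrite -/Lam0 L0 mulmx0.
move/eqP; rewrite oppr_eq0 /sigma -scalemxAl scaler_eq0.
rewrite (gt_eqF (rho_gt0 g g' j _)) /= => /eqP e.
have p0' : psi g g' j (mto M j q) = 0.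
  have := congr1 (mulmx (g' j (mto M j q))) e.
  by rewrite mulKVmx ?mulmx0 //; exact: metric_unit.
rewrite -!GamEntry (Gam_projective pr b jz) p0' trmx0 mulmx0 addr0.
by rewrite [(0 : pt) b 0]mxE raddf0 addr0.
Qed.

End HolonomyReduction.

(** The curvature pulled back to the base point lies in the algebra by [riemann_holonomy];
    conjugating back by [T] moves the tetrad and keeps the coefficients. *)
Lemma holonomy_curvature (R : realType) (M : manifold4 R) (g : lorentz_metric M)
    (i : mindex M) (p : M) (l n x y : 'cV[R]_4) (V : {vspace 'M[R]_4})
    (K : R -> R -> R -> R -> Prop) :
  (forall A, lie_algebra (holonomy_group g i p) A -> A \in V) ->
  (forall A, A \in V -> exists al be ga de,
     K al be ga de /\ A = null_biv l n x y al be ga de *m g i (mto M i p)) ->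
  forall j q T, transport g i p j q T -> forall c d, exists al be ga de,
    K al be ga de /\ Riem g j c d (mto M j q) =
      null_biv (T *m l) (T *m n) (T *m x) (T *m y) al be ga de *m g j (mto M j q).
Proof.
move=> HV HK j q T HT c d; have [_ _ iso] := transport_isometry HT.
have uT := transport_unit HT.
have [al [be [ga [de [Kab E]]]]] := HK _ (riemann_holonomy HV HT d c).
exists al, be, ga, de; split => //.
by rewrite -(null_biv_transport uT iso) -E !mulmxA mulmxV // mul1mx mulmxK.
Qed.

Theorem theorem6p4 (R : realType) (M : manifold4 R) (g g' : lorentz_metric M)
  (hnonflat : non_flat g)
  (hhol : holonomy_R6 g \/ holonomy_R8 g \/ holonomy_R12 g)
  (hproj : projectively_related g g') :
  same_connection g g'.
Proof.
case: hhol => [|[|[om om0]]].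
- move=> [p [i [l [n [x [y /= [ip nt HA]]]]]]].
  have tet := null_tetradW nt; have gs := gcomp_sym g (mrange_to ip).
  have D := tetrad_dots gs tet.
  have hK : hol_kind (@kind6 R) by exact: Or31.
  have HR := holonomy_curvature (fun A => (HA A).1) (@span_kind6 _ _ l n x y).
  have N0 := nabLam_eq0 hproj ip tet hK HR hnonflat.
  (* The inclusion of the holonomy algebra in the span constrained the curvature; the converse
     inclusion now makes each generator a velocity in a group that fixes [Lam]. *)
  have kill A HV := lie_algebra_Lam hproj N0 ((HA A).2 HV).
  have [//|lL nL] := bivector_kill gs (a := n) (b := l) D.1.1.1.1.1.1
    D.1.1.2.1.1.2 D.1.1.2.1.1.1 D.1.1.1.1.1.2 (kill _ _).
    by apply: memv_span; rewrite !inE eqxx.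
  have [//|_ xL] := bivector_kill gs (a := n) (b := x) D.1.1.1.1.1.1
    D.2.1.1.2 D.1.2.1.1.1 D.1.1.1.1.2 (kill _ _).
    by apply: memv_span; rewrite !inE eqxx orbT.
  have LE := tetrad_expand gs tet (Lam0 g g' i p).
  rewrite lL nL xL !scale0r !add0r in LE.
  apply: (connection_of_Lam0 hproj ip tet hK HR hnonflat).
  by rewrite LE (kind6_Lam hproj ip tet hK HR hnonflat erefl LE) scale0r.
- move=> [p [i [l [n [x [y /= [ip nt HA]]]]]]].
  have tet := null_tetradW nt; have gs := gcomp_sym g (mrange_to ip).
  have D := tetrad_dots gs tet.
  have hK : hol_kind (@kind8 R) by exact: Or32.
  have HR := holonomy_curvature (fun A => (HA A).1) (@span_kind8 _ _ l n x y).
  have N0 := nabLam_eq0 hproj ip tet hK HR hnonflat.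
  have kill A HV := lie_algebra_Lam hproj N0 ((HA A).2 HV).
  have [//|lL xL] := bivector_kill gs (a := n) (b := x) D.1.1.1.1.1.1
    D.2.1.1.2 D.1.2.1.1.1 D.1.1.1.1.2 (kill _ _).
    by apply: memv_span; rewrite !inE eqxx.
  have [//|_ yL] := bivector_kill gs (a := n) (b := y) D.1.1.1.1.1.1
    D.2.2 D.1.2.1.2 D.1.1.1.2 (kill _ _).
    by apply: memv_span; rewrite !inE eqxx orbT.
  have LE := tetrad_expand gs tet (Lam0 g g' i p).
  rewrite lL xL yL !scale0r !addr0 in LE.
  apply: (connection_of_Lam0 hproj ip tet hK HR hnonflat).
  by rewrite LE (kind8_Lam hproj ip tet hK HR hnonflat erefl LE) scale0r.
- move=> [p [i [l [n [x [y /= [ip nt HA]]]]]]].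
  have tet := null_tetradW nt; have gs := gcomp_sym g (mrange_to ip).
  have D := tetrad_dots gs tet.
  have hK : hol_kind (kind12 om) by apply: Or33; exists om.
  have HR := holonomy_curvature (fun A => (HA A).1) (@span_kind12 _ _ l n x y om).
  have N0 := nabLam_eq0 hproj ip tet hK HR hnonflat.
  have kill A HV := lie_algebra_Lam hproj N0 ((HA A).2 HV).
  have [//|lL xL] := bivector_kill gs (a := n) (b := x) D.1.1.1.1.1.1
    D.2.1.1.2 D.1.2.1.1.1 D.1.1.1.1.2 (kill _ _).
    by apply: memv_span; rewrite !inE eqxx.
  have [//|_ yL] := bivector_kill gs (a := n) (b := y) D.1.1.1.1.1.1
    D.2.2 D.1.2.1.2 D.1.1.1.2 (kill _ _).
    by apply: memv_span; rewrite !inE eqxx orbT.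
  (* With the other three products already zero, the third generator sends [Lam] to its product with
     [n] times [l]. *)
  have := kill _ (memv_span (mem_last _ _)).
  rewrite /= mulmxDl -scalemxAl !wedgeE !bivector_app.
  rewrite lL xL yL !scale0r !subr0 scaler0 addr0 => /eqP.
  rewrite scaler_eq0 (negPf (tetrad_neq0 gs tet).1) orbF => /eqP nL.
  apply: (connection_of_Lam0 hproj ip tet hK HR hnonflat).
  exact: (tetrad_eq0 gs tet lL nL xL yL).
Qed.
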